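(* Suppose $\sum_{n}\frac{|a_n|}{\lambda_n}<\infty$ and fix a compact interval $I=[\alpha_0,\alpha_1]\subset(0,1)$. Suppose that for some $m\in\mathbb{N}$, $m\ge1$, one has $S_1=\cdots=S_{m-1}=0$ and $S_m\ne0$, and that $c_m(\alpha)=\frac{(-1)^{m+1}}{\Gamma(1-m\alpha)}\ne0$ for all $\alpha\in I$. Let $\rho>1$. There exists $T_{I,\rho}>1$ such that, for all $t\ge T_{I,\rho}$, $M_\alpha(t)$ and $M_\alpha(\rho t)$ are non-zero for all $\alpha\in I$, and, with $R_\alpha(t,\rho)=\frac{M_\alpha(\rho t)}{M_\alpha(t)}$, $$R_\alpha(t,\rho)=\rho^{-m\alpha}\bigl(1+O(t^{-\alpha_0})\bigr)$$ uniformly for $\alpha\in I$. Moreover, $$\partial_\alpha\log|R_\alpha(t,\rho)|=-m\log\rho+O((1+\log t)t^{-\alpha_0})$$ uniformly for $\alpha\in I$. Consequently, for every sufficiently large $t$, the map $\alpha\mapsto\log|R_\alpha(t,\rho)|$ is strictly decreasing on $I$, and $$|\alpha-\widetilde\alpha|\le\frac{2}{m\log\rho}\Bigl|\log|R_\alpha(t,\rho)|-\log|R_{\widetilde\alpha}(t,\rho)|\Bigr|$$ for all $\alpha,\widetilde\alpha\in I$.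
   Context: Let $H$ be a real separable Hilbert space and $\mathcal{A}:\operatorname{Dom}(\mathcal{A})\subset H\to H$ a self-adjoint, strictly positive operator with compact resolvent, with eigenvalues counted with multiplicity $0<\lambda_1\le\lambda_2\le\cdots$ and an orthonormal eigenbasis $\{v_n\}$, $\mathcal{A}v_n=\lambda_nv_n$; in infinite dimensions $\lambda_n\to\infty$, and in finite dimensions the list of eigenvalues is finite and all spectral sums terminate accordingly. Let $\{a_n\}\subset\mathbb{R}$ be real coefficients. The resolvent moments are $S_k=\sum_{n}\frac{a_n}{\lambda_n^k}$, $k\ge1$. The scalar observation is $M_\alpha(t)=\sum_{n}a_nE_{\alpha,1}(-\lambda_nt^\alpha)$, $t>0$, $\alpha\in(0,1)$, where $E_{\alpha,1}(z)=\sum_{i\ge0}z^i/\Gamma(\alpha i+1)$ is the Mittag-Leffler function. The function $1/\Gamma$ is the entire reciprocal gamma function, vanishing at non-positive integers. The $O$-terms are as $t\to\infty$; ''uniformly for $\alpha\in I$'' means that the implied constant and the threshold on $t$ do not depend on $\alpha\in I$. *)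

(* Defs.v *)
From HB Require Import structures.
From mathcomp Require Import all_boot all_order all_algebra.
From mathcomp Require Import all_classical all_reals all_analysis.

Set Implicit Arguments.
Unset Strict Implicit.
Unset Printing Implicit Defensive.

Import Order.TTheory GRing.Theory Num.Theory.
Import numFieldNormedType.Exports.

Local Open Scope classical_set_scope.
Local Open Scope ring_scope.

Definition separable (T : topologicalType) : Prop :=
  exists S : set T, countable S /\ dense S.

(* A real Hilbert space is a complete normed module whose norm is the one
   induced by the given positive definite symmetric form. *)
Definition hilbert_norm (R : realType) (H : completeNormedModType R)
    (dot : {dot H for idfun}) : Prop :=
  forall x : H, dot x x = `|x| ^+ 2.

Section operators.
Context (R : realType) (H : completeNormedModType R).
Implicit Types (dot : {dot H for idfun}) (D : set H) (A : H -> H).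

(* An unbounded operator is a domain D together with a total function A whose
   values outside D play no role. *)
Definition linear_on D A : Prop :=
  D 0 /\ forall (c : R) (x y : H), D x -> D y ->
    D (c *: x + y) /\ A (c *: x + y) = c *: A x + A y.

(* The left-hand side of the equivalence says that (y, z) lies in the graph of
   the adjoint, the right-hand side that it lies in the graph of A. *)
Definition self_adjoint dot D A : Prop :=
  [/\ linear_on D A, dense D &
      forall y z : H,
        (forall x, D x -> dot (A x) y = dot x z) <-> (D y /\ A y = z)].

Definition strictly_positive dot D A : Prop :=
  forall x, D x -> x != 0 -> 0 < dot (A x) x.

Definition compact_operator (B : H -> H) : Prop :=
  linear B /\ precompact (B @` [set x | `|x| <= 1]).

Definition is_resolvent D A (mu : R) (B : H -> H) : Prop :=
  (forall y, D (B y) /\ A (B y) - mu *: B y = y) /\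
  (forall x, D x -> B (A x - mu *: x) = x).

Definition has_compact_resolvent D A : Prop :=
  exists (mu : R) (B : H -> H), is_resolvent D A mu B /\ compact_operator B.

(* Eigenvalues are indexed from 0; [dim] is [None] in infinite dimension and
   [Some N] in dimension N.  Only indices n with [below dim n] are meaningful. *)
Definition below (dim : option nat) (n : nat) : bool :=
  if dim is Some N then (n < N)%N else true.

Definition eigenbasis dot D A (dim : option nat) (lam : nat -> R)
    (v : nat -> H) : Prop :=
  [/\ forall n, below dim n -> D (v n) /\ A (v n) = lam n *: v n,
      forall n p, below dim n -> below dim p -> dot (v n) (v p) = (n == p)%:R &
      forall x, (fun k => \sum_(0 <= n < k | below dim n) dot x (v n) *: v n)
                  @ \oo --> x].

End operators.

Section eigenvalues.
Context (R : realType).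

Definition eigenvalue_list (dim : option nat) (lam : nat -> R) : Prop :=
  [/\ forall n, below dim n -> 0 < lam n,
      forall n p, (n <= p)%N -> below dim p -> lam n <= lam p &
      dim = None -> lam @ \oo --> +oo].

(* The series are limits of partial sums over the meaningful indices. *)
Definition resolvent_moment (dim : option nat) (a lam : nat -> R) (k : nat) : R :=
  \big[+%R/0]_(0 <= n <oo | below dim n) (a n / lam n ^+ k).

(* Euler's integral, meaningful for x > 0. *)
Definition Gamma (x : R) : R :=
  \int[lebesgue_measure]_(s in `]0, +oo[) (s `^ (x - 1) * expR (- s)).

(* The entire function 1/Gamma on the real line; for x <= 0 it is given by
   1/Gamma(x) = x (x+1) ... (x+n-1) / Gamma(x+n), with n the least natural
   number such that x + n > 0. *)
Definition rGamma (x : R) : R :=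
  if 0 < x then (Gamma x)^-1
  else let n := (Num.truncn (- x)).+1 in
       (\prod_(0 <= i < n) (x + i%:R)) / Gamma (x + n%:R).

Definition mittag_leffler (alpha beta z : R) : R :=
  \big[+%R/0]_(0 <= i <oo) (z ^+ i * rGamma (alpha * i%:R + beta)).

Definition observation (dim : option nat) (a lam : nat -> R) (alpha t : R) : R :=
  \big[+%R/0]_(0 <= n <oo | below dim n)
    (a n * mittag_leffler alpha 1 (- (lam n * t `^ alpha))).

Definition observation_ratio (dim : option nat) (a lam : nat -> R) (alpha t rho : R) : R :=
  observation dim a lam alpha (rho * t) / observation dim a lam alpha t.

Definition leading_coef (m : nat) (alpha : R) : R :=
  (-1) ^+ m.+1 * rGamma (1 - m%:R * alpha).

(* f alpha t = O(g t) as t tends to +oo, uniformly for alpha in I. *)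
Definition uniform_bigO (I : set R) (f : R -> R -> R) (g : R -> R) : Prop :=
  exists C : R, \forall t \near +oo,
    forall alpha, I alpha -> `|f alpha t| <= C * `|g t|.

End eigenvalues.

(* Main.v *)
Require Import Defs.
From HB Require Import structures.
From mathcomp Require Import all_boot all_order all_algebra.
From mathcomp Require Import all_classical all_reals all_analysis.
From mathcomp Require Import measurable_realfun.
From mathcomp Require Import ring lra.

Set Implicit Arguments.
Unset Strict Implicit.
Unset Printing Implicit Defensive.

Import Order.TTheory GRing.Theory Num.Theory.
Import numFieldNormedType.Exports.

Local Open Scope classical_set_scope.
Local Open Scope ring_scope.

(** Each mode relaxes through a superposition of exponentials:
    [pi * E_al(- lam t^al)] is the Laplace transform in [r] of the explicit
    kernel [mlker al lam r] ([relaxation_mittag_leffler]).  With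
    [y = r^al / lam] and [th = al * pi], the product [r * mlker] is the imaginary
    part of [y e^(i th) / (1 + y e^(i th))], the sum of a geometric series in
    [y], and the tail of that series after [m] terms is [O(y^m.+1)] with a
    constant that depends neither on [lam] nor on [al] in a compact interval; its
    derivative in [al] only costs a factor [1 + |ln r|] ([mlker_expansion],
    [mlker_rem_bound], [mlker_rem_d_bound]).  Integrating against [e^(-t r)] and
    summing over the modes, the [k]-th term of the series contributes
    [S_k t^(- k al)] up to a factor that depends on [al] alone, so that only
    the term [k = m] survives:
      [pi t^(m al) M_al(t) = A(al) + Q(al, t)], where
      [A(al) = S_m (-1)^(m-1) sin(m al pi) Gamma(m al)],
      [Q = O(t^(- al))] and [dQ/d al = O((1 + ln t) t^(- al))]
    ([spectral_sum_leading], [leading_bounds]).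

    If [A(al)] vanished, [m al] would be a positive integer and
    [1 / Gamma(1 - m al)] would vanish too; hence [A] has no zero on the compact
    interval, and [|A|] is bounded below there ([leading_neq0],
    [leading_lower_bound]).  For large [t] the function [N = A + Q] then has no
    zero either, and [R_al(t, rho) = rho^(- m al) N(al, rho t) / N(al, t)].  The
    two expansions are the value and the logarithmic derivative of this formula
    ([log_ratio_asymptotics]); once the error in the derivative is below
    [m ln rho / 2], the mean value theorem gives monotonicity and the stability
    estimate.

    The integral representation is obtained by comparing Laplace transforms in [t].
    Integrating the Mittag-Leffler series term by term gives
    [p^(al - 1) / (p^al + lam)] for large [p] ([laplace_mittag_leffler]); on the
    other side Tonelli's theorem leaves the Stieltjes integral of [mlker], which a
    rotation of the path of integration evaluates ([integral_mlker_stieltjes]); and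
    a continuous function is determined by the values of its Laplace transform on an
    arithmetic progression ([laplace_eq0]). *)

Notation Rpos := (`]0, +oo[%classic).

(** * Derivatives of real functions *)

Section derivative_rules.
Context {R : realType}.
Implicit Types (f g : R -> R) (x df dg c : R).

(** The rules of differentiation on pointwise expressions rather than on operations
    between functions: nested, they compute the derivative of an explicit formula. *)
Lemma isd_cst c x : is_derive x 1 (fun=> c) 0.
Proof. exact: is_derive_cst. Qed.

Lemma isd_add f g x df dg : is_derive x 1 f df -> is_derive x 1 g dg ->
  is_derive x 1 (fun y => f y + g y) (df + dg).
Proof. by move=> ? ?; exact: is_deriveD. Qed.

Lemma isd_opp f x df : is_derive x 1 f df -> is_derive x 1 (fun y => - f y) (- df).
Proof. by move=> ?; exact: is_deriveN. Qed.

Lemma isd_mul f g x df dg : is_derive x 1 f df -> is_derive x 1 g dg ->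
  is_derive x 1 (fun y => f y * g y) (df * g x + f x * dg).
Proof.
move=> ? ?; apply: is_derive_eq.
by rewrite /= /GRing.scale /= addrC mulrC.
Qed.

Lemma isd_inv f x df : f x != 0 -> is_derive x 1 f df ->
  is_derive x 1 (fun y => (f y)^-1) (- df / f x ^+ 2).
Proof.
move=> fx0 ?; have ? := is_deriveV fx0; apply: is_derive_eq.
by rewrite /= /GRing.scale /= mulNr mulrC mulNr.
Qed.

Lemma isd_comp f g x df dg : is_derive (g x) 1 f df -> is_derive x 1 g dg ->
  is_derive x 1 (fun y => f (g y)) (df * dg).
Proof. by move=> ? ?; exact: is_derive1_comp. Qed.

Lemma isd_scale c f x df : is_derive x 1 f df ->
  is_derive x 1 (fun y => c * f y) (c * df).
Proof.
move=> h; apply: (is_derive_eq (isd_mul (isd_cst c x) h)).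
by rewrite mul0r add0r.
Qed.

Lemma isd_powR_base a x : 0 < x -> is_derive x 1 (fun y => y `^ a) (a * x `^ a / x).
Proof.
move=> x0; apply: (is_derive_eq (is_derive1_powR a x0)).
by rewrite -mulrA powRB ?powRr1 ?(ltW x0)// (gt_eqF x0) implybT.
Qed.

Lemma isd_powR_exp c x : 0 < c -> is_derive x 1 (fun y => c `^ y) (ln c * c `^ x).
Proof.
move=> c0.
have -> : (fun y => c `^ y) = (fun y => expR (ln c * y)).
  by apply/funext => y; rewrite /powR gt_eqF// mulrC.
have h := isd_scale (ln c) (@is_derive_id _ _ x 1).
apply: (is_derive_eq (isd_comp (is_derive_expR _) h)).
by rewrite mulr1 mulrC /powR gt_eqF// (mulrC x).
Qed.

Lemma isd_continuous f x df : is_derive x 1 f df -> {for x, continuous f}.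
Proof.
by move=> [h _]; exact/differentiable_continuous/derivable1_diffP.
Qed.

End derivative_rules.

(** * Integrals over the positive half-line *)

Section half_line_integrals.
Context {R : realType}.
Notation mu := (@lebesgue_measure R).
Implicit Types (f F : R -> R).

Lemma Rpos_gt0 (r : R) : Rpos r -> 0 < r.
Proof. by rewrite /= in_itv/= andbT. Qed.

Lemma measurable_Rpos : measurable (Rpos : set (measurableTypeR R)).
Proof. exact: measurable_itv. Qed.

Lemma continuous_Rpos_measurable f : (forall x : R, 0 < x -> {for x, continuous f}) ->
  measurable_fun (Rpos : set R) f.
Proof.
move=> cf; apply: open_continuous_measurable_fun; first exact: interval_open.
by move=> x; rewrite inE/= in_itv/= andbT => x0; exact: cf.
Qed.

Lemma segment_integral_derivative f F (a b : R) : 0 < a -> a < b ->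
  (forall x : R, 0 < x -> {for x, continuous f}) ->
  (forall x : R, 0 < x -> is_derive x 1 F (f x)) ->
  (\int[mu]_(x in `[a, b]) (f x)%:E = (F b - F a)%:E)%E.
Proof.
move=> a0 ab cf dF; rewrite EFinB; apply: continuous_FTC2 => //.
- apply: continuous_in_subspaceT => x; rewrite inE/= in_itv/= => /andP[ax _].
  by apply: cf; exact: lt_le_trans ax.
- have cF x : 0 < x -> {for x, continuous F} by move=> x0; exact: isd_continuous (dF _ x0).
  split.
  + by move=> x; rewrite in_itv/= => /andP[ax _]; have [] := dF x (lt_trans a0 ax).
  + by apply: cvg_at_right_filter; exact: cF.
  + by apply: cvg_at_left_filter; apply: cF; exact: lt_trans ab.
- move=> x; rewrite in_itv/= => /andP[ax _]; rewrite derive1E.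
  by have [] := dF x (lt_trans a0 ax).
Qed.

Let E n : set R := `[n.+2%:R^-1, n.+2%:R].

Let E_ne n : 0 < (n.+2%:R^-1 : R) < n.+2%:R.
Proof.
rewrite invr_gt0 ltr0n/= (@le_lt_trans _ _ 1) ?invf_le1 ?ler1n ?ltr0n//.
by rewrite ltr1n.
Qed.

Let E_nd : nondecreasing_seq E.
Proof.
move=> m n mn; apply/subsetPset; apply: subset_itv; rewrite bnd_simp.
  by rewrite lef_pV2 ?posrE ?ltr0n// ler_nat !ltnS.
by rewrite ler_nat !ltnS.
Qed.

Let E_cover x : 0 < x -> exists N, forall n, (N <= n)%N -> E n x.
Proof.
move=> x0; exists (maxn (Num.truncn x).+1 (Num.truncn x^-1).+1) => n.
rewrite geq_max => /andP[h1 h2]; rewrite /E/= in_itv/=; apply/andP; split.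
  rewrite invf_ple ?posrE ?ltr0n// (le_trans (ltW (truncnS_gt _)))// ler_nat.
  by rewrite (leq_trans h2)//; apply/leqW/leqnSn.
rewrite (le_trans (ltW (truncnS_gt _)))// ler_nat.
by rewrite (leq_trans h1)//; apply/leqW/leqnSn.
Qed.

Let bigcup_E : \bigcup_n E n = Rpos.
Proof.
apply/seteqP; split=> [x [n _]|x].
  rewrite /E /= !in_itv/= andbT => /andP[h _]; apply: lt_le_trans h.
  by have /andP[] := E_ne n.
rewrite /= in_itv/= andbT => /E_cover[N h]; exists N => //; exact: h.
Qed.

(** For a nonnegative function the integrals over the exhausting segments
    [[1/n, n]] increase to the integral over the half-line, and a bounded primitive
    bounds them all. *)
Lemma integrable_of_bounded_primitive f F (B : R) :
  (forall x : R, 0 < x -> {for x, continuous f}) -> (forall x : R, 0 < x -> 0 <= f x) ->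
  (forall x : R, 0 < x -> is_derive x 1 F (f x)) ->
  (forall x : R, 0 < x -> `|F x| <= B) ->
  mu.-integrable (Rpos : set R) (EFin \o f).
Proof.
move=> cf f0 dF FB.
have mf := continuous_Rpos_measurable cf.
have E0 n x : E n x -> 0 < x.
  move=> Enx; have : (\bigcup_n E n) x by exists n.
  by rewrite bigcup_E/= in_itv/= andbT.
have mfE n : measurable_fun (E n) (EFin \o f).
  have mf' : measurable_fun (Rpos : set R) (EFin \o f) by exact/measurable_EFinP.
  by apply: measurable_funS mf' => //; rewrite -bigcup_E; exact: bigcup_sup.
apply/integrableP; split; first exact/measurable_EFinP.
rewrite (@eq_integral _ _ _ mu Rpos (EFin \o f)); last first.
  by move=> x; rewrite inE/= in_itv/= andbT => x0; rewrite ger0_norm ?f0.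
apply: (@le_lt_trans _ _ (B + B)%:E); last by rewrite ltry.
have := @ge0_nondecreasing_set_cvg_integral _ (measurableTypeR R) _ E (EFin \o f) mu E_nd.
rewrite bigcup_E => /(_ _ _ _)/cvg_lim <- //.
- apply: lime_le.
    apply: ereal_nondecreasing_is_cvgn.
    apply: (@ge0_nondecreasing_set_nondecreasing_integral _ (measurableTypeR R) _ E
      (EFin \o f) mu E_nd _ mfE) => [n|n x /E0 x0].
      exact: measurable_itv.
    by rewrite lee_fin f0.
  apply: nearW => n; have /andP[a b] := E_ne n.
  rewrite (segment_integral_derivative _ _ cf dF)// lee_fin.
  apply: (le_trans (ler_norm _)); apply: (le_trans (ler_normB _ _)).
  by rewrite lerD// FB// (lt_trans a).
- by move=> n; exact: measurable_itv.
- by move=> n x /E0 x0; rewrite lee_fin f0.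
Qed.

(** Dominated convergence along the same segments, with [f] itself as the
    dominating function. *)
Lemma Rintegral_improper f F (l L : R) :
  (forall x : R, 0 < x -> {for x, continuous f}) ->
  mu.-integrable (Rpos : set R) (EFin \o f) ->
  (forall x : R, 0 < x -> is_derive x 1 F (f x)) ->
  F x @[x --> 0^'+] --> l -> F x @[x --> +oo] --> L ->
  \int[mu]_(x in Rpos) f x = L - l.
Proof.
move=> cf intf dF Fl FL.
have E0 n x : E n x -> 0 < x.
  move=> Enx; have : (\bigcup_n E n) x by exists n.
  by rewrite bigcup_E/= in_itv/= andbT.
have mf : measurable_fun (Rpos : set R) (EFin \o f) := measurable_int _ intf.
have mE n : measurable (E n) by exact: measurable_itv.
have [] := @dominated_convergence _ _ _ mu Rpos (measurable_itv _)
  (fun n => (EFin \o f) \_ (E n)) (EFin \o f) (abse \o (EFin \o f)) _ mf _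
  (integrable_abse intf).
- move=> n; have mfI : measurable_fun (Rpos `&` E n) (EFin \o f).
    by apply: measurable_funS mf => //; exact: subIsetl.
  exact: ((measurable_restrict (EFin \o f) (mE n) (measurable_itv `]0, +oo[)).1 mfI).
- apply: aeW => x; rewrite /= in_itv/= andbT => /E_cover[N hN].
  apply: cvg_near_cst; exists N => // n /= Nn.
  by rewrite patchE mem_set//; exact: hN.
- apply: aeW => x n _; rewrite patchE; case: ifPn => // _.
  by rewrite abse0 abse_ge0.
move=> _ _ cv.
have cv2 : (F n.+2%:R - F n.+2%:R^-1)%:E @[n --> \oo] -->
    (\int[mu]_(x in Rpos) (f x)%:E)%E.
  apply: cvg_trans cv; apply: near_eq_cvg; apply: nearW => n /=.
  rewrite -integral_mkcondr setIidr; last first.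
    by rewrite -bigcup_E; exact: bigcup_sup.
  by rewrite (segment_integral_derivative _ _ cf dF)//; case/andP: (E_ne n).
have S2 : (n.+2%:R : R) @[n --> \oo] --> +oo.
  apply/cvgryPge => A; exists (Num.truncn A).+1 => // n /= h.
  by rewrite (le_trans (ltW (truncnS_gt _)))// ler_nat; exact/leqW/leqW.
have c1 : F n.+2%:R @[n --> \oo] --> L by apply: cvg_comp FL.
have c2 : F n.+2%:R^-1 @[n --> \oo] --> l.
  move/cvg_at_rightP : Fl; apply; split.
    by move=> n; rewrite invr_gt0 ltr0n.
  by apply/gtr0_cvgV0 => //; exact: nearW.
have c3 : (F n.+2%:R - F n.+2%:R^-1)%:E @[n --> \oo] --> (L - l)%:E.
  by apply: cvg_EFin; [exact: nearW|exact: cvgB].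
by rewrite /Rintegral (cvg_unique _ cv2 c3).
Qed.

Let Ey n : set R := `[n.+1%:R^-1, +oo[.

Let bigcup_Ey c : 0 < c -> \bigcup_n [set` `[c * n.+1%:R^-1, +oo[] = (Rpos : set R).
Proof.
move=> c0; apply/seteqP; split=> [x [n _]|x].
  rewrite /Ey /= !in_itv/= !andbT; apply: lt_le_trans.
  by rewrite mulr_gt0// invr_gt0 ltr0n.
rewrite /= in_itv/= andbT => x0; exists (Num.truncn (c / x)) => //=.
rewrite in_itv/= andbT ler_pdivrMr ?ltr0n// mulrC -ler_pdivrMr//.
by rewrite ltW// truncnS_gt.
Qed.

(** The substitution theorem on the half-lines [[e, +oo[], exhausted as [e] tends
    to 0. *)
Lemma ge0_integral_Rpos_scale (c : R) f : 0 < c ->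
  (forall x : R, 0 < x -> {for x, continuous f}) -> (forall x : R, 0 < x -> 0 <= f x) ->
  (\int[mu]_(x in Rpos) (f x)%:E = \int[mu]_(x in Rpos) (c * f (c * x))%:E)%E.
Proof.
move=> c0 cf f0.
have cfc (x : R) : 0 < x -> {for x, continuous (fun y => c * f (c * y))}.
  move=> x0.
  have h : (fun y => f (c * y)) y @[y --> x] --> f (c * x).
    apply: (@continuous_comp _ _ _ (fun y => c * y) f).
      exact: (@mulrl_continuous _ c x).
    by apply: cf; rewrite mulr_gt0.
  exact: (cvgM (cvg_cst c) h).
have key n : (\int[mu]_(x in `[(c * n.+1%:R^-1)%R, +oo[) (f x)%:E =
              \int[mu]_(x in Ey n) (c * f (c * x))%:E)%E.
  have n0 : 0 < n.+1%:R^-1 :> R by rewrite invr_gt0 ltr0n.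
  have dE (y : R) : is_derive y 1 (fun x => c * x) c.
    by apply: (is_derive_eq (isd_scale c (@is_derive_id _ _ y 1))); rewrite mulr1.
  have d1E : (fun x : R => c * x)^`()%classic = cst c.
    by apply/funext => y; rewrite derive1E; have [_ ->] := dE y.
  rewrite (@increasing_ge0_integration_by_substitutiony _ (fun x => c * x) f).
  - by apply: eq_integral => x _; rewrite d1E /= mulrC.
  - by move=> x y _ _ xy; rewrite ltr_pM2l.
  - by move=> x _; rewrite d1E; exact: cst_continuous.
  - by rewrite d1E; exact: is_cvg_cst.
  - by rewrite d1E; exact: is_cvg_cst.
  - split; first by move=> x _; have [] := dE x.
    by apply: cvg_at_right_filter; exact: mulrl_continuous.
  - exact: gt0_cvgMry.
  - apply: continuous_in_subspaceT => x; rewrite inE/= in_itv/= andbT => h.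
    by apply: cf; rewrite (lt_le_trans _ h)// mulr_gt0.
  - move=> x; rewrite in_itv/= andbT => h; apply: f0.
    by rewrite (lt_trans _ h)// mulr_gt0.
have lim1 (g : R -> R) (e : R) : 0 < e ->
    (forall x : R, 0 < x -> {for x, continuous g}) -> (forall x : R, 0 < x -> 0 <= g x) ->
    (\int[mu]_(x in `[(e * n.+1%:R^-1)%R, +oo[) (g x)%:E)%E @[n --> \oo] -->
    (\int[mu]_(x in Rpos) (g x)%:E)%E.
  move=> e0 cg g0.
  have pos n x : `[e * n.+1%:R^-1, +oo[%classic x -> 0 < x.
    rewrite /= in_itv/= andbT; apply: lt_le_trans.
    by rewrite mulr_gt0// invr_gt0 ltr0n.
  have mg : measurable_fun (Rpos : set R) (EFin \o g).
    by apply/measurable_EFinP; exact: continuous_Rpos_measurable.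
  have := @ge0_nondecreasing_set_cvg_integral _ (measurableTypeR R) _
    (fun n => [set` `[e * n.+1%:R^-1, +oo[]) (EFin \o g) mu.
  rewrite bigcup_Ey//; apply.
  - move=> m n mn; apply/subsetPset; apply: subset_itvr; rewrite bnd_simp.
    by rewrite ler_pM2l// lef_pV2 ?posrE ?ltr0n// ler_nat ltnS.
  - by move=> n.
  - move=> n; apply: measurable_funS mg => //.
    by move=> x /pos x0; rewrite /= in_itv/= x0.
  - by move=> n x /pos x0; rewrite lee_fin g0.
have l1 := lim1 f c c0 cf f0.
have l2 := lim1 _ 1 ltr01 cfc (fun x x0 => mulr_ge0 (ltW c0) (f0 _ (mulr_gt0 c0 x0))).
move: l1; under eq_fun do rewrite key /Ey -[X in `[X, +oo[]mul1r.
by move=> l1; exact: (cvg_unique _ l1 l2).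
Qed.

End half_line_integrals.

(** * Differentiation under the integral sign *)

Section under_integral.
Context {R : realType} {d : measure_display} {Y : measurableType d}
  (mu : {measure set Y -> \bar R}).

(** The derivative under the integral sign, with the partial derivative given
    explicitly. *)
Lemma is_derive_under_integral (f df : R -> Y -> R) (B : set Y) (G : Y -> R)
    (u v a : R) : measurable B -> u < a < v ->
  (forall x, u < x < v -> mu.-integrable B (EFin \o f x)) ->
  (forall x y, u < x < v -> B y -> is_derive x 1 (f ^~ y) (df x y)) ->
  mu.-integrable B (EFin \o G) ->
  (forall x y, u < x < v -> B y -> `|df x y| <= G y) ->
  is_derive a 1 (fun x => \int[mu]_(y in B) f x y) (\int[mu]_(y in B) df a y).
Proof.
move=> mB uav intf dfE intG dfG.
have Ia : `]u, v[%classic a by rewrite /= in_itv.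
have inI x : `]u, v[%classic x -> u < x < v by rewrite /= in_itv.
have d1E x y : `]u, v[%classic x -> B y -> partial1of2 f x y = df x y.
  by move=> /inI Ix By; rewrite partial1of2E; have [_ ->] := dfE _ _ Ix By.
have intf' x : `]u, v[%classic x -> mu.-integrable B (EFin \o f x).
  by move=> /inI; exact: intf.
have derf x y : `]u, v[%classic x -> B y -> derivable (f ^~ y) x 1.
  by move=> /inI Ix By; have [] := dfE _ _ Ix By.
have Gge0 y : 0 <= `|G y| by [].
have intG' : mu.-integrable B (EFin \o (fun y => `|G y|)).
  exact: integrable_norm intG.
have Gub x y : `]u, v[%classic x -> B y -> `|partial1of2 f x y| <= `|G y|.
  by move=> Ix By; rewrite d1E// (le_trans (dfG _ _ (inI _ Ix) By))// ler_norm.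
have -> : \int[mu]_(y in B) df a y = \int[mu]_(y in B) (partial1of2 f ^~ y) a.
  by apply: eq_Rintegral => y; rewrite inE => By; rewrite d1E.
have dF := derivable_under_integral mB Ia intf' derf Gge0 intG' Gub.
apply: DeriveDef => //; rewrite -derive1E.
exact: (differentiation_under_integral mB Ia intf' derf Gge0 intG' Gub).
Qed.

End under_integral.

(** * Series as integrals for the counting measure *)

Section series_as_integrals.
Context {R : realType}.
Implicit Types (u : nat -> R).
Notation count := (@counting nat R).

(** Absolute summability is integrability for the counting measure; this transfers
    to series the theorems on integrals that depend on a parameter. *)
Definition abs_summable (u : nat -> R) : Prop := cvgn (series (fun n => `|u n|)).

Lemma abs_summable_cvg u : abs_summable u -> cvgn (series u).
Proof. exact: normed_cvg. Qed.

Lemma abs_summable_le u v : (forall n, `|u n| <= v n) -> cvgn (series v) -> abs_summable u.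
Proof.
move=> uv cv; apply: series_le_cvg cv => // n; exact: le_trans (uv n).
Qed.

Lemma lim_series_scale c u : cvgn (series u) ->
  limn (series (fun n => c * u n)) = c * limn (series u).
Proof. exact: (@lim_seriesZ R u c). Qed.

Lemma lim_series_add u v : cvgn (series u) -> cvgn (series v) ->
  limn (series (fun n => u n + v n)) = limn (series u) + limn (series v).
Proof. exact: lim_seriesD. Qed.

Lemma abs_summable_scale c u : abs_summable u -> abs_summable (fun n => c * u n).
Proof.
move=> su; apply: (@abs_summable_le _ (fun n => `|c| * `|u n|)) => [n|].
  by rewrite normrM.
exact: (@is_cvg_seriesZ R (fun n => `|u n|) `|c|).
Qed.

Lemma eseries_EFin u : cvgn (series u) ->
  (\sum_(k <oo) (u k)%:E = (limn (series u))%:E)%E.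
Proof.
move=> cu; rewrite -EFin_lim//; congr (limn _); apply/funext => n /=.
by rewrite sumEFin.
Qed.

Lemma abs_summable_summable u : abs_summable u -> summable setT (EFin \o u).
Proof.
move=> cu; rewrite /summable -nneseries_esumT//=.
by rewrite eseries_EFin// ltry.
Qed.

Lemma integrable_counting u : abs_summable u -> count.-integrable setT (EFin \o u).
Proof.
move=> cu; apply/integrableP; split; first by [].
rewrite integral_count /=; first by rewrite eseries_EFin// ltry.
apply: (@abs_summable_summable (fun n => `|u n|)).
by rewrite /abs_summable; under eq_fun do rewrite normr_id.
Qed.

Lemma Rintegral_counting u : abs_summable u ->
  \int[count]_(n in setT) u n = limn (series u).
Proof.
move=> cu; rewrite /Rintegral integral_count; last exact: abs_summable_summable.
by rewrite eseries_EFin//; exact: abs_summable_cvg.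
Qed.

(** [is_derive_under_integral] for the counting measure. *)
Lemma is_derive_series (f df : R -> nat -> R) (G : nat -> R) (u v a : R) : u < a < v ->
  (forall x, u < x < v -> abs_summable (f x)) ->
  (forall x n, u < x < v -> is_derive x 1 (f ^~ n) (df x n)) ->
  abs_summable G -> (forall x n, u < x < v -> `|df x n| <= G n) ->
  is_derive a 1 (fun x => limn (series (f x))) (limn (series (df a))).
Proof.
move=> uav sf fE sG dfG.
have sdf : abs_summable (df a).
  apply: (@abs_summable_le _ (fun n => `|G n|)) => // n.
  by rewrite (le_trans (dfG _ n uav))// ler_norm.
rewrite -(Rintegral_counting sdf).
have := @is_derive_under_integral R _ _ count f df setT G u v a measurableT uav
  (fun x xuv => integrable_counting (sf x xuv)) (fun x n xuv _ => fE x n xuv)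
  (integrable_counting sG) (fun x n xuv _ => dfG x n xuv).
apply: near_eq_is_derive; near=> x; apply: Rintegral_counting; apply: sf.
have : x \in `]u, v[ by near: x; apply: near_in_itvoo; rewrite in_itv.
by rewrite in_itv.
Unshelve. all: by end_near. Qed.

Lemma continuous_series (f : R -> nat -> R) (G : nat -> R) (u v a : R) : u < a < v ->
  (forall n x, u < x < v -> {for x, continuous (f ^~ n)}) ->
  abs_summable G -> (forall x n, u < x < v -> `|f x n| <= G n) ->
  {for a, continuous (fun x => limn (series (f x)))}.
Proof.
move=> uav cf sG fG.
have sf x : u < x < v -> abs_summable (f x).
  move=> xuv; apply: (@abs_summable_le _ (fun n => `|G n|)) => // n.
  by rewrite (le_trans (fG _ n xuv))// ler_norm.
have inI x : `]u, v[%classic x -> u < x < v by rewrite /= in_itv.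
have := @continuity_under_integral R _ _ count f setT measurableT u v
  (fun x xuv => integrable_counting (sf x (inI x xuv))) _ G (integrable_counting sG)
  (fun x xuv => aeW _ (fun n _ => fG x n (inI x xuv))).
have h0 : {ae count, forall n, setT n -> {in `]u, v[%classic, continuous (f ^~ n)}}.
  by apply: aeW => n _ x; rewrite inE => /inI; exact: cf.
move=> /(_ h0 a); rewrite inE /= in_itv/= uav => /(_ isT) h.
rewrite /prop_for /continuous_at -Rintegral_counting; last exact: sf.
apply: cvg_trans h; apply: near_eq_cvg; near=> x; apply: Rintegral_counting; apply: sf.
have : x \in `]u, v[ by near: x; apply: near_in_itvoo; rewrite in_itv.
by rewrite in_itv.
Unshelve. all: by end_near. Qed.

End series_as_integrals.

(** * Termwise integration *)

Section integral_of_series.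
Context {R : realType} {d : measure_display} {Y : measurableType d}
  (mu : {measure set Y -> \bar R}).

(** Dominated convergence of the partial sums, the dominating function being the sum
    of the norms, which is integrable by monotone convergence. *)
Lemma Rintegral_series (f : nat -> Y -> R) (B : set Y) : measurable B ->
  (forall n, mu.-integrable B (EFin \o f n)) ->
  (forall y, B y -> abs_summable (f ^~ y)) ->
  cvgn (series (fun n => \int[mu]_(y in B) `|f n y|)) ->
  mu.-integrable B (EFin \o (fun y => limn (series (f ^~ y)))) /\
  \int[mu]_(y in B) limn (series (f ^~ y)) = limn (series (fun n => \int[mu]_(y in B) f n y)).
Proof.
move=> mB intf sf ci.
have mf n : measurable_fun B (f n) by exact/measurable_EFinP/(measurable_int _ (intf n)).
have mfn n : measurable_fun B (fun y => `|f n y|%:E).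
  by apply/measurable_EFinP; apply: measurableT_comp.
pose G y := (\sum_(n <oo) `|f n y|%:E)%E.
have GE y : B y -> G y = (limn (series (fun n => `|f n y|)))%:E.
  by move=> By; rewrite /G eseries_EFin//; exact: sf.
have intE n : (\int[mu]_(y in B) `|f n y|%:E = (\int[mu]_(y in B) `|f n y|)%:E)%E.
  by rewrite /Rintegral fineK// integrable_fin_num//; exact: integrable_norm (intf n).
have mG : measurable_fun B G.
  apply: ge0_emeasurable_sum => // n y By _; rewrite lee_fin//.
have intG : mu.-integrable B G.
  apply/integrableP; split=> //.
  rewrite (@eq_integral _ _ _ mu B G); last first.
    move=> y; rewrite inE => By; rewrite gee0_abs//.
    by apply: nneseries_ge0 => n _ _; rewrite lee_fin.
  rewrite integral_nneseries//.
  by under eq_eseriesr do rewrite intE; rewrite eseries_EFin// ltry.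
have sumE k y : (series (f ^~ y) k)%:E = (\sum_(0 <= i < k) (f i y)%:E)%E.
  by rewrite /series /= sumEFin.
have mS k : measurable_fun B (fun y => (series (f ^~ y) k)%:E).
  under eq_fun do rewrite sumE.
  by apply: emeasurable_sum => n; exact/measurable_EFinP.
have cvS y : B y -> (series (f ^~ y) k)%:E @[k --> \oo] --> (limn (series (f ^~ y)))%:E.
  by move=> By; apply: cvg_EFin; [exact: nearW|exact/abs_summable_cvg/sf].
have mL : measurable_fun B (EFin \o (fun y => limn (series (f ^~ y)))).
  exact: (emeasurable_fun_cvg _ _ mS cvS).
have [||intL _ cvI] := @dominated_convergence _ _ _ mu B mB
  (fun k y => (series (f ^~ y) k)%:E) (EFin \o (fun y => limn (series (f ^~ y)))) G mS mL _ intG.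
- exact: aeW.
- apply: aeW => y k By; rewrite /G /series.
  apply: (@le_trans _ _ (\sum_(0 <= i < k) `|f i y|%:E)%E); last exact: nneseries_lim_ge.
  by rewrite sumEFin lee_fin ler_norm_sum.
split=> //; rewrite /Rintegral; symmetry.
have E k : (\int[mu]_(y in B) (series (f ^~ y) k)%:E)%E =
    (series (fun n => \int[mu]_(y in B) f n y) k)%:E.
  under eq_integral do rewrite sumE.
  rewrite integral_sum// /series/= -sumEFin; apply: eq_bigr => n _.
  by rewrite /Rintegral fineK//; exact: (integrable_fin_num mB (intf n)).
have {}cvI : EFin \o series (fun n => \int[mu]_(y in B) f n y) @ \oo -->
    (\int[mu]_(y in B) (limn (series (f ^~ y)))%:E)%E.
  apply: cvg_trans cvI; apply: near_eq_cvg; apply: nearW => k /=.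
  by rewrite -E.
rewrite -[X in _ --> X](fineK (integrable_fin_num mB intL)) in cvI.
by apply/cvg_lim => //; exact: fine_cvg cvI.
Qed.

End integral_of_series.

(** * Holomorphic functions in polar coordinates *)

Section polar_holomorphic.
Context {R : realType}.
Implicit Types (p q : R * R) (F G : R -> R -> R * R).

(** Complex numbers as pairs of reals, with the squared modulus as [c2norm]; every
    limit, derivative and integral taken below is that of one real coordinate. *)
Definition c2add p q := (p.1 + q.1, p.2 + q.2).
Definition c2mul p q := (p.1 * q.1 - p.2 * q.2, p.1 * q.2 + p.2 * q.1).
Definition c2norm p := p.1 ^+ 2 + p.2 ^+ 2.
Definition c2inv p := (p.1 / c2norm p, - p.2 / c2norm p).

(** A bound on both coordinates rather than on the modulus, at the price of a factor
    2 for each product. *)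
Definition c2bound p (b : R) := `|p.1| <= b /\ `|p.2| <= b.

Lemma c2bound_add p q b c : c2bound p b -> c2bound q c -> c2bound (c2add p q) (b + c).
Proof.
by move=> [h1 h2] [h3 h4]; split; rewrite (le_trans (ler_normD _ _))// lerD.
Qed.

Lemma c2bound_mul p q b c : c2bound p b -> c2bound q c -> c2bound (c2mul p q) (2 * (b * c)).
Proof.
move=> [h1 h2] [h3 h4]; split; rewrite /= mulr_natl mulr2n.
  by rewrite (le_trans (ler_normB _ _))// lerD// normrM ler_pM.
by rewrite (le_trans (ler_normD _ _))// lerD// normrM ler_pM.
Qed.

Lemma c2bound_inv p m : 0 < m -> m ^+ 2 <= c2norm p -> c2bound (c2inv p) m^-1.
Proof.
move=> m0 mp; have n0 : 0 < c2norm p by rewrite (lt_le_trans _ mp)// exprn_gt0.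
have key x : x ^+ 2 <= c2norm p -> `|x / c2norm p| <= m^-1.
  move=> xp; rewrite normrM normfV (gtr0_norm n0) ler_pdivrMr// mulrC ler_pdivlMr//.
  have : (`|x| * m) ^+ 2 <= c2norm p ^+ 2.
    by rewrite exprMn real_normK ?num_real// (expr2 (c2norm p)) ler_pM// sqr_ge0.
  by rewrite ler_pXn2r// nnegrE ?mulr_ge0// ltW.
split=> /=; apply: key; rewrite ?sqrrN.
  by rewrite lerDl sqr_ge0.
by rewrite lerDr sqr_ge0.
Qed.

(** [dF] is [z F'(z)] at [z = r e^(i th)]: these are the Cauchy-Riemann equations
    in polar coordinates. *)
Definition polar_holo F (th r : R) (dF : R * R) :=
  [/\ is_derive th 1 (fun s => (F s r).1) (- dF.2),
      is_derive th 1 (fun s => (F s r).2) dF.1,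
      is_derive r 1 (fun s => (F th s).1) (dF.1 / r) &
      is_derive r 1 (fun s => (F th s).2) (dF.2 / r)].

Lemma polar_holo_pow a th r : 0 < r ->
  polar_holo (fun th r => (r `^ a * cos (a * th), r `^ a * sin (a * th))) th r
    (a * (r `^ a * cos (a * th)), a * (r `^ a * sin (a * th))).
Proof.
move=> r0.
have dl : is_derive th 1 (fun s => a * s) a.
  by apply: (is_derive_eq (isd_scale a (@is_derive_id _ _ th 1))); rewrite mulr1.
have dc := isd_comp (is_derive_cos (a * th)) dl.
have ds := isd_comp (is_derive_sin (a * th)) dl.
have dp := isd_powR_base a r0.
split=> /=.
- by apply: (is_derive_eq (isd_scale _ dc)); ring.
- by apply: (is_derive_eq (isd_scale _ ds)); ring.
- by apply: (is_derive_eq (isd_mul dp (isd_cst _ _))); ring.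
- by apply: (is_derive_eq (isd_mul dp (isd_cst _ _))); ring.
Qed.

Lemma polar_holo_id th r : 0 < r ->
  polar_holo (fun th r => (r * cos th, r * sin th)) th r (r * cos th, r * sin th).
Proof.
move=> r0; have rn0 : r != 0 by rewrite gt_eqF.
split=> /=.
- by apply: (is_derive_eq (isd_scale _ (is_derive_cos th))); ring.
- by apply: (is_derive_eq (isd_scale _ (is_derive_sin th))); ring.
- by apply: (is_derive_eq (isd_mul (@is_derive_id _ _ r 1) (isd_cst _ _))); field.
- by apply: (is_derive_eq (isd_mul (@is_derive_id _ _ r 1) (isd_cst _ _))); field.
Qed.

Lemma polar_holo_addc F c th r dF : polar_holo F th r dF ->
  polar_holo (fun th r => (c + (F th r).1, (F th r).2)) th r dF.
Proof.
move=> [h1 h2 h3 h4]; split=> //=.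
  by apply: (is_derive_eq (isd_add (isd_cst c _) h1)); rewrite add0r.
by apply: (is_derive_eq (isd_add (isd_cst c _) h3)); rewrite add0r.
Qed.

Lemma polar_holo_mul F G th r dF dG : polar_holo F th r dF -> polar_holo G th r dG ->
  polar_holo (fun th r => c2mul (F th r) (G th r)) th r
    (c2add (c2mul dF (G th r)) (c2mul (F th r) dG)).
Proof.
move=> [h1 h2 h3 h4] [k1 k2 k3 k4]; split=> /=.
- by apply: (is_derive_eq (isd_add (isd_mul h1 k1) (isd_opp (isd_mul h2 k2)))); ring.
- by apply: (is_derive_eq (isd_add (isd_mul h1 k2) (isd_mul h2 k1))); ring.
- by apply: (is_derive_eq (isd_add (isd_mul h3 k3) (isd_opp (isd_mul h4 k4)))); ring.
- by apply: (is_derive_eq (isd_add (isd_mul h3 k4) (isd_mul h4 k3))); ring.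
Qed.

Lemma polar_holo_inv F (th r : R) dF : r != 0 -> c2norm (F th r) != 0 -> polar_holo F th r dF ->
  polar_holo (fun th r => c2inv (F th r)) th r
    (c2mul (- dF.1, - dF.2) (c2mul (c2inv (F th r)) (c2inv (F th r)))).
Proof.
move=> rn0 n0 [h1 h2 h3 h4].
have dn (f g : R -> R) (x df dg : R) : is_derive x 1 f df -> is_derive x 1 g dg ->
    c2norm (f x, g x) != 0 ->
    is_derive x 1 (fun y => (c2norm (f y, g y))^-1)
      (- (2 * (f x * df + g x * dg)) / c2norm (f x, g x) ^+ 2).
  move=> hf hg nz.
  have d1 := isd_add (isd_mul hf hf) (isd_mul hg hg).
  have E : (fun y => (c2norm (f y, g y))^-1) = (fun y => (f y * f y + g y * g y)^-1).
    by apply/funext => y; rewrite /c2norm/= !expr2.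
  rewrite E; apply: (is_derive_eq (isd_inv _ d1)); first by rewrite -!expr2.
  by rewrite /c2norm/= -!expr2; congr (_ / _); ring.
have n0' : (F th r).1 ^+ 2 + (F th r).2 ^+ 2 != 0 := n0.
have e1 : (fun s => c2norm (F s r)) = (fun s => c2norm ((F s r).1, (F s r).2)) by [].
split; rewrite /c2inv /c2mul /=.
- apply: (is_derive_eq (isd_mul h1 (dn _ _ _ _ _ h1 h2 n0))); rewrite /c2norm/=; field.
  exact: n0'.
- apply: (is_derive_eq (isd_mul (isd_opp h2) (dn _ _ _ _ _ h1 h2 n0))); rewrite /c2norm/=; field.
  exact: n0'.
- apply: (is_derive_eq (isd_mul h3 (dn _ _ _ _ _ h3 h4 n0))); rewrite /c2norm/=; field.
  by rewrite rn0.
- apply: (is_derive_eq (isd_mul (isd_opp h4) (dn _ _ _ _ _ h3 h4 n0))); rewrite /c2norm/=; field.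
  by rewrite rn0.
Qed.

End polar_holomorphic.

(** * The dominating function of the contour argument *)

Section dominating_function.
Context {R : realType}.
Notation mu := (@lebesgue_measure R).
Implicit Types a r : R.

(** The derivative of [- 1 / (a (1 + r^a))], hence integrable; it behaves like
    [r^(a - 1)] at 0 and like [r^(- a - 1)] at infinity, as the kernel does. *)
Definition dom a r := r `^ a / (r * (1 + r `^ a) ^+ 2).

Lemma dom_ge0 a r : 0 < r -> 0 <= dom a r.
Proof.
move=> /ltW r0; apply: divr_ge0; first exact: powR_ge0.
by apply: mulr_ge0 => //; exact: sqr_ge0.
Qed.

Lemma add1_powR_gt0 a r : 0 < 1 + r `^ a.
Proof. by have := powR_ge0 r a; lra. Qed.

Lemma is_derive_dom_primitive a r : a != 0 -> 0 < r ->
  is_derive r 1 (fun x => - a^-1 * (1 + x `^ a)^-1) (dom a r).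
Proof.
move=> a0 r0; have r0' := gt_eqF r0; have p0 := gt_eqF (add1_powR_gt0 a r).
have d := isd_add (isd_cst 1 r) (isd_powR_base a r0).
apply: (is_derive_eq (isd_scale _ (isd_inv _ d))); first by rewrite p0.
by rewrite /dom; field; rewrite a0 p0 r0'.
Qed.

Lemma continuous_dom a r : 0 < r -> {for r, continuous (dom a)}.
Proof.
move=> r0; have r0' := gt_eqF r0; have p0 := gt_eqF (add1_powR_gt0 a r).
have dp := isd_powR_base a r0; have d := isd_add (isd_cst 1 r) dp.
have n0 : r * ((1 + r `^ a) * (1 + r `^ a)) != 0 by rewrite !mulf_neq0 ?r0' ?p0.
have d2 := isd_mul (@is_derive_id _ _ r 1) (isd_mul d d).
have d3 := isd_mul dp (@isd_inv _ (fun x => x * ((1 + x `^ a) * (1 + x `^ a))) _ _ n0 d2).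
exact: (isd_continuous d3).
Qed.

Lemma integrable_dom a : 0 < a -> mu.-integrable (Rpos : set R) (EFin \o dom a).
Proof.
move=> a0; apply: (integrable_of_bounded_primitive (F := fun x => - a^-1 * (1 + x `^ a)^-1)
  (B := a^-1)) => x x0.
- exact: continuous_dom.
- exact: dom_ge0.
- by apply: is_derive_dom_primitive => //; rewrite gt_eqF.
- have p0 := add1_powR_gt0 a x.
  rewrite normrM normrN !ger0_norm ?invr_ge0 ?(ltW p0) ?(ltW a0)//.
  apply: ler_piMr; first by rewrite invr_ge0 (ltW a0).
  by rewrite invf_le1// lerDl powR_ge0.
Qed.

Lemma powR_le_add1 a r : 0 < a <= 1 -> 0 < r -> r `^ a <= 1 + r.
Proof.
move=> /andP[a0 a1] r0; have [r1|r1] := leP r 1.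
  have h : r `^ a <= 1 `^ a by apply: ge0_ler_powR; rewrite ?nnegrE// ltW.
  by move: h; rewrite powR1 /=; lra.
by have := ler1_powR (ltW r1) a1; lra.
Qed.

Lemma dom1 r : 0 < r -> dom 1 r = ((1 + r) ^+ 2)^-1.
Proof.
move=> r0; rewrite /dom powRr1 ?ltW//; field.
by rewrite (gt_eqF r0) gt_eqF// addr_gt0.
Qed.

Lemma dom_bound1 a r : 0 < a <= 1 -> 0 < r ->
  r `^ a / (r * ((1 + r) * (1 + r `^ a))) <= 2 * dom a r.
Proof.
move=> a1 r0; have p0 := add1_powR_gt0 a r; have r1 : 0 < 1 + r by rewrite addr_gt0.
rewrite /dom [leRHS]mulrCA; apply: ler_wpM2l; first exact: powR_ge0.
have Aub := powR_le_add1 a1 r0; set A := r `^ a in p0 Aub *.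
rewrite ler_pdivlMr ?mulr_gt0 ?exprn_gt0// mulrC ler_pdivrMr ?mulr_gt0//.
rewrite -subr_ge0.
have -> : 2 * (r * ((1 + r) * (1 + A))) - r * (1 + A) ^+ 2 =
  r * (1 + A) * (1 + r + r - A) by ring.
by rewrite mulr_ge0 ?mulr_ge0// ?ltW//; lra.
Qed.

Lemma dom_bound2 a r : 0 < a <= 1 -> 0 < r ->
  ((1 + r) * (1 + r `^ a))^-1 <= 4 * (dom a r + dom 1 r).
Proof.
move=> a1 r0; have p0 := add1_powR_gt0 a r; have r1 : 0 < 1 + r by rewrite addr_gt0.
have da := dom_ge0 a r0; have d1 := dom_ge0 1 r0; have A0 := powR_ge0 r a.
have [rle|rgt] := leP r 1.
  apply: (@le_trans _ _ (4 * dom 1 r)); last by rewrite ler_pM2l// lerDr.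
  rewrite dom1// -[4]invrK -invfM lef_pV2 ?posrE ?mulr_gt0 ?exprn_gt0//.
  rewrite expr2; have : (1 + r) * ((1 + r) * 4^-1) <= (1 + r) * (1 + r `^ a).
    by rewrite ler_pM2l//; lra.
  by lra.
apply: (@le_trans _ _ (4 * dom a r)); last by rewrite ler_pM2l// lerDl.
have A1 : 1 <= r `^ a.
  by rewrite -(powRr0 r) ler_powR ?(ltW rgt)//; case/andP: a1 => /ltW.
rewrite /dom; set A := r `^ a in p0 A0 A1 *.
have -> : 4 * (A / (r * (1 + A) ^+ 2)) = ((r * (1 + A)) / (4 * A) * (1 + A))^-1.
  by field; rewrite (gt_eqF p0) (gt_eqF r0) gt_eqF// (lt_le_trans ltr01).
have A0' : 0 < A by rewrite (lt_le_trans ltr01).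
rewrite lef_pV2 ?posrE ?mulr_gt0 ?invr_gt0 ?mulr_gt0//.
apply: ler_pM; rewrite ?(ltW p0) ?divr_ge0 ?mulr_ge0 ?(ltW r0) ?(ltW p0)//.
rewrite ler_pdivrMr ?mulr_gt0//; nra.
Qed.

End dominating_function.

(** * The Stieltjes transform of the relaxation kernel *)

Section contour.
Context {R : realType}.
Notation mu := (@lebesgue_measure R).
Variables (al lam : R).
Hypotheses (al01 : 0 < al < 1) (lam0 : 0 < lam).

Let mR := @measurable_Rpos R.
Let al0 : 0 < al. Proof. by case/andP: al01. Qed.
Let al1 : 0 < al <= 1. Proof. by case/andP: al01 => -> /ltW. Qed.

Let Nu (th r : R) : R * R := (-1 + r `^ al * cos (al * th), r `^ al * sin (al * th)).
Let Z (th r : R) : R * R := (-1 + r * cos th, r * sin th).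
Let W (th r : R) : R * R := (lam + r `^ al * cos (al * th), r `^ al * sin (al * th)).

(** The function [(z^al - 1) / ((z - 1) (lam + z^al))] at [z = r e^(i th)].  On the
    ray [th = pi] the factor [z - 1] becomes [- (1 + r)], and the imaginary part is [r]
    times a multiple of [mlker al lam r / (1 + r)]; on the ray [th = 0] it vanishes.  The
    numerator removes the pole at [z = 1], through which the path starts. *)
Definition cQ th r := c2mul (c2mul (Nu th r) (c2inv (Z th r))) (c2inv (W th r)).

Let dPow th r : R * R := (al * (r `^ al * cos (al * th)), al * (r `^ al * sin (al * th))).
Let dZ th r : R * R := (r * cos th, r * sin th).
Let dinv (F dF : R * R) := c2mul (- dF.1, - dF.2) (c2mul (c2inv F) (c2inv F)).
Let dNZ th r := c2add (c2mul (dPow th r) (c2inv (Z th r))) (c2mul (Nu th r) (dinv (Z th r) (dZ th r))).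
Let dQ th r := c2add (c2mul (dNZ th r) (c2inv (W th r)))
  (c2mul (c2mul (Nu th r) (c2inv (Z th r))) (dinv (W th r) (dPow th r))).

(** Both moduli are bounded below through the half-angle decomposition
    [|b + x e^(i t)|^2 = cos(t/2)^2 (b + x)^2 + sin(t/2)^2 (b - x)^2]. *)
Lemma c2norm_polar (b x t : R) : c2norm (b + x * cos t, x * sin t) =
  (1 + cos t) / 2 * (b + x) ^+ 2 + (1 - cos t) / 2 * (b - x) ^+ 2.
Proof. by rewrite /c2norm/= exprMn sin2cos2; field. Qed.

Let normZ th r : 0 < r -> (1 - cos th) / 2 * (1 + r) ^+ 2 <= c2norm (Z th r).
Proof.
move=> r0; rewrite c2norm_polar -[leLHS]add0r lerD//.
  by rewrite mulr_ge0 ?sqr_ge0// divr_ge0//; have := cos_geN1 th; lra.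
by have -> : (-1 - r) ^+ 2 = (1 + r) ^+ 2 by ring.
Qed.

Let normW th r : 0 < r -> (1 + cos (al * th)) / 2 * (lam + r `^ al) ^+ 2 <= c2norm (W th r).
Proof.
move=> r0; rewrite c2norm_polar -[leLHS]addr0 lerD//.
by rewrite mulr_ge0 ?sqr_ge0// divr_ge0//; have := cos_le1 (al * th); lra.
Qed.

Let holoQ th r : 0 < r -> c2norm (Z th r) != 0 -> c2norm (W th r) != 0 ->
  polar_holo cQ th r (dQ th r).
Proof.
move=> r0 Z0 W0; have rn0 : r != 0 by rewrite gt_eqF.
have hp := polar_holo_pow al th r0.
have hN := polar_holo_addc (-1) hp; have hW := polar_holo_addc lam hp.
have hZ := polar_holo_addc (-1) (polar_holo_id th r0).
exact: (polar_holo_mul (polar_holo_mul hN (polar_holo_inv rn0 Z0 hZ))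
  (polar_holo_inv rn0 W0 hW)).
Qed.

Let holodQ th r : 0 < r -> c2norm (Z th r) != 0 -> c2norm (W th r) != 0 ->
  exists d, polar_holo dQ th r d.
Proof.
move=> r0 Z0 W0; have rn0 : r != 0 by rewrite gt_eqF.
have hp := polar_holo_pow al th r0.
have hN := polar_holo_addc (-1) hp; have hW := polar_holo_addc lam hp.
have hZ' := polar_holo_id th r0.
have hZ := polar_holo_addc (-1) hZ'.
have hdp : polar_holo dPow th r (al * (al * (r `^ al * cos (al * th))),
    al * (al * (r `^ al * sin (al * th)))).
  by move: hp => [h1 h2 h3 h4]; split;
    [apply: (is_derive_eq (isd_scale al h1))|apply: (is_derive_eq (isd_scale al h2))
    |apply: (is_derive_eq (isd_scale al h3))|apply: (is_derive_eq (isd_scale al h4))] => /=; ring.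
have hopp (F : R -> R -> R * R) d : polar_holo F th r d ->
    polar_holo (fun th r => (- (F th r).1, - (F th r).2)) th r (- d.1, - d.2).
  by move=> [h1 h2 h3 h4]; split;
    [apply: (is_derive_eq (isd_opp h1))|apply: (is_derive_eq (isd_opp h2))
    |apply: (is_derive_eq (isd_opp h3))|apply: (is_derive_eq (isd_opp h4))] => /=; ring.
have hadd (F G : R -> R -> R * R) d e : polar_holo F th r d -> polar_holo G th r e ->
    polar_holo (fun th r => c2add (F th r) (G th r)) th r (c2add d e).
  by move=> [h1 h2 h3 h4] [k1 k2 k3 k4]; split;
    [apply: (is_derive_eq (isd_add h1 k1))|apply: (is_derive_eq (isd_add h2 k2))
    |apply: (is_derive_eq (isd_add h3 k3))|apply: (is_derive_eq (isd_add h4 k4))] => /=; ring.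
have hZi := polar_holo_inv rn0 Z0 hZ; have hWi := polar_holo_inv rn0 W0 hW.
have hdZ := polar_holo_mul (hopp _ _ hZ') (polar_holo_mul hZi hZi).
have hdW := polar_holo_mul (hopp _ _ hdp) (polar_holo_mul hWi hWi).
have hNZ := polar_holo_mul hN hZi.
have hdNZ := hadd _ _ _ _ (polar_holo_mul hdp hZi) (polar_holo_mul hN hdZ).
by eexists; exact: (hadd _ _ _ _ (polar_holo_mul hdNZ hWi) (polar_holo_mul hNZ hdW)).
Qed.

(** Away from the zeros of the two denominators, quantified by [mz] and [mw], the
    derivative of the integrand is dominated uniformly in the angle. *)
Let boundQ (mz mw th r : R) : 0 < mz -> 0 < mw -> 0 < r ->
  (mz * (1 + r)) ^+ 2 <= c2norm (Z th r) -> (mw * (1 + r `^ al)) ^+ 2 <= c2norm (W th r) ->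
  [/\ c2bound (cQ th r) (4 * (mz * mw)^-1 * (1 + r)^-1) &
    c2bound (dQ th r) (r * ((8 * (mz * mw)^-1 + 32 * (mz * mw ^+ 2)^-1) * dom al r
    + 16 * (mz ^+ 2 * mw)^-1 * dom 1 r))].
Proof.
move=> mz0 mw0 r0 hZ hW; have p0 := add1_powR_gt0 al r; have r1 : 0 < 1 + r by rewrite addr_gt0.
have A0 := powR_ge0 r al.
have bc (x t : R) : `|x * cos t| <= `|x|.
  by rewrite normrM ler_piMr// ler_norml cos_geN1 cos_le1.
have bs (x t : R) : `|x * sin t| <= `|x| by rewrite normrM ler_piMr// sin_max.
have bP : c2bound (dPow th r) (r `^ al).
  have al' : `|al| <= 1 by rewrite ger0_norm; case/andP: al1 => // /ltW.
  split=> /=; rewrite normrM -[leRHS]mul1r ler_pM//.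
    by rewrite (le_trans (bc _ _))// ger0_norm.
  by rewrite (le_trans (bs _ _))// ger0_norm.
have bN : c2bound (Nu th r) (1 + r `^ al).
  split=> /=.
    rewrite (le_trans (ler_normD _ _))// normrN1 lerD2l.
    by rewrite (le_trans (bc _ _))// ger0_norm.
  by rewrite (le_trans (bs _ _))// ger0_norm// lerDr.
have bdZ : c2bound (- (dZ th r).1, - (dZ th r).2) r.
  split=> /=; rewrite normrN; first by rewrite (le_trans (bc _ _))// gtr0_norm.
  by rewrite (le_trans (bs _ _))// gtr0_norm.
have bdP : c2bound (- (dPow th r).1, - (dPow th r).2) (r `^ al).
  by case: bP => ? ?; split=> /=; rewrite normrN.
have bZi := c2bound_inv (mulr_gt0 mz0 r1) hZ.
have bWi := c2bound_inv (mulr_gt0 mw0 p0) hW.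
have bNZ := c2bound_mul bN bZi.
have bNZ' := c2bound_add (c2bound_mul bP bZi) (c2bound_mul bN (c2bound_mul bdZ (c2bound_mul bZi bZi))).
have bQ := c2bound_mul bNZ bWi.
have bQ' := c2bound_add (c2bound_mul bNZ' bWi) (c2bound_mul bNZ (c2bound_mul bdP (c2bound_mul bWi bWi))).
have cle p (b c : R) : b <= c -> c2bound p b -> c2bound p c.
  by move=> bc' [h1 h2]; split; [exact: le_trans h1 bc'|exact: le_trans h2 bc'].
split; [apply: cle bQ|apply: cle bQ'].
  rewrite le_eqVlt; apply/orP; left; apply/eqP; field.
  by rewrite (gt_eqF mz0) (gt_eqF mw0) (gt_eqF r1) (gt_eqF p0).
have db := dom_bound1 al1 r0.
rewrite dom1//; set A := r `^ al in p0 A0 db *; set D := dom al r in db *.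
rewrite [leLHS](_ : _ = r * ((4 * (mz * mw)^-1 + 16 * (mz * mw ^+ 2)^-1) *
     (A / (r * ((1 + r) * (1 + A)))) + 16 * (mz ^+ 2 * mw)^-1 * ((1 + r) ^+ 2)^-1)); last first.
  by field; rewrite (gt_eqF mz0) (gt_eqF mw0) (gt_eqF r1) (gt_eqF p0) (gt_eqF r0).
rewrite ler_pM2l// lerD2r.
rewrite (_ : _ * D = (4 * (mz * mw)^-1 + 16 * (mz * mw ^+ 2)^-1) * (2 * D)); last by ring.
by apply: ler_wpM2l db; rewrite addr_ge0// mulr_ge0// invr_ge0 ltW// !mulr_gt0.
Qed.

(** The numerator of the imaginary part, split so that each term is small near
    the point [r = 1], [th = 0] where [z - 1] vanishes. *)
Lemma cQ_Im th r : (cQ th r).2 =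
  ((lam + 1) * r `^ al * sin (al * th) * (r * cos th - 1) -
   r * sin th * ((r `^ al - 1) * (r `^ al + lam) -
     (lam - 1) * r `^ al * (1 - cos (al * th)))) / c2norm (Z th r) / c2norm (W th r).
Proof.
rewrite /cQ /c2mul /c2inv /=; set i := (c2norm (Z th r))^-1; set j := (c2norm (W th r))^-1.
have e := sin2cos2 (al * th).
set A := r `^ al; set s := sin (al * th) in e *; set c := cos (al * th) in e *.
rewrite -/A -/s -/c.
have -> : (A - 1) * (A + lam) - (lam - 1) * A * (1 - c) = (-1 + A * c) * (lam + A * c) + A ^+ 2 * s ^+ 2.
  by rewrite e; ring.
by ring.
Qed.

(** With the measure [dr / r] the Cauchy-Riemann equations read
    [d_th (Im cQ / r) = d_r (Re cQ)]. *)
Definition Qint th r := (cQ th r).2 / r.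

Let cos_near th : `|th| <= pi / 2 -> 0 <= cos th <= cos (al * th).
Proof.
move=> h; have p0 : 0 <= `|th| <= pi / 2 by rewrite normr_ge0.
have pi0 := pi_gt0 R; have a0 := al0; have a1 : al <= 1 by case/andP: al1.
rewrite -cos_norm -(cos_norm (al * th)) normrM (gtr0_norm al0).
apply/andP; split; first by apply: cos_ge0_pihalf; apply/andP; split; lra.
have t0 : 0 <= `|th| by [].
have at1 : al * `|th| <= `|th| by rewrite ler_piMl.
have at0 : 0 <= al * `|th| by rewrite mulr_ge0// ltW.
have [->//|ne] := eqVneq (al * `|th|) `|th|.
by apply/ltW; rewrite ltr_cos ?in_itv/=;
  [rewrite lt_neqAle ne|apply/andP; split; lra|apply/andP; split; lra].
Qed.

Let abs_powR_sub1 r : 0 < r -> `|r `^ al - 1| <= `|r - 1|.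
Proof.
move=> r0; have [r1|r1] := leP r 1.
  have h : r <= r `^ al by rewrite ger1_powR ?r0//; case/andP: al1.
  have h2 : r `^ al <= 1 `^ al.
    by apply: ge0_ler_powR; rewrite ?nnegrE ?(ltW al0) ?(ltW r0).
  move: h2; rewrite powR1 /= => h2.
  by rewrite !ler0_norm; lra.
have h : r `^ al <= r by rewrite ler1_powR ?(ltW r1)//; case/andP: al1.
have h2 : 1 <= r `^ al by rewrite -(powRr0 r) ler_powR ?(ltW r1)// ltW.
by rewrite !ger0_norm; lra.
Qed.

(** Each of the three terms of the numerator is a multiple of
    [D = |z - 1|^2 = (r - 1)^2 + 2 r (1 - cos th)], because [|sin th| |r - 1|] and
    [r (1 - cos th)] are; the quotient by [D] stays bounded up to the angle 0. *)
Let near_num (r A c s ca sa : R) : 0 < r -> 0 <= A -> `|A - 1| <= `|r - 1| ->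
  0 <= c <= 1 -> s ^+ 2 = 1 - c ^+ 2 -> `|sa| <= `|s| -> c <= ca <= 1 ->
  `|(lam + 1) * A * sa * (r * c - 1) -
   r * s * ((A - 1) * (A + lam) - (lam - 1) * A * (1 - ca))| <=
  ((r - 1) ^+ 2 + 2 * (r * (1 - c))) * ((lam + 1) * (3 * A + 2 * (r * (1 + A)) / (1 + r))).
Proof.
move=> r0 A0 Ar /andP[c0 c1] sE sas /andP[cca ca1].
set D := (r - 1) ^+ 2 + _; have r1 : 0 < 1 + r by rewrite addr_gt0.
have l0 := lam0.
have q0 : 0 <= 1 - c by lra.
have rq0 : 0 <= r * (1 - c) by rewrite mulr_ge0// ltW.
have D0 : 0 <= D by rewrite addr_ge0 ?sqr_ge0// mulr_ge0.
have s1 : `|s| <= 1.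
  by rewrite -(@ler_pXn2r _ 2)// ?nnegrE// real_normK ?num_real// sE expr1n lerBlDr lerDl sqr_ge0.
have h2 : r * (1 - c) <= D / 2 by rewrite /D; have := sqr_ge0 (r - 1); lra.
have h1 : (1 + r) * (`|s| * `|r - 1|) <= 2 * D.
  rewrite -(@ler_pXn2r _ 2)// ?nnegrE ?mulr_ge0// ?(ltW r1)//.
  rewrite !exprMn !real_normK ?num_real// sE /D.
  set q := 1 - c; have -> : c = 1 - q by rewrite /q; ring.
  have q1 : q <= 1 by rewrite /q; lra.
  have {}q0 : 0 <= q by [].
  rewrite -subr_ge0 [leRHS](_ : _ = (r - 1) ^+ 4 * (4 - 2 * q + q ^+ 2) +
     (r * q * (r - 1) ^+ 2) * (8 + 4 * q) + 16 * (r * q) ^+ 2); last by ring.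
  have r4 : 0 <= (r - 1) ^+ 4 by rewrite exprn_even_ge0.
  apply: addr_ge0; last by rewrite mulr_ge0// sqr_ge0.
  apply: addr_ge0; first by rewrite mulr_ge0//; have := sqr_ge0 q; lra.
  apply: mulr_ge0; last lra.
  by apply: mulr_ge0; rewrite ?sqr_ge0// mulr_ge0// ltW.
have h3 : `|s| * `|r - 1| <= 2 * D / (1 + r) by rewrite ler_pdivlMr// mulrC.
have h3' : `|s| * `|r - 1| <= 2 * D.
  apply: le_trans h3 _; rewrite ler_pdivrMr// ler_peMr//; last by rewrite lerDl ltW.
  by rewrite mulr_ge0.
have lA0 : 0 <= (lam + 1) * A by rewrite mulr_ge0// addr_ge0// ltW.
have t1 : `|(lam + 1) * A * sa * (r * c - 1)| <= (lam + 1) * A * (5 / 2 * D).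
  rewrite -mulrA normrM (ger0_norm lA0) ler_wpM2l// normrM.
  apply: (@le_trans _ _ (`|s| * (`|r - 1| + r * (1 - c)))).
    rewrite ler_pM//; have -> : r * c - 1 = (r - 1) - r * (1 - c) by ring.
    by rewrite (le_trans (ler_normB _ _))// lerD2l ger0_norm.
  rewrite mulrDr; have : `|s| * (r * (1 - c)) <= r * (1 - c) by rewrite ler_piMl.
  lra.
have t2 : `|r * s * ((A - 1) * (A + lam))| <= D * ((lam + 1) * (2 * (r * (1 + A)) / (1 + r))).
  have -> : D * ((lam + 1) * (2 * (r * (1 + A)) / (1 + r))) =
     r * (2 * D / (1 + r)) * ((lam + 1) * (1 + A)) by ring.
  rewrite mulrA normrM ler_pM//.
    rewrite -mulrA normrM (gtr0_norm r0) ler_pM2l// (le_trans _ h3)//.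
    by rewrite normrM ler_wpM2l.
  have lA : 0 <= lam * A by rewrite mulr_ge0// ltW.
  by rewrite ger0_norm; lra.
have t3 : `|r * s * ((lam - 1) * A * (1 - ca))| <= (lam + 1) * A * (D / 2).
  have -> : r * s * ((lam - 1) * A * (1 - ca)) = (lam - 1) * A * (r * (1 - ca) * s) by ring.
  rewrite normrM ler_pM//.
    rewrite normrM (ger0_norm A0) ler_wpM2r//.
    by rewrite (le_trans (ler_normB _ _))// normr1 gtr0_norm.
  rewrite normrM (@le_trans _ _ `|r * (1 - ca)|)// ?ler_piMr//.
  rewrite normrM gtr0_norm// ger0_norm; last lra.
  by apply: le_trans h2; rewrite ler_pM2l//; lra.
rewrite (mulrBr (r * s)) opprB addrA.
apply: le_trans (ler_normB _ _) _; apply: le_trans (lerD (ler_normD _ _) (lexx _)) _.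
apply: le_trans (lerD (lerD t1 t3) t2) _.
by rewrite le_eqVlt; apply/orP; left; apply/eqP; field; rewrite gt_eqF.
Qed.

Let Wk := Num.min 1 lam.

Let Wk_gt0 : 0 < Wk. Proof. by rewrite lt_min ltr01 lam0. Qed.

Let lam_add_ge r : Wk * (1 + r `^ al) <= lam + r `^ al.
Proof.
have A0 := powR_ge0 r al; rewrite mulrDr mulr1 lerD//.
  by rewrite ge_min lexx orbT.
by rewrite ler_piMl// ge_min lexx.
Qed.

Let normW' mw th r : 0 < r -> 0 < mw -> mw ^+ 2 <= (1 + cos (al * th)) / 2 ->
  (mw * Wk * (1 + r `^ al)) ^+ 2 <= c2norm (W th r).
Proof.
move=> r0 mw0 h; apply: le_trans (normW th r0); rewrite -mulrA exprMn.
apply: ler_pM; rewrite ?sqr_ge0//.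
have k0 : 0 <= Wk * (1 + r `^ al) by rewrite mulr_ge0 ?ltW// add1_powR_gt0.
have kle := lam_add_ge r.
by rewrite ler_pXn2r ?nnegrE// (le_trans k0).
Qed.

Let Qint_near th r : 0 < r -> `|th| <= pi / 2 ->
  `|Qint th r| <= (lam + 1) / (Wk / 2) ^+ 2 * (11 * dom al r + 8 * dom 1 r).
Proof.
move=> r0 hth; have /andP[c0 cc] := cos_near hth.
have r1 : 0 < 1 + r by rewrite addr_gt0.
have p0 := add1_powR_gt0 al r; have A0 := powR_ge0 r al; have l0 := lam0; have k0 := Wk_gt0.
have hW : (2^-1 * Wk * (1 + r `^ al)) ^+ 2 <= c2norm (W th r).
  apply: normW' => //; have : 0 <= cos (al * th) by exact: le_trans cc.
  lra.
have W0 : 0 < c2norm (W th r).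
  by rewrite (lt_le_trans _ hW)// exprn_gt0// !mulr_gt0.
have hc : 0 <= cos th <= 1 by rewrite c0 cos_le1.
have hca : cos th <= cos (al * th) <= 1 by rewrite cc cos_le1.
have hs : `|sin (al * th)| <= `|sin th|.
  rewrite -(@ler_pXn2r _ 2)// ?nnegrE// !real_normK ?num_real// !sin2cos2 lerD2l lerN2.
  by rewrite ler_pXn2r ?nnegrE// (le_trans c0).
have hn := near_num r0 A0 (abs_powR_sub1 r0) hc (sin2cos2 th) hs hca.
rewrite /Qint cQ_Im !normrM !normfV (gtr0_norm r0) (gtr0_norm W0).
set num := `|_| in hn *; set Dz := c2norm (Z th r).
have DzE : Dz = (r - 1) ^+ 2 + 2 * (r * (1 - cos th)).
  by rewrite /Dz c2norm_polar; field.
set K := (lam + 1) * (3 * r `^ al + 2 * (r * (1 + r `^ al)) / (1 + r)) in hn.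
have K0 : 0 <= K.
  by rewrite mulr_ge0 ?addr_ge0 ?mulr_ge0 ?invr_ge0 ?addr_ge0// ltW.
have {}hn : num / `|Dz| <= K.
  have Dz0 : 0 <= Dz by rewrite /Dz addr_ge0 ?sqr_ge0.
  rewrite (ger0_norm Dz0); move: Dz0; rewrite le_eqVlt => /orP[/eqP <-|Dz0].
    by rewrite invr0 mulr0.
  by rewrite ler_pdivrMr// mulrC DzE.
apply: (@le_trans _ _ (K / (2^-1 * Wk * (1 + r `^ al)) ^+ 2 / r)).
  rewrite ler_pM2r ?invr_gt0// ler_pM ?invr_ge0 ?(ltW W0)//.
    by rewrite divr_ge0// normr_ge0.
  by rewrite lef_pV2 ?posrE// exprn_gt0// !mulr_gt0.
have db2 := dom_bound2 al1 r0.
rewrite [leLHS](_ : _ = (lam + 1) / (Wk / 2) ^+ 2 * (3 * dom al r + 2 * ((1 + r) * (1 + r `^ al))^-1)); last first.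
  by rewrite /K /dom; field; rewrite (gt_eqF k0) (gt_eqF r1) (gt_eqF p0) (gt_eqF r0).
apply: ler_wpM2l; last lra.
by rewrite divr_ge0 ?sqr_ge0// addr_ge0// ltW.
Qed.

Let Qint_far mz mw th r : 0 < r -> 0 < mz -> 0 < mw ->
  mz ^+ 2 <= (1 - cos th) / 2 -> mw ^+ 2 <= (1 + cos (al * th)) / 2 ->
  `|Qint th r| <= (lam + 1) / (mz ^+ 2 * (mw * Wk) ^+ 2) * (dom al r + 3 * dom 1 r).
Proof.
move=> r0 mz0 mw0 hz hw.
have r1 : 0 < 1 + r by rewrite addr_gt0.
have p0 := add1_powR_gt0 al r; have A0 := powR_ge0 r al; have l0 := lam0; have k0 := Wk_gt0.
have hW := normW' r0 mw0 hw.
have hZ : (mz * (1 + r)) ^+ 2 <= c2norm (Z th r).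
  by apply: le_trans (normZ th r0); rewrite exprMn ler_wpM2r// sqr_ge0.
have W0 : 0 < c2norm (W th r) by rewrite (lt_le_trans _ hW)// exprn_gt0// !mulr_gt0.
have Z0 : 0 < c2norm (Z th r) by rewrite (lt_le_trans _ hZ)// exprn_gt0// !mulr_gt0.
rewrite /Qint cQ_Im !normrM !normfV (gtr0_norm r0) (gtr0_norm W0) (gtr0_norm Z0).
set num := `|_|.
have hn : num <= (lam + 1) * (r `^ al * (1 + r) + 3 * (r * (1 + r `^ al) ^+ 2)).
  rewrite /num; set A := r `^ al in A0 p0 *; set s := sin (al * th); set c := cos (al * th).
  have s1 : `|s| <= 1 by exact: sin_max.
  have c1 : `|1 - c| <= 2.
    by rewrite (le_trans (ler_normB _ _))// normr1; have := cos_max (al * th); rewrite -/c; lra.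
  have l1 : `|lam - 1| <= lam + 1.
    by rewrite (le_trans (ler_normB _ _))// normr1 gtr0_norm.
  have rc : `|r * cos th - 1| <= 1 + r.
    rewrite (le_trans (ler_normB _ _))// normr1 addrC lerD2l normrM gtr0_norm//.
    by rewrite ler_piMr ?cos_max// ltW.
  have lA : 0 <= (lam + 1) * A by rewrite mulr_ge0// addr_ge0// ltW.
  have Al : `|(A - 1) * (A + lam)| <= (lam + 1) * (1 + A) ^+ 2.
    have h1 : `|A - 1| <= 1 + A.
      by rewrite (le_trans (ler_normB _ _))// normr1 ger0_norm// addrC.
    have h2 : `|A + lam| <= (lam + 1) * (1 + A).
      have lA' : 0 <= lam * A by rewrite mulr_ge0// ltW.
      by rewrite ger0_norm; lra.
    have := ler_pM (normr_ge0 _) (normr_ge0 _) h1 h2; rewrite normrM.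
    by have -> : (1 + A) * ((lam + 1) * (1 + A)) = (lam + 1) * (1 + A) ^+ 2 by ring.
  have B : `|(lam - 1) * A * (1 - c)| <= 2 * ((lam + 1) * (1 + A) ^+ 2).
    have h : `|lam - 1| * A <= (lam + 1) * (1 + A) ^+ 2.
      by rewrite ler_pM//; have := sqr_ge0 A; lra.
    rewrite !normrM (ger0_norm A0) mulrC; apply: ler_pM => //.
    by rewrite mulr_ge0.
  have t1 : `|(lam + 1) * A * s * (r * cos th - 1)| <= (lam + 1) * A * (1 + r).
    rewrite normrM ler_pM// normrM (ger0_norm lA) ler_piMr//.
  have t2 : `|r * sin th * ((A - 1) * (A + lam) - (lam - 1) * A * (1 - c))| <=
      r * (3 * ((lam + 1) * (1 + A) ^+ 2)).
    rewrite normrM ler_pM//.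
      by rewrite normrM (gtr0_norm r0) ler_piMr ?sin_max// ltW.
    by rewrite (le_trans (ler_normB _ _))//; apply: le_trans (lerD Al B) _; lra.
  apply: le_trans (ler_normB _ _) _; apply: le_trans (lerD t1 t2) _.
  by rewrite le_eqVlt; apply/orP; left; apply/eqP; ring.
have num0 : 0 <= num by rewrite /num.
apply: (@le_trans _ _ ((lam + 1) * (r `^ al * (1 + r) + 3 * (r * (1 + r `^ al) ^+ 2)) /
    (mz * (1 + r)) ^+ 2 / (mw * Wk * (1 + r `^ al)) ^+ 2 / r)).
  rewrite ler_pM2r ?invr_gt0//; apply: ler_pM.
  - by rewrite divr_ge0// ltW.
  - by rewrite invr_ge0 ltW.
  - apply: ler_pM => //; first by rewrite invr_ge0 ltW.
    by rewrite lef_pV2 ?posrE// exprn_gt0// mulr_gt0.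
  - by rewrite lef_pV2 ?posrE// exprn_gt0// !mulr_gt0.
rewrite [leLHS](_ : _ = (lam + 1) / (mz ^+ 2 * (mw * Wk) ^+ 2) *
    (dom al r / (1 + r) + 3 * dom 1 r)); last first.
  rewrite dom1// /dom; field.
  by rewrite (gt_eqF k0) (gt_eqF r1) (gt_eqF p0) (gt_eqF r0) (gt_eqF mz0) (gt_eqF mw0).
apply: ler_wpM2l.
  by rewrite -exprMn divr_ge0 ?sqr_ge0// addr_ge0// ltW.
rewrite lerD2r ler_piMr ?dom_ge0// invf_le1// lerDl ltW//.
Qed.

Let integrable_combo (c d : R) : mu.-integrable (Rpos : set R)
  (EFin \o (fun r => c * dom al r + d * dom 1 r)).
Proof.
have -> : EFin \o (fun r => c * dom al r + d * dom 1 r) =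
  ((fun r => c%:E * (EFin \o dom al) r) \+ (fun r => d%:E * (EFin \o dom 1) r))%E.
  by apply/funext => r; rewrite /= EFinD !EFinM.
by apply: integrableD => //; apply: integrableZl => //; exact: integrable_dom.
Qed.

Let Z_neq0 th r : 0 < r -> cos th < 1 -> c2norm (Z th r) != 0.
Proof.
move=> r0 h; rewrite gt_eqF// (lt_le_trans _ (normZ th r0))//.
by rewrite mulr_gt0 ?exprn_gt0 ?addr_gt0//; lra.
Qed.

Let W_neq0 th r : 0 < r -> -1 < cos (al * th) -> c2norm (W th r) != 0.
Proof.
move=> r0 h; rewrite gt_eqF// (lt_le_trans _ (normW th r0))//.
by rewrite mulr_gt0 ?exprn_gt0 ?ltr_pwDl ?powR_ge0//; lra.
Qed.

Let Z_neq0' th r : 0 < r -> r != 1 -> 0 <= cos th -> c2norm (Z th r) != 0.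
Proof.
move=> r0 r1 h; rewrite gt_eqF// c2norm_polar.
have h1 := cos_le1 th.
have h2 : 0 < (-1 + r) ^+ 2 by rewrite exprn_even_gt0// addrC subr_eq0.
by have h3 := sqr_ge0 (-1 - r); nra.
Qed.

Let continuous_Qint_r th r : 0 < r -> c2norm (Z th r) != 0 -> c2norm (W th r) != 0 ->
  {for r, continuous (Qint th)}.
Proof.
move=> r0 Z0 W0; have [_ _ _ h] := holoQ r0 Z0 W0.
have rn0 : r != 0 by rewrite gt_eqF.
exact: isd_continuous (isd_mul h (isd_inv rn0 (@is_derive_id _ _ r 1))).
Qed.

Let is_derive_Qint th r : 0 < r -> c2norm (Z th r) != 0 -> c2norm (W th r) != 0 ->
  is_derive th 1 (Qint ^~ r) ((dQ th r).1 / r).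
Proof.
move=> r0 Z0 W0; have [_ h _ _] := holoQ r0 Z0 W0.
by apply: (is_derive_eq (isd_mul h (isd_cst _ _))); rewrite mulr0 addr0.
Qed.

Let cvg_c2mul (FF : set_system R) {hF : ProperFilter FF} (f g : R -> R * R) (p q : R * R) :
  (f x).1 @[x --> FF] --> p.1 -> (f x).2 @[x --> FF] --> p.2 ->
  (g x).1 @[x --> FF] --> q.1 -> (g x).2 @[x --> FF] --> q.2 ->
  (c2mul (f x) (g x)).1 @[x --> FF] --> (c2mul p q).1 /\
  (c2mul (f x) (g x)).2 @[x --> FF] --> (c2mul p q).2.
Proof.
move=> f1 f2 g1 g2; split => /=.
  exact: (cvgB (cvgM f1 g1) (cvgM f2 g2)).
exact: (cvgD (cvgM f1 g2) (cvgM f2 g1)).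
Qed.

Let cvg_c2inv (FF : set_system R) {hF : ProperFilter FF} (f : R -> R * R) (p : R * R) :
  c2norm p != 0 ->
  (f x).1 @[x --> FF] --> p.1 -> (f x).2 @[x --> FF] --> p.2 ->
  (c2inv (f x)).1 @[x --> FF] --> (c2inv p).1 /\
  (c2inv (f x)).2 @[x --> FF] --> (c2inv p).2.
Proof.
move=> p0 f1 f2.
have hn : (c2norm (f x))^-1 @[x --> FF] --> (c2norm p)^-1.
  apply: cvgV => //; rewrite /c2norm.
  exact: (cvgD (cvgM f1 f1) (cvgM f2 f2)).
split=> /=; first exact: cvgM.
by apply: cvgM => //; exact: cvgN.
Qed.

Let cQ_cvg0 th : (cQ th r).1 @[r --> 0^'+] --> lam^-1.
Proof.
have A0 : r `^ al @[r --> 0^'+] --> (0 : R) by exact: powR_cvg0.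
have r0 : r @[r --> (0 : R)^'+] --> (0 : R) by apply: cvg_at_right_filter; exact: cvg_id.
have m0 (f : R -> R) (c : R) : f r @[r --> 0^'+] --> 0 -> f r * c @[r --> 0^'+] --> 0.
  by move=> h; rewrite -[X in _ --> X](mul0r c); apply: cvgM => //; exact: cvg_cst.
have ma (f : R -> R) (c d : R) : f r @[r --> 0^'+] --> 0 -> d + f r * c @[r --> 0^'+] --> d.
  by move=> h; rewrite -[X in _ --> X](addr0 d); apply: cvgD; [exact: cvg_cst|exact: m0].
have n1 : c2norm ((-1 : R), (0 : R)) != 0 by rewrite /c2norm/=; apply/eqP; lra.
have n2 : c2norm (lam, (0 : R)) != 0.
  by rewrite /c2norm/= expr0n addr0 expf_neq0// gt_eqF.
have [z1 z2] := @cvg_c2inv _ _ (Z th) (-1, 0) n1 (ma _ (cos th) (-1) r0) (m0 _ (sin th) r0).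
have [w1 w2] := @cvg_c2inv _ _ (W th) (lam, 0) n2 (ma _ (cos (al * th)) lam A0)
  (m0 _ (sin (al * th)) A0).
have [a1 a2] := @cvg_c2mul _ _ (Nu th) _ (-1, 0) _ (ma _ (cos (al * th)) (-1) A0)
  (m0 _ (sin (al * th)) A0) z1 z2.
have [q1 _] := @cvg_c2mul _ _ _ _ _ _ a1 a2 w1 w2.
move: q1; set X := (X in _ --> X); suff -> : X = lam^-1 by [].
rewrite /X /c2mul /c2inv /c2norm /=; field.
by rewrite gt_eqF// gt_eqF.
Qed.

Let ray_integral th := \int[mu]_(r in Rpos) Qint th r.

(** The integral of the imaginary part changes with the angle at the constant rate
    [Re cQ(oo) - Re cQ(0) = 0 - 1 / lam]: differentiate under the integral sign, use
    the Cauchy-Riemann equations, and integrate an exact derivative in [r]. *)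
Lemma is_derive_contour_integral th : 0 < th <= pi -> is_derive th 1 ray_integral (- lam^-1).
Proof.
move=> /andP[th0 thpi]; have pi0 := pi_gt0 R.
(* The neighbourhood ]u, v[ of th extends beyond pi, yet [al * v < pi], so that
     [lam + z^al] still has no zero there, and [v <= 3 pi / 2] keeps z off the
     positive axis. *)
pose u := th / 2; pose v := Num.min (3 / 2 * pi) ((pi + pi / al) / 2).
have al_lt1 : al < 1 by case/andP: al01.
have pial : pi < pi / al by rewrite ltr_pdivlMr// gtr_pMr.
have thv : pi < v by rewrite lt_min; apply/andP; split; lra.
have v1 : v <= 3 / 2 * pi by rewrite ge_min lexx.
have v2 : al * v < pi.
  have : v <= (pi + pi / al) / 2 by rewrite ge_min lexx orbT.
  rewrite -(ler_pM2l al0) => /le_lt_trans; apply.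
  have -> : al * ((pi + pi / al) / 2) = (al * pi + pi) / 2 by field; rewrite gt_eqF.
  have : al * pi < pi by rewrite gtr_pMl.
  lra.
have u0 : 0 < u by rewrite /u; lra.
have upi : u < pi by rewrite /u; lra.
have thE : u < th < v by rewrite /u; apply/andP; split; lra.
have cosle (x y : R) : 0 <= x -> x <= y -> y <= pi -> cos y <= cos x.
  move=> x0 xy ypi; have [->//|ne] := eqVneq x y.
  by apply/ltW; rewrite ltr_cos ?in_itv/= ?lt_neqAle ?ne//; apply/andP; split; lra.
have coslt (x : R) : 0 < x -> x <= pi -> cos x < 1.
  by move=> x0 xpi; rewrite -cos0 ltr_cos ?in_itv/= ?lexx//; apply/andP; split; lra.
have cosu x : u < x < v -> cos x <= cos u.
  move=> /andP[ux xv]; have [xpi|xpi] := leP x pi; first by apply: cosle => //; lra.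
  have -> : cos x = cos (pi *+ 2 - x) by rewrite cosB cos2pi sin2pi mul1r mul0r addr0.
  by apply: cosle; rewrite ?mulr2n; rewrite /u in ux *; lra.
have cosv x : u < x < v -> cos (al * v) <= cos (al * x).
  move=> /andP[ux xv]; apply: cosle; last exact: ltW.
    by rewrite mulr_ge0// ?ltW//; lra.
  by rewrite ler_pM2l// ltW.
have cv : -1 < cos (al * v).
  by rewrite -cospi ltr_cos ?in_itv/= ?lexx ?(ltW pi0)//; rewrite mulr_ge0 ?ltW//; lra.
pose mz := Num.sqrt ((1 - cos u) / 2); pose mw := Num.sqrt ((1 + cos (al * v)) / 2).
have cu := coslt _ u0 (ltW upi).
have mz0 : 0 < mz by rewrite sqrtr_gt0; lra.
have mw0 : 0 < mw by rewrite sqrtr_gt0; lra.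
have mzE x : u < x < v -> mz ^+ 2 <= (1 - cos x) / 2.
  by move=> /cosu ?; rewrite sqr_sqrtr; lra.
have mwE x : u < x < v -> mw ^+ 2 <= (1 + cos (al * x)) / 2.
  by move=> /cosv ?; rewrite sqr_sqrtr; lra.
have Zn (x r : R) : u < x < v -> 0 < r -> c2norm (Z x r) != 0.
  by move=> /cosu ? ?; apply: Z_neq0 => //; lra.
have Wn (x r : R) : u < x < v -> 0 < r -> c2norm (W x r) != 0.
  by move=> /cosv ? ?; apply: W_neq0 => //; lra.
have mwk : 0 < mw * Wk by rewrite mulr_gt0.
have hBz (x r : R) : u < x < v -> 0 < r -> (mz * (1 + r)) ^+ 2 <= c2norm (Z x r).
  by move=> xuv r0; apply: le_trans (normZ x r0); rewrite exprMn ler_wpM2r ?sqr_ge0// mzE.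
have hB (x r : R) (xuv : u < x < v) (r0 : 0 < r) :=
  boundQ mz0 mwk r0 (hBz x r xuv r0) (normW' r0 mw0 (mwE _ xuv)).
set C1 := (8 * (mz * (mw * Wk))^-1 + 32 * (mz * (mw * Wk) ^+ 2)^-1) in hB.
set C2 := 16 * (mz ^+ 2 * (mw * Wk))^-1 in hB.
have dB (x r : R) : u < x < v -> 0 < r -> `|(dQ x r).1 / r| <= C1 * dom al r + C2 * dom 1 r.
  move=> xuv r0; have [_ [h _]] := hB x r xuv r0.
  by rewrite normrM normfV (gtr0_norm r0) ler_pdivrMr// mulrC.
have intQ (x : R) : u < x < v -> mu.-integrable Rpos (EFin \o Qint x).
  move=> xuv.
  set c := (lam + 1) / (mz ^+ 2 * (mw * Wk) ^+ 2).
  apply: (le_integrable mR _ _ (integrable_combo c (c * 3))).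
    apply/measurable_EFinP; apply: continuous_Rpos_measurable => r r0.
    by apply: continuous_Qint_r => //; [exact: Zn|exact: Wn].
  move=> r /Rpos_gt0 r0; rewrite lee_fin.
  apply: le_trans (Qint_far r0 mz0 mw0 (mzE _ xuv) (mwE _ xuv)) _.
  by rewrite -/c mulrDr mulrA ler_norm.
have cdQ : forall r, 0 < r -> {for r, continuous (fun r => (dQ th r).1 / r)}.
  move=> r r0; have [d [_ _ h _]] := holodQ r0 (Zn _ _ thE r0) (Wn _ _ thE r0).
  have rn0 : r != 0 by rewrite gt_eqF.
  exact: isd_continuous (isd_mul h (isd_inv rn0 (@is_derive_id _ _ r 1))).
have intdQ : mu.-integrable Rpos (EFin \o (fun r => (dQ th r).1 / r)).
  apply: (le_integrable mR _ _ (integrable_combo C1 C2)).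
    by apply/measurable_EFinP; exact: continuous_Rpos_measurable.
  by move=> r /Rpos_gt0 r0; rewrite lee_fin; apply: le_trans (dB _ _ thE r0) (ler_norm _).
have -> : - lam^-1 = \int[mu]_(r in Rpos) ((dQ th r).1 / r).
  have dP (r : R) : 0 < r -> is_derive r 1 (fun r => (cQ th r).1) ((dQ th r).1 / r).
    by move=> r0; have [_ _ h _] := holoQ r0 (Zn _ _ thE r0) (Wn _ _ thE r0).
  have cy : (cQ th r).1 @[r --> +oo] --> (0 : R).
    set C := 4 * (mz * (mw * Wk))^-1 in hB.
    apply/cvgr0Pnorm_le => e e0; near=> r.
    have r0 : 0 < r by near: r; apply: nbhs_pinfty_gt; rewrite num_real.
    have [[h _] _] := hB th r thE r0.
    apply: le_trans h _; rewrite ler_pdivrMr ?addr_gt0//.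
    have : C / e <= r by near: r; apply: nbhs_pinfty_ge; rewrite num_real.
    by rewrite ler_pdivrMr// => h; rewrite mulrDr mulr1 (mulrC e r); lra.
  by rewrite (Rintegral_improper cdQ intdQ dP (cQ_cvg0 th) cy) sub0r.
have hd (x r : R) : u < x < v -> Rpos r -> is_derive x 1 (Qint ^~ r) ((dQ x r).1 / r).
  by move=> xuv /Rpos_gt0 r0; apply: is_derive_Qint => //; [exact: Zn|exact: Wn].
have hb (x r : R) : u < x < v -> Rpos r -> `|(dQ x r).1 / r| <= C1 * dom al r + C2 * dom 1 r.
  by move=> xuv /Rpos_gt0; exact: dB.
exact: (@is_derive_under_integral R _ _ mu Qint (fun x r => (dQ x r).1 / r) Rpos
  (fun r => C1 * dom al r + C2 * dom 1 r) u v th mR thE intQ hd (integrable_combo C1 C2) hb).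
Unshelve. all: by end_near. Qed.

Let ray_integral0 : ray_integral 0 = 0.
Proof.
rewrite /ray_integral (_ : Qint 0 = cst 0); first by rewrite Rintegral_cst// mul0r.
by apply/funext => r; rewrite /Qint cQ_Im mulr0 sin0 !(mulr0, mul0r) subrr !mul0r.
Qed.

(** The differentiation stops short of the angle 0, where [z - 1] vanishes; there the
    bound [Qint_near] on the integrand itself gives continuity, and the only
    radius at which the integrand is not continuous in the angle, [r = 1], is
    negligible. *)
Let ray_integral_cont0 : {for 0, continuous ray_integral}.
Proof.
have pi0 := pi_gt0 R.
pose c := (lam + 1) / (Wk / 2) ^+ 2.
pose G := fun r => c * 11 * dom al r + c * 8 * dom 1 r.
have bG (x r : R) : - (pi / 2) < x < pi / 2 -> 0 < r -> `|Qint x r| <= G r.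
  move=> /andP[x1 x2] r0; apply: le_trans (Qint_near r0 _) _.
    by rewrite ler_norml !ltW.
  by rewrite /G -/c le_eqVlt; apply/orP; left; apply/eqP; ring.
have cpos (x : R) : - (pi / 2) < x < pi / 2 -> 0 <= cos x <= cos (al * x).
  by move=> /andP[x1 x2]; apply: cos_near; rewrite ler_norml !ltW.
have Zn (x r : R) : - (pi / 2) < x < pi / 2 -> 0 < r -> r != 1 -> c2norm (Z x r) != 0.
  by move=> /cpos/andP[h _] r0 r1; exact: Z_neq0'.
have Wn (x r : R) : - (pi / 2) < x < pi / 2 -> 0 < r -> c2norm (W x r) != 0.
  by move=> /cpos/andP[h1 h2] r0; apply: W_neq0 => //; lra.
have intG : mu.-integrable Rpos (EFin \o G) by exact: integrable_combo.
have inI (x : R) : `](- (pi / 2)), (pi / 2)[%classic x -> - (pi / 2) < x < pi / 2.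
  by rewrite /= in_itv.
have intQ (x : R) : `](- (pi / 2)), (pi / 2)[%classic x -> mu.-integrable Rpos (EFin \o Qint x).
  move=> /inI xI; apply: (le_integrable mR _ _ intG); last first.
    by move=> r /Rpos_gt0 r0; rewrite lee_fin; apply: le_trans (bG _ _ xI r0) (ler_norm _).
  apply/measurable_EFinP.
  have oU : open (`]0, 1[ `|` `]1, +oo[ : set R) by apply: openU; exact: interval_open.
  have -> : (Rpos : set R) = (`]0, 1[ `|` `]1, +oo[) `|` [set 1].
    apply/seteqP; split=> [r /Rpos_gt0 r0|r].
      have [r1|r1|->] := ltgtP r 1; last by right.
        by left; left; rewrite /= in_itv/= r0.
      by left; right; rewrite /= in_itv/= r1.
    move=> [[|]|->]; rewrite /= !in_itv/= ?andbT.
    - by move=> /andP[].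
    - exact: lt_trans.
    - exact: ltr01.
  apply/measurable_funU; [exact: open_measurable|exact: measurable_set1|split]; last first.
    exact: measurable_fun_set1.
  apply: open_continuous_measurable_fun => // r; rewrite inE => rU.
  have [r0 r1] : 0 < r /\ r != 1.
    move: rU => [|]; rewrite /= in_itv/= ?andbT.
      by move=> /andP[r0 r1]; split=> //; rewrite lt_eqF.
    by move=> r1; split; [exact: lt_trans r1|rewrite gt_eqF].
  by apply: continuous_Qint_r => //; [exact: Zn|exact: Wn].
have := @continuity_under_integral R _ _ mu Qint Rpos mR (- (pi / 2)) (pi / 2) intQ _ G intG _.
move=> h; have {}h := h _ _ 0; rewrite /ray_integral; apply: h.
- exists [set 1]; split; [exact: measurable_set1|exact: lebesgue_measure_set1|].
  move=> r h; apply: contrapT => /= /eqP r1; apply: h => /= /Rpos_gt0 r0 x; rewrite inE => /inI xI.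
  exact: isd_continuous (is_derive_Qint r0 (Zn _ _ xI r0 r1) (Wn _ _ xI r0)).
- by move=> x /inI xI; apply: aeW => r /Rpos_gt0; exact: bG.
- by rewrite inE /= in_itv/=; apply/andP; split; lra.
Qed.

Lemma contour_integral_pi : ray_integral pi = - (pi / lam).
Proof.
have pi0 := pi_gt0 R.
have dT := is_derive_contour_integral.
have dS (x : R) : x \in `]0, pi[ -> is_derive x 1 (fun y => ray_integral y + lam^-1 * y) 0.
  rewrite in_itv/= => /andP[x0 xpi].
  have h : 0 < x <= pi by rewrite x0 ltW.
  apply: (is_derive_eq (isd_add (dT x h) (isd_scale _ (@is_derive_id _ _ x 1)))).
  by rewrite mulr1 addNr.
have cS : {within `[0, pi], continuous (fun y => ray_integral y + lam^-1 * y)}.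
  apply: continuous_in_subspaceT => x; rewrite inE/= in_itv/= => /andP[x0 xpi].
  apply: cvgD; last exact: mulrl_continuous.
  move: x0; rewrite le_eqVlt => /orP[/eqP <-|x0]; first exact: ray_integral_cont0.
  have h : 0 < x <= pi by rewrite x0 xpi.
  exact: isd_continuous (dT x h).
have [c _] := MVT pi0 dS cS.
by rewrite mul0r ray_integral0 mulr0 addr0 subr0 => /eqP; rewrite addr_eq0 => /eqP ->; rewrite mulrC.
Qed.

(** The density of the relaxation function [E_al(- lam t^al)] as a superposition of
    exponentials, without its factor [1 / pi]; it is minus the imaginary part of
    [lam / (r (lam + (r e^(i pi))^al))]. *)
Definition mlker r := lam * r `^ al * sin (al * pi) /
  (r * (lam ^+ 2 + 2 * lam * r `^ al * cos (al * pi) + (r `^ al) ^+ 2)).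

Let api : 0 < al * pi < pi.
Proof.
have pi0 := pi_gt0 R; have a1 : al < 1 by case/andP: al01.
by rewrite mulr_gt0//= gtr_pMl.
Qed.

Let sin_api : 0 < sin (al * pi). Proof. exact: sin_gt0_pi. Qed.

Let cos_api : -1 < cos (al * pi).
Proof.
have /andP[h1 h2] := api; have pi0 := pi_gt0 R.
by rewrite -cospi ltr_cos ?in_itv/= ?lexx ?(ltW pi0) ?(ltW h1) ?(ltW h2).
Qed.

Let W_pi r : c2norm (W pi r) = lam ^+ 2 + 2 * lam * r `^ al * cos (al * pi) + (r `^ al) ^+ 2.
Proof. by rewrite /c2norm /W /=; rewrite exprMn sin2cos2; ring. Qed.

Lemma mlker_denom_neq0 r : 0 < r ->
  lam ^+ 2 + 2 * lam * r `^ al * cos (al * pi) + (r `^ al) ^+ 2 != 0.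
Proof. by move=> r0; rewrite -W_pi; apply: W_neq0 => //; exact: cos_api. Qed.

Lemma mlker_dom : exists2 C, 0 <= C & forall r, 0 < r -> 0 <= mlker r <= C * dom al r.
Proof.
pose mw := Num.sqrt ((1 + cos (al * pi)) / 2); have ca := cos_api; have sa := sin_api.
have mw0 : 0 < mw by rewrite sqrtr_gt0; lra.
have mwE : mw ^+ 2 <= (1 + cos (al * pi)) / 2 by rewrite sqr_sqrtr; lra.
have l0 := lam0; have k0 := Wk_gt0.
exists (lam / (mw * Wk) ^+ 2); first by rewrite divr_ge0 ?sqr_ge0// ltW.
move=> r r0; rewrite /mlker -W_pi; have A0 := powR_ge0 r al; have p0 := add1_powR_gt0 al r.
have hW := normW' r0 mw0 mwE.
have W0 : 0 < c2norm (W pi r) by rewrite (lt_le_trans _ hW)// exprn_gt0// !mulr_gt0.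
apply/andP; split.
  by apply: divr_ge0; apply: mulr_ge0; rewrite ?(ltW r0) ?(ltW W0) ?(ltW sa)// mulr_ge0// ltW.
rewrite (_ : lam / _ * _ = lam * r `^ al * 1 / (r * (mw * Wk * (1 + r `^ al)) ^+ 2)); last first.
  by rewrite /dom; field; rewrite (gt_eqF p0) (gt_eqF r0) (gt_eqF k0) (gt_eqF mw0).
apply: ler_pM.
- by rewrite !mulr_ge0// ltW.
- by rewrite invr_ge0 mulr_ge0// ltW.
- by apply: ler_wpM2l; rewrite ?sin_le1// mulr_ge0// ltW.
- by rewrite lef_pV2 ?posrE ?ler_pM2l// mulr_gt0// exprn_gt0// !mulr_gt0.
Qed.

Lemma continuous_mlker r : 0 < r -> {for r, continuous mlker}.
Proof.
move=> r0; have ca := cos_api; have dA := isd_powR_base al r0.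
have W0 : c2norm (W pi r) != 0 by apply: W_neq0.
have n0 : r * (lam ^+ 2 + 2 * lam * r `^ al * cos (al * pi) + r `^ al * r `^ al) != 0.
  by rewrite -expr2 -W_pi mulf_neq0// gt_eqF.
have d1 := isd_add (isd_add (isd_cst (lam ^+ 2) r) (isd_mul (isd_scale (2 * lam) dA) (isd_cst (cos (al * pi)) r)))
  (isd_mul dA dA).
have d2 := isd_mul (@is_derive_id _ _ r 1) d1.
have d3 := isd_mul (isd_mul (isd_scale lam dA) (isd_cst (sin (al * pi)) r)) (@isd_inv _
  (fun y => y * (lam ^+ 2 + 2 * lam * y `^ al * cos (al * pi) + y `^ al * y `^ al)) r _ n0 d2).
exact: (isd_continuous d3).
Qed.

(** The contour integral at the angle [pi], where [Qint] is [- (1 + lam) / lam] times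
    the integrand. *)
Lemma integral_mlker_stieltjes :
  (\int[mu]_(r in Rpos) (mlker r / (1 + r))%:E = (pi / (1 + lam))%:E)%E.
Proof.
have l0 := lam0.
have [C C0 hC] := mlker_dom.
have cK (r : R) : 0 < r -> {for r, continuous (fun r => mlker r / (1 + r))}.
  move=> r0; apply: cvgM; first exact: continuous_mlker.
  apply: cvgV; first by rewrite gt_eqF// addr_gt0.
  by apply: cvgD; [exact: cvg_cst|exact: cvg_id].
have intK : mu.-integrable Rpos (EFin \o (fun r => mlker r / (1 + r))).
  apply: (le_integrable mR _ _ (integrable_combo C 0)).
    by apply/measurable_EFinP; exact: continuous_Rpos_measurable.
  move=> r /Rpos_gt0 r0; rewrite lee_fin mul0r addr0.
  have /andP[h1 h2] := hC r r0.
  have r1 : 0 < 1 + r by rewrite addr_gt0.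
  rewrite ger0_norm; last by rewrite mulr_ge0// invr_ge0 ltW.
  apply: le_trans (ler_norm _); apply: le_trans h2.
  by apply: ler_piMr => //; rewrite invf_le1// lerDl ltW.
suff E : \int[mu]_(r in Rpos) (mlker r / (1 + r)) = pi / (1 + lam).
  by rewrite -E /Rintegral fineK//; exact: (integrable_fin_num mR intK).
have E : ray_integral pi = \int[mu]_(r in Rpos) (- ((1 + lam) / lam) * (mlker r / (1 + r))).
  apply: eq_Rintegral => r; rewrite inE => /Rpos_gt0 r0.
  rewrite /Qint cQ_Im sinpi cospi /mlker -W_pi.
  have W0 : c2norm (W pi r) != 0 by apply: W_neq0 => //; exact: cos_api.
  have -> : c2norm (Z pi r) = (1 + r) ^+ 2.
    by rewrite /c2norm /Z /= cospi sinpi; ring.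
  field; rewrite W0 (gt_eqF l0) (gt_eqF r0) gt_eqF//= addr_gt0//.
rewrite contour_integral_pi (RintegralZl _ mR intK) in E.
have l1 : 1 + lam != 0 by rewrite gt_eqF// addr_gt0.
have c0 : - ((1 + lam) / lam) != 0 by rewrite oppr_eq0 mulf_neq0// invr_eq0 gt_eqF.
apply: (mulfI c0); rewrite -E; field.
by rewrite l1 gt_eqF.
Qed.

End contour.

(** * Euler integrals *)

Section gamma_integrals.
Context {R : realType}.
Notation mu := (@lebesgue_measure R).
Implicit Types x t r : R.

Lemma expR_dominates x t : 0 <= x -> 0 < t ->
  exists2 C, 0 < C & forall r, 0 < r -> (1 + r `^ x) ^+ 2 * expR (- (t * r)) <= C.
Proof.
move=> x0 t0; pose n := (Num.truncn (2 * x)).+1.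
pose K := n`!%:R / t ^+ n.
have K0 : 0 < K by rewrite divr_gt0 ?exprn_gt0// ltr0n fact_gt0.
exists (4 * (1 + K)); first by rewrite mulr_gt0// addr_gt0.
move=> r r0; have A0 := powR_ge0 r x.
have e0 := expR_gt0 (t * r); have e1 : 1 <= expR (t * r) by rewrite -expR0 ler_expR mulr_ge0 ?ltW.
rewrite expRN ler_pdivrMr// -mulrA.
have h : (1 + K) * expR (t * r) >= 1.
  by apply: mulr_ege1 => //; rewrite lerDl ltW.
have [r1|r1] := leP r 1.
  have A1 : r `^ x <= 1.
    have h1 : r `^ x <= 1 `^ x by apply: ge0_ler_powR; rewrite ?nnegrE// ltW.
    by move: h1; rewrite powR1.
  have : (1 + r `^ x) ^+ 2 <= 4 * 1 by nra.
  by move=> /le_trans; apply; rewrite ler_pM2l.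
have A1 : 1 <= r `^ x by rewrite -(powRr0 r) ler_powR ?(ltW r1).
apply: (@le_trans _ _ (4 * (r `^ x) ^+ 2)); first by nra.
rewrite ler_pM2l// -powR_mulrn// -powRrM.
apply: (@le_trans _ _ (r `^ n%:R)).
  apply: ler_powR; first exact: ltW.
  by rewrite mulrC ltW// truncnS_gt.
rewrite powR_mulrn ?(ltW r0)//.
have : (t * r) ^+ n / n`!%:R <= expR (t * r).
  have := @expR_ge1Dxn R (t * r) n.-1 (mulr_ge0 (ltW t0) (ltW r0)).
  by rewrite prednK//; lra.
rewrite ler_pdivrMr ?ltr0n ?fact_gt0// exprMn => h2.
have : r ^+ n <= K * expR (t * r).
  by rewrite /K mulrAC ler_pdivlMr ?exprn_gt0// mulrC (mulrC (n`!%:R)).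
by move=> /le_trans; apply; rewrite ler_pM2r// lerDr.
Qed.

Lemma integrable_RposZl C (f : R -> R) : mu.-integrable (Rpos : set R) (EFin \o f) ->
  mu.-integrable (Rpos : set R) (EFin \o (fun r => C * f r)).
Proof.
move=> h; have -> : EFin \o (fun r => C * f r) = (fun r => C%:E * (EFin \o f) r)%E.
  by apply/funext => r; rewrite /= EFinM.
by apply: integrableZl => //; exact: measurable_Rpos.
Qed.

(** Euler's integrand, with an exponential rate [t]. *)
Definition euler x t r := r `^ (x - 1) * expR (- (t * r)).

Lemma euler_ge0 x t r : 0 <= euler x t r.
Proof. by rewrite mulr_ge0 ?powR_ge0 ?expR_ge0. Qed.

Lemma continuous_euler x t r : 0 < r -> {for r, continuous (euler x t)}.
Proof.
move=> r0.
have d1 := isd_opp (isd_scale t (@is_derive_id _ _ r 1)).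
exact: (isd_continuous (isd_mul (isd_powR_base (x - 1) r0) (isd_comp (is_derive_expR _) d1))).
Qed.

Lemma powR_sub1 x r : 0 < r -> r `^ (x - 1) = r `^ x / r.
Proof. by move=> r0; rewrite powRB ?powRr1 ?(ltW r0)// (gt_eqF r0) implybT. Qed.

(** The exponential beats any power, so that the integrable function [dom] also
    dominates Euler's integrand. *)
Lemma euler_dom x t : 0 < x -> 0 < t ->
  exists2 C, 0 < C & forall r, 0 < r -> euler x t r <= C * dom x r.
Proof.
move=> x0 t0; have [C C0 hC] := expR_dominates (ltW x0) t0; exists C => // r r0.
have p0 := add1_powR_gt0 x r; have A0 := powR_ge0 r x.
rewrite /euler /dom powR_sub1//.
rewrite (_ : C * _ = r `^ x / r * (C / (1 + r `^ x) ^+ 2)); last first.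
  by field; rewrite (gt_eqF p0) (gt_eqF r0).
apply: ler_wpM2l; first by rewrite divr_ge0// ltW.
by rewrite ler_pdivlMr ?exprn_gt0// mulrC; exact: hC.
Qed.

Lemma integrable_euler x t : 0 < x -> 0 < t ->
  mu.-integrable (Rpos : set R) (EFin \o euler x t).
Proof.
move=> x0 t0; have [C C0 hC] := euler_dom x0 t0.
have intC := integrable_RposZl C (integrable_dom x0).
apply: (le_integrable measurable_Rpos _ _ intC).
  by apply/measurable_EFinP; apply: continuous_Rpos_measurable => r; exact: continuous_euler.
move=> r /Rpos_gt0 r0; rewrite lee_fin ger0_norm ?euler_ge0//.
exact: le_trans (hC _ r0) (ler_norm _).
Qed.

Lemma GammaE x : Gamma x = \int[mu]_(r in Rpos) euler x 1 r.
Proof. by apply: eq_Rintegral => r _; rewrite /euler mul1r. Qed.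

Lemma integral_euler x t : 0 < x -> 0 < t ->
  \int[mu]_(r in Rpos) euler x t r = t `^ (- x) * Gamma x.
Proof.
move=> x0 t0; rewrite GammaE.
have t1 : 0 < t `^ x by rewrite powR_gt0.
rewrite {2}/Rintegral (ge0_integral_Rpos_scale t0); last 2 first.
- by move=> r; exact: continuous_euler.
- by move=> r _; exact: euler_ge0.
rewrite -/(Rintegral mu Rpos (fun r => t * euler x 1 (t * r))).
have -> : \int[mu]_(r in Rpos) (t * euler x 1 (t * r)) = \int[mu]_(r in Rpos) (t `^ x * euler x t r).
  apply: eq_Rintegral => r; rewrite inE => /Rpos_gt0 r0.
  rewrite /euler mul1r powRM ?(ltW t0) ?(ltW r0)// (powR_sub1 _ t0).
  by field; rewrite gt_eqF.
rewrite RintegralZl; [|exact: measurable_Rpos|exact: integrable_euler].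
by rewrite mulrA powRN mulVf ?mul1r// gt_eqF.
Qed.

(** On the segment [[c, c + 1]] Euler's integrand is at least the left-hand side.
    As [c] is arbitrary, [Gamma] grows faster than every exponential, which is what
    the convergence of the Mittag-Leffler series requires. *)
Lemma Gamma_lower_bound x c : 0 <= x -> 0 < c ->
  c `^ x * expR (- (c + 1)) <= Gamma (x + 1).
Proof.
move=> x0 c0; rewrite GammaE.
have mS : measurable (`[c, (c + 1)] : set (measurableTypeR R)) by exact: measurable_itv.
have sub : `[c, (c + 1)] `<=` (Rpos : set R).
  by move=> r; rewrite /= !in_itv/= andbT => /andP[+ _]; exact: lt_le_trans.
have x1 : 0 < x + 1 by rewrite ltr_wpDl.
have intE := integrable_euler x1 ltr01.
rewrite -lee_fin /Rintegral fineK; last exact: (integrable_fin_num measurable_Rpos intE).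
apply: (@le_trans _ _ (\int[mu]_(r in `[c, (c + 1)%R]) (euler (x + 1) 1 r)%:E)%E); last first.
  apply: ge0_subset_integral => //.
  - exact: (measurable_int _ intE).
  - by move=> r _; rewrite lee_fin euler_ge0.
apply: (@le_trans _ _ (\int[mu]_(r in `[c, (c + 1)%R]) (c `^ x * expR (- (c + 1)))%:E)%E).
  rewrite integral_cst//= lebesgue_measure_itv/= lte_fin ltrDl ltr01.
  by rewrite -EFinB addrAC subrr add0r mule1.
apply: ge0_le_integral => //.
- by move=> r _; rewrite lee_fin mulr_ge0 ?powR_ge0 ?expR_ge0.
- by apply: measurable_funS (measurable_int _ intE) => //; exact: measurable_Rpos.
- move=> r; rewrite /= in_itv/= => /andP[cr rc]; rewrite lee_fin /euler mul1r addrK.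
  apply: ler_pM; rewrite ?powR_ge0 ?expR_ge0//.
    by apply: ge0_ler_powR; rewrite ?nnegrE ?(ltW c0)// (le_trans (ltW c0)).
  by rewrite ler_expR lerN2.
Qed.

Lemma Gamma_gt0 x : 0 <= x -> 0 < Gamma (x + 1).
Proof.
move=> x0; apply: lt_le_trans (Gamma_lower_bound x0 (ltr01 : 0 < (1 : R))).
by rewrite mulr_gt0 ?powR_gt0 ?expR_gt0.
Qed.

End gamma_integrals.

(** * The Laplace transform of the Mittag-Leffler function *)

Section mittag_leffler_laplace.
Context {R : realType}.
Notation mu := (@lebesgue_measure R).
Variable al : R.
Hypothesis al0 : 0 < al.

Let ali (i : nat) : 0 <= al * i%:R. Proof. by rewrite mulr_ge0// ltW. Qed.

Lemma rGammaE (i : nat) : rGamma (al * i%:R + 1) = (Gamma (al * i%:R + 1))^-1.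
Proof. by rewrite /rGamma ltr_wpDl. Qed.

Lemma rGamma_ge0 (i : nat) : 0 <= rGamma (al * i%:R + 1).
Proof. by rewrite rGammaE invr_ge0 ltW// Gamma_gt0. Qed.

Definition ml_term (z : R) (i : nat) := z ^+ i * rGamma (al * i%:R + 1).

Lemma mittag_lefflerE (z : R) : mittag_leffler al 1 z = limn (series (ml_term z)).
Proof. by []. Qed.

(** [Gamma_lower_bound] at the point [c] with [c^al = 2 B]. *)
Lemma ml_term_bound (B : R) : 0 < B ->
  exists2 C, 0 <= C & forall z i, `|z| <= B -> `|ml_term z i| <= C * 2^-1 ^+ i.
Proof.
move=> B0; have B2 : 0 < 2 * B by rewrite mulr_gt0.
pose c := (2 * B) `^ al^-1; have c0 : 0 < c by rewrite powR_gt0.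
exists (expR (c + 1)) => [|z i zB]; first exact: expR_ge0.
rewrite normrM normrX (ger0_norm (rGamma_ge0 i)) rGammaE.
have hG := Gamma_lower_bound (ali i) c0.
have cE : c `^ (al * i%:R) = (2 * B) ^+ i.
  by rewrite /c -powRrM mulrA mulVf ?gt_eqF// mul1r powR_mulrn// ltW.
have e0 := expR_gt0 (c + 1).
have h : (Gamma (al * i%:R + 1))^-1 <= expR (c + 1) / (2 * B) ^+ i.
  rewrite -[leRHS]invrK lef_pV2 ?posrE ?Gamma_gt0 ?invr_gt0 ?divr_gt0 ?exprn_gt0//.
  by rewrite invfM invrK mulrC -expRN -cE.
apply: (@le_trans _ _ (B ^+ i * (expR (c + 1) / (2 * B) ^+ i))).
  apply: ler_pM => //; first by rewrite invr_ge0 ltW// Gamma_gt0.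
  by apply: lerXn2r => //; rewrite ?nnegrE// ltW.
rewrite le_eqVlt; apply/orP; left; apply/eqP.
rewrite exprMn exprVn; field; rewrite !expf_neq0// ?gt_eqF//.
Qed.

Lemma half_lt1 : `|2^-1 : R| < 1.
Proof. by rewrite ger0_norm; lra. Qed.

Lemma ml_term_summable (z : R) : abs_summable (ml_term z).
Proof.
have B0 : 0 < 1 + `|z| by rewrite ltr_pwDl.
have [C C0 hC] := ml_term_bound B0.
apply: (@abs_summable_le _ _ (fun i => C * 2^-1 ^+ i)) => [i|].
  by apply: hC; rewrite lerDr.
exact: is_cvg_geometric_series half_lt1.
Qed.

Lemma continuous_ml_powR (lam t : R) : 0 < t ->
  {for t, continuous (fun t => mittag_leffler al 1 (- (lam * t `^ al)))}.
Proof.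
move=> t0.
have hE (z : R) : {for z, continuous (mittag_leffler al 1)}.
  have B0 : 0 < 1 + `|z| by rewrite ltr_pwDl.
  have [C C0 hC] := ml_term_bound B0.
  have zI : - (1 + `|z|) < z < 1 + `|z|.
    by have := ler_norm z; have := ler_norm (- z); rewrite normrN; lra.
  apply: (continuous_series (f := ml_term) (G := fun i => C * 2^-1 ^+ i) zI).
  - move=> n x _; rewrite /ml_term; apply: cvgM; last exact: cvg_cst.
    exact: exprn_continuous.
  - apply: (@abs_summable_le _ _ (fun i => C * 2^-1 ^+ i)) => [i|].
      by rewrite ger0_norm// mulr_ge0// exprn_ge0.
    exact: is_cvg_geometric_series half_lt1.
  - by move=> x n /andP[x1 x2]; apply: hC; rewrite ler_norml !ltW.
have dg := isd_opp (isd_scale lam (isd_powR_base al t0)).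
exact: (continuous_comp (isd_continuous dg) (hE _)).
Qed.

Let lterm (lam p : R) (i : nat) (t : R) := expR (- (p * t)) * ml_term (- (lam * t `^ al)) i.

Let ltermE (lam p : R) (i : nat) (t : R) : 0 < t -> 
  lterm lam p i t = (- lam) ^+ i * rGamma (al * i%:R + 1) * euler (al * i%:R + 1) p t.
Proof.
move=> t0; rewrite /lterm /ml_term /euler addrK.
have -> : - (lam * t `^ al) = - lam * t `^ al by rewrite mulNr.
rewrite exprMn.
rewrite -[(t `^ al) ^+ i]powR_mulrn ?powR_ge0// -powRrM; ring.
Qed.

(** Term by term, [t^(al i)] contributes [Gamma(al i + 1) / p^(al i + 1)], and the
    Gamma factors cancel: a geometric series remains, convergent for [p^al > lam]. *)
Lemma laplace_mittag_leffler (lam p : R) : 0 < lam -> 0 < p -> lam < p `^ al ->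
  mu.-integrable (Rpos : set R)
    (EFin \o (fun t => expR (- (p * t)) * mittag_leffler al 1 (- (lam * t `^ al)))) /\
  \int[mu]_(t in Rpos) (expR (- (p * t)) * mittag_leffler al 1 (- (lam * t `^ al))) =
    p^-1 / (1 + lam / p `^ al).
Proof.
move=> lam0 p0 lamp; have P0 : 0 < p `^ al by rewrite powR_gt0.
have mR := @measurable_Rpos R.
have x0 (i : nat) : 0 < al * i%:R + 1 by rewrite ltr_wpDl.
have intL i : mu.-integrable Rpos (EFin \o lterm lam p i).
  have := integrable_RposZl ((- lam) ^+ i * rGamma (al * i%:R + 1)) (integrable_euler (x0 i) p0).
  apply: eq_integrable => //.
  by move=> t; rewrite inE => /Rpos_gt0 t0 /=; rewrite ltermE.
have G0 (i : nat) : Gamma (al * i%:R + 1) != 0 by rewrite gt_eqF// Gamma_gt0.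
have pE (i : nat) : p `^ (- (al * i%:R + 1)) = p^-1 * (p `^ al)^-1 ^+ i.
  rewrite powRN powRD ?(gt_eqF p0) ?implybT// powRr1 ?(ltW p0)// powRrM powR_mulrn ?(ltW P0)//.
  by rewrite invfM mulrC exprVn.
have intE i : \int[mu]_(t in Rpos) lterm lam p i t = p^-1 * (- (lam / p `^ al)) ^+ i.
  rewrite (@eq_Rintegral _ _ _ mu Rpos (fun t => (- lam) ^+ i * rGamma (al * i%:R + 1) * euler (al * i%:R + 1) p t)).
    rewrite RintegralZl//; last exact: integrable_euler.
    have -> : - (lam / p `^ al) = - lam / p `^ al by rewrite mulNr.
    rewrite integral_euler// rGammaE pE exprMn exprVn; field.
    by rewrite G0 (gt_eqF p0) expf_neq0// gt_eqF.
  by move=> t; rewrite inE => /Rpos_gt0 t0; rewrite ltermE.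
have intN i : \int[mu]_(t in Rpos) `|lterm lam p i t| = p^-1 * (lam / p `^ al) ^+ i.
  rewrite (@eq_Rintegral _ _ _ mu Rpos (fun t => lam ^+ i * rGamma (al * i%:R + 1) * euler (al * i%:R + 1) p t)).
    rewrite RintegralZl//; last exact: integrable_euler.
    rewrite integral_euler// rGammaE pE exprMn exprVn; field.
    by rewrite G0 (gt_eqF p0) expf_neq0// gt_eqF.
  move=> t; rewrite inE => /Rpos_gt0 t0; rewrite ltermE// 2!normrM normrX normrN (gtr0_norm lam0).
  by rewrite (ger0_norm (rGamma_ge0 i)) (ger0_norm (euler_ge0 _ _ _)).
have q1 : `|lam / p `^ al| < 1.
  by rewrite gtr0_norm ?divr_gt0// ltr_pdivrMr// mul1r.
have sL (t : R) : Rpos t -> abs_summable ((lterm lam p) ^~ t).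
  by move=> _; apply: abs_summable_scale; exact: ml_term_summable.
have cI : cvgn (series (fun n => \int[mu]_(t in Rpos) `|lterm lam p n t|)).
  have -> : (fun n => \int[mu]_(t in Rpos) `|lterm lam p n t|) = geometric p^-1 (lam / p `^ al).
    by apply/funext => n; rewrite intN.
  exact: is_cvg_geometric_series.
have [h1 h2] := Rintegral_series mR intL sL cI.
have sE : (fun t => limn (series ((lterm lam p) ^~ t))) =
    (fun t => expR (- (p * t)) * mittag_leffler al 1 (- (lam * t `^ al))).
  apply/funext => t; rewrite mittag_lefflerE lim_series_scale//.
  exact/abs_summable_cvg/ml_term_summable.
rewrite sE in h1 h2; split => //.
rewrite h2.
have -> : (fun n => \int[mu]_(t in Rpos) lterm lam p n t) = geometric p^-1 (- (lam / p `^ al)).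
  by apply/funext => n; rewrite intE.
have q2 : `|- (lam / p `^ al)| < 1 by rewrite normrN.
have cg := @cvg_geometric_series R p^-1 _ q2; rewrite opprK in cg.
exact: (cvg_lim _ cg).
Qed.

End mittag_leffler_laplace.

(** * Uniqueness of the Laplace transform *)

Section laplace_uniqueness.
Context {R : realType}.
Notation mu := (@lebesgue_measure R).

Lemma integrable_Rpos_dominated (f g : R -> R) :
  (forall x : R, 0 < x -> {for x, continuous f}) ->
  mu.-integrable (Rpos : set R) (EFin \o g) ->
  (forall x : R, 0 < x -> `|f x| <= g x) ->
  mu.-integrable (Rpos : set R) (EFin \o f).
Proof.
move=> cf intg fg; apply: (le_integrable measurable_Rpos _ _ intg).
  by apply/measurable_EFinP; exact: continuous_Rpos_measurable.
by move=> x /Rpos_gt0 x0; rewrite lee_fin (le_trans (fg _ x0))// ler_norm.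
Qed.

Lemma continuous_expRM (p t : R) : {for t, continuous (fun t => expR (- (p * t)))}.
Proof.
exact: (isd_continuous (isd_comp (is_derive_expR _)
  (isd_opp (isd_scale p (@is_derive_id _ _ t 1))))).
Qed.

Section kernel.
Variable w : R -> R.
Hypothesis cw : forall t : R, 0 < t -> {for t, continuous w}.
Hypothesis intw : mu.-integrable (Rpos : set R) (EFin \o w).
Hypothesis w0 : forall n : nat, \int[mu]_(t in Rpos) (expR (- (n%:R * t)) * w t) = 0.

Let cpw (q : {poly R}) (t : R) : 0 < t -> {for t, continuous (fun t => q.[expR (- t)] * w t)}.
Proof.
move=> t0; apply: cvgM; last exact: cw.
apply: (@continuous_comp _ _ _ (fun t : R => expR (- t)) (horner q)).
  exact: (isd_continuous (isd_comp (is_derive_expR _) (isd_opp (@is_derive_id _ _ t 1)))).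
exact: continuous_horner.
Qed.

Let ipw (q : {poly R}) : mu.-integrable (Rpos : set R) (EFin \o (fun t => q.[expR (- t)] * w t)).
Proof.
pose C := \sum_(i < size q) `|q`_i|.
apply: (@integrable_Rpos_dominated _ (fun t => C * `|w t|)); first by move=> t; exact: cpw.
  exact/integrable_RposZl/integrable_norm.
move=> t t0; rewrite normrM ler_wpM2r// horner_coef (le_trans (ler_norm_sum _ _ _))//.
apply: ler_sum => i _; rewrite normrM ler_piMr// normrX exprn_ile1//.
by rewrite ger0_norm ?expR_ge0// expR_le1 oppr_le0 ltW.
Qed.

Let poly_w0 (q : {poly R}) : \int[mu]_(t in Rpos) (q.[expR (- t)] * w t) = 0.
Proof.
have mono (c : R) n : \int[mu]_(t in Rpos) ((c *: 'X^n).[expR (- t)] * w t) = 0.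
  rewrite (@eq_Rintegral _ _ _ mu Rpos (fun t => c * (expR (- (n%:R * t)) * w t))).
    rewrite RintegralZl ?w0 ?mulr0//.
    have := ipw 'X^n; apply: eq_integrable => //.
    by move=> t _ /=; rewrite hornerXn -expRM_natl mulrN.
  by move=> t _; rewrite hornerZ hornerXn -expRM_natl mulrN mulrA.
have sumE k : \int[mu]_(t in Rpos) ((\sum_(i < k) q`_i *: 'X^i).[expR (- t)] * w t) = 0.
  elim: k => [|k IH].
    rewrite big_ord0; under eq_Rintegral do rewrite horner0 mul0r.
    by rewrite Rintegral_cst ?mul0r//; exact: measurable_Rpos.
  rewrite big_ord_recr /=; under eq_Rintegral do rewrite hornerD mulrDl.
  by rewrite RintegralD; [rewrite IH mono addr0|exact: measurable_Rpos|exact: ipw|exact: ipw].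
by have := sumE (size q); rewrite -poly_def coefK.
Qed.

(** If [w t0 > 0], test [w] against the powers of
    [Q = 1 + eta - (e^(- t) - e^(- t0))^2]: on an interval that starts at [t0] they
    are at least 1 while [w] stays away from 0, and away from [t0] they decay like
    [(1 - eta)^n], so that the integrals, which all vanish, would be bounded
    below by a positive constant. *)
Lemma laplace_eq0_le0 (t0 : R) : 0 < t0 -> w t0 <= 0.
Proof.
move=> t00; rewrite leNgt; apply/negP => wt0.
pose c := w t0 / 2; have c0 : 0 < c by rewrite divr_gt0.
have [d d0 hd] : exists2 d : R, 0 < d & forall t : R, `|t - t0| < d -> c < w t.
  have := cw t00; move/cvgrPdist_lt => /(_ c c0)[e /= e0 he].
  exists e => // t te; have := he t; rewrite /= distrC => /(_ te).
  by rewrite ltr_norml /c; lra.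
pose d1 := Num.min d t0 / 2.
have m0 : 0 < Num.min d t0 by rewrite lt_min d0.
have d10 : 0 < d1 by rewrite divr_gt0.
have d1d : d1 < d.
  have : Num.min d t0 <= d by rewrite ge_min lexx.
  by rewrite /d1; lra.
pose y0 := expR (- t0).
pose g := Num.min (expR (- (t0 - d1)) - y0) (y0 - expR (- (t0 + d1))).
have g0 : 0 < g by rewrite lt_min !subr_gt0 !ltr_expR; apply/andP; split; lra.
have y01 : 0 < y0 <= 1 by rewrite expR_gt0 expR_le1 oppr_le0 ltW.
have g1 : g <= 1.
  have : g <= y0 - expR (- (t0 + d1)) by rewrite ge_min lexx orbT.
  by have := expR_gt0 (- (t0 + d1)); case/andP: y01; lra.
pose eta := g ^+ 2 / 2.
have eta0 : 0 < eta by rewrite divr_gt0 ?exprn_gt0.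
have eta1 : eta <= 2^-1.
  have : g ^+ 2 <= 1 by rewrite exprn_ile1// ltW.
  by rewrite /eta; lra.
pose Q : {poly R} := (1 + eta)%:P - ('X - y0%:P) ^+ 2.
have QE (t : R) : Q.[expR (- t)] = 1 + eta - (expR (- t) - y0) ^+ 2 by rewrite /Q !hornerE.
have [d2 d20 hd2] : exists2 e : R, 0 < e & forall t : R, `|t - t0| < e -> (expR (- t) - y0) ^+ 2 <= eta.
  have ce : {for t0, continuous (fun t : R => expR (- t))}.
    exact: (isd_continuous (isd_comp (is_derive_expR _) (isd_opp (@is_derive_id _ _ t0 1)))).
  have s0 : 0 < Num.sqrt eta by rewrite sqrtr_gt0.
  move: ce; move/cvgrPdist_lt => /(_ _ s0)[e /= e0 he].
  exists e => // t te; have := he t; rewrite /= distrC => /(_ te).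
  rewrite -/y0 distrC => h.
  rewrite -real_normK ?num_real// -(sqr_sqrtr (ltW eta0)).
  by rewrite ler_pXn2r ?nnegrE ?sqrtr_ge0// ltW.
pose d3 := Num.min d1 d2 / 2.
have m1 : 0 < Num.min d1 d2 by rewrite lt_min d10.
have d31 : d3 < d1.
  have : Num.min d1 d2 <= d1 by rewrite ge_min lexx.
  by rewrite /d3; lra.
have d32 : d3 < d2.
  have : Num.min d1 d2 <= d2 by rewrite ge_min lexx orbT.
  by rewrite /d3; lra.
have d30 : 0 < d3 by rewrite divr_gt0.
pose S : set R := `[t0, (t0 + d3)]%classic.
have Q0 (t : R) : 0 < t -> 0 <= Q.[expR (- t)].
  move=> t_gt0; rewrite QE.
  have h1 := expR_gt0 (- t); have h2 : expR (- t) <= 1 by rewrite expR_le1 oppr_le0 ltW.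
  have : (expR (- t) - y0) ^+ 2 <= 1.
    by rewrite -real_normK ?num_real// exprn_ile1// ler_norml; case/andP: y01; lra.
  lra.
have far (t : R) : 0 < t -> d1 <= `|t - t0| -> Q.[expR (- t)] <= 1 - eta.
  move=> t_gt0 tt; rewrite QE; suff : 2 * eta <= (expR (- t) - y0) ^+ 2 by lra.
  rewrite /eta mulrCA divff ?mulr1//.
  rewrite -[leRHS]real_normK ?num_real// ler_pXn2r ?nnegrE ?(ltW g0)//.
  have [h|h] := leP t t0.
    have e1 : expR (- (t0 - d1)) <= expR (- t).
      by rewrite ler_expR lerN2; move: tt; rewrite distrC ger0_norm ?subr_ge0//; lra.
    have e2 : g <= expR (- (t0 - d1)) - y0 by rewrite ge_min lexx.
    by rewrite (le_trans _ (ler_norm _))//; lra.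
  have e1 : expR (- t) <= expR (- (t0 + d1)).
    by rewrite ler_expR lerN2; move: tt; rewrite gtr0_norm ?subr_gt0//; lra.
  have e2 : g <= y0 - expR (- (t0 + d1)) by rewrite ge_min lexx orbT.
  by rewrite distrC (le_trans _ (ler_norm _))//; lra.
have SR : S `<=` Rpos.
  by move=> t; rewrite /S /= !in_itv/= andbT => /andP[+ _]; exact: lt_le_trans.
have mS : measurable (S : set (measurableTypeR R)) by exact: measurable_itv.
have mR := @measurable_Rpos R.
pose lo n (t : R) := c * \1_S t - (1 - eta) ^+ n * `|w t|.
have q0 : 0 <= 1 - eta by lra.
have lo_le n (t : R) : 0 < t -> lo n t <= (Q ^+ n).[expR (- t)] * w t.
  move=> t_gt0; rewrite horner_exp /lo; have Qt := Q0 t t_gt0.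
  have Qn : 0 <= Q.[expR (- t)] ^+ n by rewrite exprn_ge0.
  have pn : 0 <= (1 - eta) ^+ n * `|w t| by rewrite mulr_ge0// exprn_ge0.
  have [tS|tS] := boolP (t \in S).
    rewrite indicE tS mulr1; move: tS; rewrite inE /S /= in_itv/= => /andP[a1 a2].
    have n1 : `|t - t0| < d2 by rewrite ger0_norm ?subr_ge0//; lra.
    have n2 : `|t - t0| < d by rewrite ger0_norm ?subr_ge0//; lra.
    have Q1 : 1 <= Q.[expR (- t)] by rewrite QE; have := hd2 _ n1; lra.
    have : 1 * c <= Q.[expR (- t)] ^+ n * w t.
      by apply: ler_pM => //; [exact: ltW|exact: exprn_ege1|exact/ltW/hd].
    lra.
  rewrite indicE (negbTE tS) mulr0 sub0r.
  have [nr|fr] := ltP `|t - t0| d1.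
    have wt : 0 <= w t by rewrite ltW// (lt_trans c0)// hd// (lt_trans nr).
    by rewrite (@le_trans _ _ 0) ?oppr_le0// mulr_ge0.
  rewrite lerNl; apply: le_trans (ler_norm _) _; rewrite normrN normrM (ger0_norm Qn).
  by rewrite ler_wpM2r// lerXn2r ?nnegrE// far.
pose I := \int[mu]_(t in Rpos) `|w t|.
have i1 : mu.-integrable Rpos (EFin \o (fun t => c * \1_S t)).
  apply: integrable_RposZl; apply: (integrableS measurableT) => //.
  exact: (@integrable_indic_itv R t0 (t0 + d3) true false).
have i2 n : mu.-integrable Rpos (EFin \o (fun t => (1 - eta) ^+ n * `|w t|)).
  exact/integrable_RposZl/integrable_norm.
have muS : \int[mu]_(t in Rpos) \1_S t = d3.
  rewrite /Rintegral integral_indic// setIidl//.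
  rewrite /mu/= lebesgue_measure_itv/= lte_fin ltrDl d30.
  by rewrite -EFinB/= addrAC subrr add0r.
have key n : c * d3 <= (1 - eta) ^+ n * I.
  have iL : mu.-integrable Rpos (EFin \o lo n).
    have -> : EFin \o lo n = ((EFin \o (fun t => (c * \1_S t)%R)) \- (EFin \o (fun t => ((1 - eta) ^+ n * `|w t|)%R)))%E.
      by apply/funext => t; rewrite /= -EFinB.
    exact: integrableB.
  have := le_Rintegral mR iL (ipw (Q ^+ n)) (fun t tR => lo_le n t (Rpos_gt0 tR)).
  rewrite poly_w0 /lo RintegralB// !RintegralZl//.
  - by rewrite muS -/I subr_le0.
  - exact: integrable_norm.
  - apply: (integrableS measurableT) => //.
    exact: (@integrable_indic_itv R t0 (t0 + d3) true false).
have : c * d3 <= 0.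
  have cvg0 : (1 - eta) ^+ n * I @[n --> \oo] --> 0 * I.
    by apply: cvgM; [apply: cvg_expr; rewrite ger0_norm//; lra|exact: cvg_cst].
  rewrite mul0r in cvg0.
  rewrite -(cvg_lim (@Rhausdorff R) cvg0); apply: limr_ge; first exact: cvgP cvg0.
  exact: nearW.
by rewrite leNgt mulr_gt0.
Qed.

End kernel.

(** Uniqueness of the Laplace transform: already its values on an arithmetic
    progression determine a continuous function, since the powers of [expR (- t)]
    can be combined into kernels concentrated at any given point. *)
Lemma laplace_eq0 (w : R -> R) : (forall t : R, 0 < t -> {for t, continuous w}) ->
  mu.-integrable (Rpos : set R) (EFin \o w) ->
  (forall n : nat, \int[mu]_(t in Rpos) (expR (- (n%:R * t)) * w t) = 0) ->
  forall t, 0 < t -> w t = 0.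
Proof.
move=> cw iw w0 t t0; apply/eqP; rewrite eq_le; apply/andP; split; first exact: laplace_eq0_le0.
rewrite -oppr_le0; apply: (@laplace_eq0_le0 (fun t => - w t)) => //.
- by move=> s s0; apply: cvgN; exact: cw.
- have := integrable_RposZl (-1) iw; apply: eq_integrable; first exact: measurable_Rpos.
  by move=> s _ /=; rewrite mulN1r.
- move=> n; under eq_Rintegral do rewrite mulrN -mulN1r.
  rewrite RintegralZl ?w0 ?mulr0//.
  apply: (@integrable_Rpos_dominated _ (fun t => `|w t|)).
  + move=> s s0; apply: cvgM; last exact: cw.
    exact: continuous_expRM.
  + exact: integrable_norm.
  + move=> s s0; rewrite normrM ger0_norm ?expR_ge0// ler_piMl// expR_le1 oppr_le0.
    by rewrite mulr_ge0// ltW.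
Qed.

End laplace_uniqueness.

(** * The integral representation of the Mittag-Leffler function *)

Section mittag_leffler_integral.
Context {R : realType}.
Notation mu := (@lebesgue_measure R).

Lemma ge0_Rpos_measurable (f : R -> R) : (forall t : R, 0 < t -> {for t, continuous f}) ->
  measurable_fun (Rpos : set R) (EFin \o f).
Proof. by move=> cf; apply/measurable_EFinP; exact: continuous_Rpos_measurable. Qed.

Lemma EFin_Rintegral (f : R -> R) : mu.-integrable (Rpos : set R) (EFin \o f) ->
  (\int[mu]_(r in Rpos) (f r)%:E = (\int[mu]_(r in Rpos) f r)%:E)%E.
Proof.
by move=> h; rewrite /Rintegral fineK//; exact: (integrable_fin_num (@measurable_Rpos R) h).
Qed.

Lemma integral_expRM (p : R) : 0 < p ->
  (\int[mu]_(t in Rpos) (expR (- (p * t)))%:E = (p^-1)%:E)%E.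
Proof.
move=> p0; have iE : mu.-integrable (Rpos : set R) (EFin \o (fun t => expR (- (p * t)))).
  have := @integrable_euler R 1 p ltr01 p0; apply: eq_integrable; first exact: measurable_Rpos.
  by move=> t _; rewrite /= /euler subrr powRr0 mul1r.
pose f (t : R) := p * expR (- p * t).
have h : (\int[mu]_t (((EFin \o f) \_ `[0%R, +oo[) t) = 1)%E.
  by rewrite restrict_EFin; exact: integral_exponential_pdf.
rewrite -integral_mkcond -integral_itv_obnd_cbnd in h; last first.
  apply/measurable_EFinP; apply: continuous_Rpos_measurable => t _.
  exact: (isd_continuous (isd_scale p (isd_comp (is_derive_expR _)
    (isd_scale (- p) (@is_derive_id _ _ t 1))))).
rewrite EFin_Rintegral//; congr (_%:E); have pn : p != 0 by rewrite gt_eqF.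
rewrite -[LHS](mulKf pn) -RintegralZl//.
rewrite /Rintegral; under eq_integral do rewrite -mulNr.
by rewrite h mulr1.
Qed.

Variables (al lam : R).
Hypotheses (al01 : 0 < al < 1) (lam0 : 0 < lam).
Let al0 : 0 < al. Proof. by case/andP: al01. Qed.

(** The completely monotone function with spectral density [mlker al lam]. *)
Definition relaxation (t : R) := \int[mu]_(r in Rpos) (expR (- (t * r)) * mlker al lam r).

Let ker_ge0 (r : R) : 0 < r -> 0 <= mlker al lam r.
Proof. by move=> r0; have [C _ h] := mlker_dom al01 lam0; case/andP: (h r r0). Qed.

Lemma integrable_mlker : mu.-integrable (Rpos : set R) (EFin \o mlker al lam).
Proof.
have [C _ h] := mlker_dom al01 lam0.
apply: (@integrable_Rpos_dominated _ _ (fun r => C * dom al r)).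
- by move=> r; exact: continuous_mlker.
- exact/integrable_RposZl/integrable_dom.
- by move=> r r0; have /andP[h1 h2] := h r r0; rewrite ger0_norm.
Qed.

Let cEK (t r : R) : 0 < r -> {for r, continuous (fun r => expR (- (t * r)) * mlker al lam r)}.
Proof.
by move=> r0; apply: cvgM; [exact: continuous_expRM|exact: continuous_mlker].
Qed.

Lemma integrable_expR_mlker (t : R) : 0 <= t ->
  mu.-integrable (Rpos : set R) (EFin \o (fun r => expR (- (t * r)) * mlker al lam r)).
Proof.
move=> t0; apply: (integrable_Rpos_dominated _ integrable_mlker).
  by move=> r; exact: cEK.
move=> r r0; rewrite normrM !ger0_norm ?expR_ge0 ?ker_ge0//.
by rewrite ler_piMl ?ker_ge0// expR_le1 oppr_le0 mulr_ge0// ltW.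
Qed.

Lemma continuous_relaxation (t : R) : 0 < t -> {for t, continuous relaxation}.
Proof.
move=> t0.
have inI (x : R) : `]0, (t + 1)[%classic x -> 0 < x by rewrite /= in_itv/= => /andP[].
have := @continuity_under_integral R _ _ mu (fun t r => expR (- (t * r)) * mlker al lam r) Rpos
  (@measurable_Rpos R) 0 (t + 1)
  (fun x xI => integrable_expR_mlker (ltW (inI x xI))) _ (mlker al lam) integrable_mlker _.
move=> h; have {}h := h _ _ t; apply: h.
- apply: aeW => r rR x _; apply: cvgM; last exact: cvg_cst.
  exact: (isd_continuous (isd_comp (is_derive_expR _)
    (isd_opp (isd_mul (@is_derive_id _ _ x 1) (isd_cst r x))))).
- move=> x /inI x0; apply: aeW => r /Rpos_gt0 r0.
  rewrite normrM !ger0_norm ?expR_ge0 ?ker_ge0//.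
  by rewrite ler_piMl ?ker_ge0// expR_le1 oppr_le0 mulr_ge0// ltW.
- by rewrite inE /= in_itv/= t0 ltrDl ltr01.
Qed.

(** Tonelli's theorem, with the inner integral [1 / (p + r)]. *)
Let laplace_relaxation_ereal (p : R) : 0 < p ->
  (\int[mu]_(t in Rpos) (expR (- (p * t)) * relaxation t)%:E =
   \int[mu]_(r in Rpos) (mlker al lam r / (p + r))%:E)%E.
Proof.
move=> p0; have mR := @measurable_Rpos R.
pose u : R -> R := (fun t => expR (- (p * t))) \_ Rpos.
pose k : R -> R := mlker al lam \_ Rpos.
pose F := fun tr : measurableTypeR R * measurableTypeR R =>
  (u tr.1 * expR (- (tr.1 * tr.2)) * k tr.2)%:E.
have mu_ : measurable_fun (setT : set (measurableTypeR R)) u.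
  apply/(measurable_restrictT _ mR); apply: continuous_Rpos_measurable => t _.
  exact: continuous_expRM.
have mk_ : measurable_fun (setT : set (measurableTypeR R)) k.
  apply/(measurable_restrictT _ mR); apply: continuous_Rpos_measurable => t t0.
  exact: continuous_mlker.
have mF : measurable_fun setT F.
  apply/measurable_EFinP; apply: measurable_funM; last first.
    by apply: (measurableT_comp mk_); exact: measurable_snd.
  apply: measurable_funM; first by apply: (measurableT_comp mu_); exact: measurable_fst.
  apply: (measurableT_comp (@measurable_expR R)).
  by apply: measurable_funN; apply: measurable_funM; [exact: measurable_fst|exact: measurable_snd].
have u0 t : 0 <= u t by rewrite /u patchE; case: ifP => // _; exact: expR_ge0.
have k0 r : 0 <= k r.
  by rewrite /k patchE; case: ifPn => //; rewrite inE => /Rpos_gt0 r0; exact: ker_ge0.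
have F0 tr : (0 <= F tr)%E by rewrite lee_fin !mulr_ge0 ?expR_ge0.
have := @fubini_tonelli _ _ _ _ _ mu mu F mF F0.
have E1 t : (\int[mu]_r F (t, r) =
    ((fun t => (expR (- (p * t)) * relaxation t)%:E) \_ Rpos) t)%E.
  rewrite patchE; case: ifPn => [|tR].
    rewrite inE => /[dup] tR /Rpos_gt0 t0.
    transitivity (\int[mu]_(r in Rpos) (expR (- (p * t)) * (expR (- (t * r)) * mlker al lam r))%:E)%E.
      rewrite [RHS]integral_mkcond; apply: eq_integral => r _; rewrite /F /k /u !patchE /= (mem_set tR).
      by case: ifP => _; rewrite ?mulr0// mulrA.
    rewrite EFin_Rintegral.
      rewrite RintegralZl//; exact: integrable_expR_mlker (ltW t0).
    by apply: integrable_RposZl; exact: integrable_expR_mlker (ltW t0).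
  rewrite (_ : (fun r => F (t, r)) = cst 0%E) ?integral0//.
  by apply/funext => r; rewrite /F /u patchE /= (negbTE tR) !mul0r.
have E2 r : (\int[mu]_t F (t, r) = ((fun r => (mlker al lam r / (p + r))%:E) \_ Rpos) r)%E.
  rewrite patchE; case: ifPn => [|rR].
    rewrite inE => /[dup] rR /Rpos_gt0 r0.
    have pr : 0 < p + r by rewrite addr_gt0.
    transitivity (\int[mu]_(t in Rpos) ((mlker al lam r)%:E * (expR (- ((p + r) * t)))%:E))%E.
      rewrite [RHS]integral_mkcond; apply: eq_integral => t _; rewrite /F /k /u !patchE /= (mem_set rR).
      case: ifP => _; rewrite ?mul0r//= -EFinM; congr (_%:E).
      by rewrite mulrC -expRD; congr (_ * expR _); ring.
    rewrite ge0_integralZl//.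
    - by rewrite integral_expRM.
    - by apply: ge0_Rpos_measurable => t _; exact: continuous_expRM.
    - by rewrite lee_fin ker_ge0.
  rewrite (_ : (fun t => F (t, r)) = cst 0%E) ?integral0//.
  by apply/funext => t; rewrite /F /k patchE /= (negbTE rR) mulr0.
move=> tonelli; rewrite [LHS]integral_mkcond [RHS]integral_mkcond.
have e1 := @eq_integral _ _ _ mu setT _ _ (fun t _ => E1 t).
have e2 := @eq_integral _ _ _ mu setT _ _ (fun r _ => E2 r).
exact: etrans (esym e1) (etrans tonelli e2).
Qed.

(** The substitution [r := p r] replaces [lam] by [lam / p^al] and [p] by 1. *)
Let integral_mlker_shift (p : R) : 0 < p ->
  (\int[mu]_(r in Rpos) (mlker al lam r / (p + r))%:E = (p^-1 * (pi / (1 + lam / p `^ al)))%:E)%E.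
Proof.
move=> p0; have P0 : 0 < p `^ al by rewrite powR_gt0.
have l1 : 0 < lam / p `^ al by rewrite divr_gt0.
rewrite (ge0_integral_Rpos_scale p0); last 2 first.
- move=> r r0; apply: cvgM; first exact: continuous_mlker.
  by apply: cvgV; [rewrite gt_eqF// addr_gt0|apply: cvgD; [exact: cvg_cst|exact: cvg_id]].
- by move=> r r0; rewrite divr_ge0 ?ker_ge0// addr_ge0// ltW.
have iK : mu.-integrable (Rpos : set R) (EFin \o (fun r => mlker al (lam / p `^ al) r / (1 + r))).
  apply/integrableP; split.
    apply: ge0_Rpos_measurable => r r0; apply: cvgM; first exact: continuous_mlker.
    by apply: cvgV; [rewrite gt_eqF// addr_gt0|apply: cvgD; [exact: cvg_cst|exact: cvg_id]].
  rewrite (@eq_integral _ _ _ mu Rpos (EFin \o (fun r => mlker al (lam / p `^ al) r / (1 + r)))).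
    by have := integral_mlker_stieltjes al01 l1 => /= ->; rewrite ltry.
  move=> r; rewrite inE => /Rpos_gt0 r0 /=; rewrite ger0_norm// divr_ge0 ?addr_ge0 ?(ltW r0)//.
  by have [C _ h] := mlker_dom al01 l1; case/andP: (h r r0).
rewrite EFinM -(integral_mlker_stieltjes al01 l1) (EFin_Rintegral iK) -EFinM.
rewrite -RintegralZl//.
rewrite -EFin_Rintegral; last exact: integrable_RposZl.
apply: eq_integral => r; rewrite inE => /Rpos_gt0 r0; congr (_%:E).
have := mlker_denom_neq0 al01 lam0 (mulr_gt0 p0 r0).
rewrite /mlker powRM ?(ltW p0) ?(ltW r0)// => D0.
have D1 : lam ^+ 2 + 2 * lam * r `^ al * cos (al * pi) * p `^ al +
    r `^ al ^+ 2 * (p `^ al * p `^ al) != 0.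
  by move: D0; congr (_ != 0); ring.
rewrite [X in X / (p + p * r)](_ : _ = p^-1 * (lam / p `^ al * r `^ al * sin (al * pi) /
  (r * ((lam / p `^ al) ^+ 2 + 2 * (lam / p `^ al) * r `^ al * cos (al * pi) + (r `^ al) ^+ 2)))).
  field; rewrite D1 (gt_eqF P0) (gt_eqF r0) (gt_eqF p0) gt_eqF ?addr_gt0//=.
  by rewrite gt_eqF// addr_gt0// mulr_gt0.
by field; rewrite D1 (gt_eqF P0) (gt_eqF r0) (gt_eqF p0).
Qed.

(** Both sides have the Laplace transform [pi * p^(al - 1) / (p^al + lam)] at the
    points [p = p0 + n], where [p0] is large enough for the series to be integrated
    term by term; the factor [e^(- p0 t)] makes the difference integrable. *)
Lemma relaxation_mittag_leffler (t : R) : 0 < t ->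
  relaxation t = pi * mittag_leffler al 1 (- (lam * t `^ al)).
Proof.
pose p0 := (2 * lam) `^ al^-1.
have l2 : 0 < 2 * lam by rewrite mulr_gt0.
have p00 : 0 < p0 by rewrite powR_gt0.
have p0E : p0 `^ al = 2 * lam by rewrite /p0 -powRrM mulVf ?gt_eqF// powRr1// ltW.
have pp (n : nat) : 0 < p0 + n%:R by rewrite ltr_pwDl.
have lp (n : nat) : lam < (p0 + n%:R) `^ al.
  apply: (@lt_le_trans _ _ (p0 `^ al)); first by rewrite p0E; lra.
  apply: ge0_ler_powR; rewrite ?nnegrE ?(ltW al0) ?(ltW p00) ?(ltW (pp n))//.
  by rewrite lerDl.
pose h t := relaxation t - pi * mittag_leffler al 1 (- (lam * t `^ al)).
have mR := @measurable_Rpos R.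
have iml (n : nat) := laplace_mittag_leffler al0 lam0 (pp n) (lp n).
have crel (p s : R) : 0 < s -> {for s, continuous (fun s => expR (- (p * s)) * relaxation s)}.
  by move=> s0; apply: cvgM; [exact: continuous_expRM|exact: continuous_relaxation].
have rel_ge0 (s : R) : 0 < s -> 0 <= relaxation s.
  by move=> s0; apply: Rintegral_ge0 => r /Rpos_gt0 r0; rewrite mulr_ge0 ?expR_ge0 ?ker_ge0.
have Erel (n : nat) := laplace_relaxation_ereal (pp n).
have irel (n : nat) : mu.-integrable (Rpos : set R) (EFin \o (fun t => expR (- ((p0 + n%:R) * t)) * relaxation t)).
  apply/integrableP; split; first by apply: ge0_Rpos_measurable => s; exact: crel.
  rewrite (@eq_integral _ _ _ mu Rpos (EFin \o (fun t => expR (- ((p0 + n%:R) * t)) * relaxation t))).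
    by rewrite /= Erel integral_mlker_shift// ltry.
  move=> s; rewrite inE => /Rpos_gt0 s0 /=; rewrite ger0_norm//.
  by rewrite mulr_ge0 ?expR_ge0 ?rel_ge0.
have Vrel (n : nat) : \int[mu]_(t in Rpos) (expR (- ((p0 + n%:R) * t)) * relaxation t) =
    (p0 + n%:R)^-1 * (pi / (1 + lam / (p0 + n%:R) `^ al)).
  by rewrite /Rintegral Erel integral_mlker_shift.
have ch (s : R) : 0 < s -> {for s, continuous (fun s => expR (- (p0 * s)) * h s)}.
  move=> s0; apply: cvgM; first exact: continuous_expRM.
  apply: cvgB; first exact: continuous_relaxation.
  by apply: cvgM; [exact: cvg_cst|exact: continuous_ml_powR].
have hE (n : nat) : (fun s => expR (- ((p0 + n%:R) * s)) * h s) =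
    (fun s => expR (- ((p0 + n%:R) * s)) * relaxation s -
      pi * (expR (- ((p0 + n%:R) * s)) * mittag_leffler al 1 (- (lam * s `^ al)))).
  by apply/funext => s; rewrite /h; ring.
have ih (n : nat) : mu.-integrable (Rpos : set R) (EFin \o (fun s => expR (- ((p0 + n%:R) * s)) * h s)).
  rewrite hE; have := integrableB mR (irel n) (integrable_RposZl pi (iml n).1).
  by apply: eq_integrable.
have ih0 : mu.-integrable (Rpos : set R) (EFin \o (fun s => expR (- (p0 * s)) * h s)).
  by have := ih 0%N; rewrite addr0.
have zh (n : nat) : \int[mu]_(s in Rpos) (expR (- (n%:R * s)) * (expR (- (p0 * s)) * h s)) = 0.
  transitivity (\int[mu]_(s in Rpos) (expR (- ((p0 + n%:R) * s)) * h s)).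
    apply: eq_Rintegral => s _; rewrite mulrA -expRD; congr (expR _ * _); ring.
  have [i1 E1] := iml n.
  rewrite hE RintegralB//; last exact: integrable_RposZl.
  by rewrite RintegralZl// E1 Vrel; ring.
move=> t0; have := laplace_eq0 ch ih0 zh t0.
by move/eqP; rewrite mulf_eq0 gt_eqF ?expR_gt0//= subr_eq0 => /eqP.
Qed.

End mittag_leffler_integral.

(** * Expansion of the kernel in inverse powers of the eigenvalue *)

Section kernel_expansion.
Context {R : realType}.
Implicit Types (y th al lam r : R) (m k : nat).

(** The imaginary part of [e^(i m.+1 th) / (1 + y e^(i th))]: up to the factor
    [(-1) ^+ m * y ^+ m.+1], the tail of a geometric series. *)
Definition geom_tail m y th :=
  (sin (m.+1%:R * th) + y * sin (m%:R * th)) / (1 + 2 * y * cos th + y ^+ 2).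

Lemma sin_recurrence m th :
  sin (m.+2%:R * th) = 2 * cos th * sin (m.+1%:R * th) - sin (m%:R * th).
Proof.
have e1 : m.+2%:R * th = m.+1%:R * th + th by rewrite -[m.+2]addn1 natrD mulrDl mul1r.
have e2 : m%:R * th = m.+1%:R * th - th by rewrite -[m.+1]addn1 natrD mulrDl mul1r addrK.
by rewrite e1 e2 sinD sinB; ring.
Qed.

(** Consecutive tails differ by one term of the sum: after multiplication by
    [1 + 2 y cos th + y^2] this is the addition formula [sin_recurrence]. *)
Lemma geom_expansion m y th : 1 + 2 * y * cos th + y ^+ 2 != 0 ->
  y * sin th / (1 + 2 * y * cos th + y ^+ 2) =
  \sum_(0 <= k < m) (-1) ^+ k * (y ^+ k.+1 * sin (k.+1%:R * th)) +
  (-1) ^+ m * y ^+ m.+1 * geom_tail m y th.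
Proof.
move=> D0; elim: m => [|m IH].
  rewrite big_geq// add0r /geom_tail (mul0r th) sin0 mulr0 addr0.
  have -> : 1%:R * th = th by rewrite mul1r.
  by field.
rewrite big_nat_recr//= IH -!addrA; congr (_ + _).
by rewrite /geom_tail sin_recurrence !exprS; field.
Qed.

(** The denominator is [|1 + y e^(i th)|^2]; it stays away from 0 as long as [th]
    stays away from [pi], that is, [al] from 1. *)
Lemma geom_denom_ge y th : 0 <= y ->
  (1 + cos th) / 2 * (1 + y) ^+ 2 <= 1 + 2 * y * cos th + y ^+ 2.
Proof.
move=> y0; rewrite -subr_ge0.
have -> : 1 + 2 * y * cos th + y ^+ 2 - (1 + cos th) / 2 * (1 + y) ^+ 2 =
  (1 - cos th) / 2 * (1 - y) ^+ 2 by field.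
by rewrite mulr_ge0 ?sqr_ge0// divr_ge0// subr_ge0 cos_le1.
Qed.

Lemma geom_denom_neq0 lam al r : 0 < al < 1 -> 0 < lam -> 0 < r ->
  1 + 2 * (r `^ al / lam) * cos (al * pi) + (r `^ al / lam) ^+ 2 != 0.
Proof.
move=> al01 lam0 r0; have D0' := mlker_denom_neq0 al01 lam0 r0.
have ln0 : lam != 0 by rewrite gt_eqF.
have -> : 1 + 2 * (r `^ al / lam) * cos (al * pi) + (r `^ al / lam) ^+ 2 =
    (lam ^+ 2 + 2 * lam * r `^ al * cos (al * pi) + (r `^ al) ^+ 2) / lam ^+ 2 by field.
by rewrite mulf_neq0// invr_eq0 expf_neq0.
Qed.

(** The remainder of order [m] in the expansion of [mlker] in powers of [lam^-1]. *)
Definition mlker_rem m lam al r :=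
  (-1) ^+ m * lam^-1 ^+ m.+1 * (r `^ (m.+1%:R * al - 1) * geom_tail m (r `^ al / lam) (al * pi)).

Lemma mlker_expansion m lam al r : 0 < al < 1 -> 0 < lam -> 0 < r ->
  mlker al lam r = \sum_(0 <= k < m)
    (-1) ^+ k * lam^-1 ^+ k.+1 * sin (k.+1%:R * (al * pi)) * r `^ (k.+1%:R * al - 1)
  + mlker_rem m lam al r.
Proof.
move=> al01 lam0 r0; pose y := r `^ al / lam.
have ln0 : lam != 0 by rewrite gt_eqF.
have rn0 : r != 0 by rewrite gt_eqF.
have D0' := mlker_denom_neq0 al01 lam0 r0.
have D0 : 1 + 2 * y * cos (al * pi) + y ^+ 2 != 0 by exact: geom_denom_neq0.
have pE k : r `^ (k.+1%:R * al - 1) = r^-1 * (r `^ al) ^+ k.+1.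
  by rewrite powR_sub1// mulrC mulrC (mulrC _ al) powRrM powR_mulrn ?powR_ge0// mulrC.
have -> : mlker al lam r = r^-1 * (y * sin (al * pi) / (1 + 2 * y * cos (al * pi) + y ^+ 2)).
  have D1 : (lam + 2 * r `^ al * cos (al * pi)) * lam + r `^ al ^+ 2 != 0.
    by move: D0'; congr (_ != 0); ring.
  by rewrite /mlker /y; field; rewrite ln0 rn0 D1.
rewrite (geom_expansion m D0) mulrDr mulr_sumr; congr (_ + _).
  by apply: eq_bigr => k _; rewrite pE /y expr_div_n exprVn; field; rewrite rn0 expf_neq0.
by rewrite /mlker_rem pE -/y /y expr_div_n exprVn; field; rewrite rn0 expf_neq0.
Qed.

(** The derivative of [mlker_rem] with respect to [al]; [N / D] is [geom_tail], and
    [dN], [dD] are the derivatives of its numerator and denominator. *)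
Definition mlker_rem_d m lam al r :=
  let y := r `^ al / lam in let th := al * pi in
  let D := 1 + 2 * y * cos th + y ^+ 2 in
  let N := sin (m.+1%:R * th) + y * sin (m%:R * th) in
  let dN := m.+1%:R * pi * cos (m.+1%:R * th) + ln r * y * sin (m%:R * th) +
    y * (m%:R * pi * cos (m%:R * th)) in
  let dD := 2 * ln r * y * cos th - 2 * y * pi * sin th + 2 * ln r * y ^+ 2 in
  (-1) ^+ m * lam^-1 ^+ m.+1 * (r `^ (m.+1%:R * al - 1) *
    (m.+1%:R * ln r * (N / D) + (dN / D - N * dD / D ^+ 2))).

Lemma is_derive_mlker_rem m lam al r : 0 < al < 1 -> 0 < lam -> 0 < r ->
  is_derive al 1 (fun a => mlker_rem m lam a r) (mlker_rem_d m lam al r).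
Proof.
move=> al01 lam0 r0.
have ln0 : lam != 0 by rewrite gt_eqF.
have D0 : 1 + 2 * (r `^ al / lam) * cos (al * pi) + (r `^ al / lam) * (r `^ al / lam) != 0 :=
  geom_denom_neq0 al01 lam0 r0.
have dth : is_derive al 1 (fun a => a * pi) pi.
  by apply: (is_derive_eq (isd_mul (@is_derive_id _ _ al 1) (isd_cst pi al))); ring.
have dk (k : nat) : is_derive al 1 (fun a => k%:R * (a * pi)) (k%:R * pi) by exact: isd_scale.
have dA := isd_powR_exp al r0.
have dy := isd_mul dA (isd_cst lam^-1 al).
have dp : is_derive al 1 (fun a => r `^ (m.+1%:R * a - 1))
    (m.+1%:R * ln r * r `^ (m.+1%:R * al - 1)).
  have d1 : is_derive al 1 (fun a => m.+1%:R * a - 1) m.+1%:R.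
    by apply: (is_derive_eq (isd_add (isd_scale _ (@is_derive_id _ _ al 1)) (isd_cst (-1) al))); ring.
  by apply: (is_derive_eq (@isd_comp _ (fun x => r `^ x) (fun a => m.+1%:R * a - 1) al _ _ (isd_powR_exp _ r0) d1)); ring.
have ds (k : nat) := @isd_comp _ sin (fun a => k%:R * (a * pi)) al _ _ (is_derive_sin _) (dk k).
have dN := isd_add (ds m.+1) (isd_mul dy (ds m)).
have dD := isd_add (isd_add (isd_cst 1 al) (isd_mul (isd_scale 2 dy)
  (@isd_comp _ cos (fun a => a * pi) al _ _ (is_derive_cos _) dth))) (isd_mul dy dy).
have dI := @isd_inv _ (fun a => 1 + 2 * (r `^ a / lam) * cos (a * pi) + (r `^ a / lam) * (r `^ a / lam)) al _ D0 dD.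
apply: (is_derive_eq (isd_scale _ (isd_mul dp (isd_mul dN dI)))).
rewrite /mlker_rem_d /=; move: D0; rewrite -!expr2.
set D := 1 + _ + _ => D0; field.
by rewrite D0 ln0.
Qed.

End kernel_expansion.

(** * Uniform bounds on the remainder of the kernel *)

Section remainder_bounds.
Context {R : realType}.
Variables (b0 b1 : R).
Hypotheses (b00 : 0 < b0) (b01 : b0 < b1) (b11 : b1 < 1).

Let k0 : R := (1 + cos (b1 * pi)) / 2.

Let pi0 : 0 < (pi : R). Proof. exact: pi_gt0. Qed.

Let b1pi : 0 < b1 * pi < pi.
Proof.
have b10 := lt_trans b00 b01.
apply/andP; split; first exact: mulr_gt0.
by rewrite gtr_pMl// pi_gt0.
Qed.

Let k0_gt0 : 0 < k0.
Proof.
have /andP[h1 h2] := b1pi; rewrite divr_gt0//.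
suff : -1 < cos (b1 * pi) by lra.
by rewrite -cospi ltr_cos ?in_itv/= ?lexx ?(ltW pi0) ?(ltW h1) ?(ltW h2).
Qed.

Let k0_le al : b0 < al < b1 -> k0 <= (1 + cos (al * pi)) / 2.
Proof.
move=> /andP[a0 a1]; have /andP[h1 h2] := b1pi.
have h : al * pi < b1 * pi by rewrite ltr_pM2r.
have h0 : 0 < al * pi by rewrite mulr_gt0// (lt_trans b00).
suff : cos (b1 * pi) < cos (al * pi) by rewrite /k0; lra.
by rewrite ltr_cos ?in_itv/=; [|apply/andP; split; lra|apply/andP; split; lra].
Qed.

Let DE al (y : R) : b0 < al < b1 -> 0 <= y ->
  k0 * (1 + y) ^+ 2 <= 1 + 2 * y * cos (al * pi) + y ^+ 2.
Proof.
move=> hal y0; apply: le_trans (geom_denom_ge _ y0).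
by rewrite ler_wpM2r ?sqr_ge0// k0_le.
Qed.

Let y1E (y : R) : 0 <= y -> 1 + y <= (1 + y) ^+ 2.
Proof. by move=> y0; rewrite expr2; nra. Qed.

Let norm_sin_mul (x y : R) : `|x * sin y| <= `|x|.
Proof. by rewrite normrM ler_piMr// sin_max. Qed.

Let norm_cos_mul (x y : R) : `|x * cos y| <= `|x|.
Proof. by rewrite normrM ler_piMr// cos_max. Qed.

Let num_bound m (th y : R) : 0 <= y -> `|sin (m.+1%:R * th) + y * sin (m%:R * th)| <= 1 + y.
Proof.
move=> y0; rewrite (le_trans (ler_normD _ _))// lerD ?sin_max//.
by rewrite (le_trans (norm_sin_mul _ _))// ger0_norm.
Qed.

(** The numerator of [geom_tail] is at most [1 + y] and its denominator at least
    [k0 * (1 + y)^2], whatever [lam] is. *)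
Lemma mlker_rem_bound m : exists2 C : R, 0 <= C & forall lam al r : R, 0 < lam -> b0 < al < b1 -> 0 < r ->
  `|mlker_rem m lam al r| <= C * lam^-1 ^+ m.+1 * r `^ (m.+1%:R * al - 1).
Proof.
have K := k0_gt0.
exists k0^-1 => [|lam al r l0 hal r0]; first by rewrite invr_ge0 ltW.
have y0 : 0 <= r `^ al / lam by rewrite divr_ge0 ?powR_ge0// ltW.
have y1 : 0 < 1 + r `^ al / lam by rewrite ltr_pwDl.
have D := DE hal y0.
have D0 : 0 < 1 + 2 * (r `^ al / lam) * cos (al * pi) + (r `^ al / lam) ^+ 2.
  by rewrite (lt_le_trans _ D)// mulr_gt0// exprn_gt0.
have l1 : 0 <= lam^-1 ^+ m.+1 by rewrite exprn_ge0// invr_ge0 ltW.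
have pw := powR_ge0 r (m.+1%:R * al - 1).
rewrite /mlker_rem normrM normrM normrX normrN1 expr1n mul1r (ger0_norm l1).
rewrite normrM (ger0_norm pw) [leRHS](_ : _ = lam^-1 ^+ m.+1 * (r `^ (m.+1%:R * al - 1) * k0^-1)); last by ring.
apply: ler_wpM2l => //; apply: ler_wpM2l => //.
rewrite /geom_tail; move: D D0 y0 y1; set y := r `^ al / lam; set D := 1 + _ + _ => hD D0 y0 y1.
rewrite normrM normfV (gtr0_norm D0) ler_pdivrMr//.
apply: le_trans (num_bound m _ y0) _.
rewrite ler_pdivlMl//; apply: le_trans hD.
by rewrite ler_wpM2l ?(ltW K)// y1E.
Qed.

(** Differentiating in [al] multiplies powers of [r] by [ln r] and keeps their
    exponents, so that only the logarithm is lost. *)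
Lemma mlker_rem_d_bound m : exists2 C : R, 0 <= C & forall lam al r : R, 0 < lam -> b0 < al < b1 -> 0 < r ->
  `|mlker_rem_d m lam al r| <=
     C * lam^-1 ^+ m.+1 * (r `^ (m.+1%:R * al - 1) * (1 + `|ln r|)).
Proof.
have K := k0_gt0; have p0 := pi0.
pose C1 := m.+1%:R / k0 + ((m.+1%:R + m%:R) * pi + 1) / k0 + (2 + 2 * pi) / k0 ^+ 2 : R.
exists C1.
  have K2 : 0 <= k0 by exact: ltW.
  have h1 : 0 <= (m.+1%:R + m%:R) * pi + 1 :> R by rewrite addr_ge0// mulr_ge0// ltW.
  have h2 : 0 <= 2 + 2 * pi :> R by rewrite addr_ge0// mulr_ge0// ltW.
  by rewrite /C1; apply: addr_ge0; [apply: addr_ge0|]; rewrite divr_ge0// exprn_ge0.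
move=> lam al r l0 hal r0.
have y0 : 0 <= r `^ al / lam by rewrite divr_ge0 ?powR_ge0// ltW.
have y1 : 0 < 1 + r `^ al / lam by rewrite ltr_pwDl.
have D := DE hal y0.
have D0 : 0 < 1 + 2 * (r `^ al / lam) * cos (al * pi) + (r `^ al / lam) ^+ 2.
  by rewrite (lt_le_trans _ D)// mulr_gt0// exprn_gt0.
have l1 : 0 <= lam^-1 ^+ m.+1 by rewrite exprn_ge0// invr_ge0 ltW.
have pw := powR_ge0 r (m.+1%:R * al - 1).
rewrite /mlker_rem_d /=.
rewrite normrM normrM normrX normrN1 expr1n mul1r (ger0_norm l1).
rewrite normrM (ger0_norm pw) [leRHS](_ : _ = lam^-1 ^+ m.+1 * (r `^ (m.+1%:R * al - 1) * (C1 * (1 + `|ln r|)))); last by ring.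
apply: ler_wpM2l => //; apply: ler_wpM2l => //.
move: D D0 y0 y1; set y := r `^ al / lam; set th := al * pi; set D := 1 + _ + _ => hD D0 y0 y1.
set N := sin _ + _ * sin _; set dN := _ + _ + _; set dD := _ - _ + _.
clearbody y th.
set L := `|ln r|; have L0 : 0 <= L by exact: normr_ge0.
have hN : `|N| <= 1 + y by exact: num_bound.
have hDi : (1 + y) / D <= k0^-1.
  rewrite ler_pdivrMr// ler_pdivlMl//; apply: le_trans hD.
  by rewrite ler_wpM2l ?(ltW K)// y1E.
have hDi2 : (1 + y) ^+ 2 / D <= k0^-1.
  by rewrite ler_pdivrMr// ler_pdivlMl.
have hND : `|N / D| <= k0^-1.
  rewrite normrM normfV (gtr0_norm D0); apply: le_trans hDi.
  by rewrite ler_pM2r ?invr_gt0.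
have hdN : `|dN| <= ((m.+1%:R + m%:R) * pi + 1) * ((1 + y) * (1 + L)).
  have t1 : `|m.+1%:R * pi * cos (m.+1%:R * th)| <= m.+1%:R * pi.
    by rewrite (le_trans (norm_cos_mul _ _))// ger0_norm// mulr_ge0// ltW.
  have t2 : `|ln r * y * sin (m%:R * th)| <= L * y.
    by rewrite (le_trans (norm_sin_mul _ _))// normrM (ger0_norm y0).
  have t3 : `|y * (m%:R * pi * cos (m%:R * th))| <= y * (m%:R * pi).
    rewrite normrM (ger0_norm y0) ler_wpM2l//.
    by rewrite (le_trans (norm_cos_mul _ _))// ger0_norm// mulr_ge0// ltW.
  apply: le_trans (ler_normD _ _) _; apply: le_trans (lerD (ler_normD _ _) (lexx _)) _.
  apply: le_trans (lerD (lerD t1 t2) t3) _.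
  have A0 : 0 <= m.+1%:R * pi :> R by rewrite mulr_ge0// ltW.
  have B0 : 0 <= m%:R * pi :> R by rewrite mulr_ge0// ltW.
  rewrite mulrDl (mulrDl _ _ pi) mul1r.
  set a := m.+1%:R * pi in A0 *; set b := m%:R * pi in B0 *.
  have yL : 0 <= y * L by rewrite mulr_ge0.
  have h1 : a <= a * ((1 + y) * (1 + L)) by rewrite ler_peMr// mulr_ege1// lerDl.
  have h2 : y * b <= b * ((1 + y) * (1 + L)).
    rewrite mulrC ler_wpM2l//; lra.
  have h3 : L * y <= (1 + y) * (1 + L) by lra.
  rewrite [leRHS]addrC mulrDl; lra.
have hdD : `|dD| <= (2 + 2 * pi) * ((1 + y) ^+ 2 * (1 + L)).
  have t1 : `|2 * ln r * y * cos th| <= 2 * L * y.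
    by rewrite (le_trans (norm_cos_mul _ _))// !normrM (ger0_norm y0) ger0_norm.
  have t2 : `|2 * y * pi * sin th| <= 2 * y * pi.
    by rewrite (le_trans (norm_sin_mul _ _))// ger0_norm// mulr_ge0 ?mulr_ge0// ltW.
  have t3 : `|2 * ln r * y ^+ 2| <= 2 * L * y ^+ 2.
    by rewrite 2!normrM (ger0_norm (sqr_ge0 y)) ger0_norm.
  apply: le_trans (ler_normD _ _) _; apply: le_trans (lerD (ler_normB _ _) (lexx _)) _.
  apply: le_trans (lerD (lerD t1 t2) t3) _.
  have yL : 0 <= y * L by rewrite mulr_ge0.
  have yy : 0 <= y ^+ 2 by exact: sqr_ge0.
  have yyL : 0 <= y ^+ 2 * L by rewrite mulr_ge0.
  have h1 : pi * (2 * y) <= pi * (2 * ((1 + y) ^+ 2 * (1 + L))).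
    by rewrite ler_wpM2l ?(ltW p0)//; lra.
  have h2 : 2 * L * y + 2 * L * y ^+ 2 <= 2 * ((1 + y) ^+ 2 * (1 + L)) by lra.
  rewrite mulrDl; lra.
have q1 : `|m.+1%:R * ln r * (N / D)| <= m.+1%:R / k0 * (1 + L).
  rewrite normrM (mulrAC _ k0^-1); apply: ler_pM => //.
  by rewrite normrM ger0_norm// ler_wpM2l// lerDr.
have q2 : `|dN / D| <= ((m.+1%:R + m%:R) * pi + 1) / k0 * (1 + L).
  rewrite normrM normfV (gtr0_norm D0).
  apply: (@le_trans _ _ (((m.+1%:R + m%:R) * pi + 1) * ((1 + y) * (1 + L)) / D)).
    by rewrite ler_pM2r ?invr_gt0.
  rewrite (_ : _ / D = ((m.+1%:R + m%:R) * pi + 1) * (1 + L) * ((1 + y) / D)); last by ring.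
  rewrite [leRHS]mulrAC; apply: ler_wpM2l => //; apply: mulr_ge0; last by lra.
  by apply: addr_ge0 => //; apply: mulr_ge0 => //; exact: ltW.
have q3 : `|N * dD / D ^+ 2| <= (2 + 2 * pi) / k0 ^+ 2 * (1 + L).
  rewrite (_ : N * dD / D ^+ 2 = (N / D) * (dD / D)); last by rewrite expr2 invfM; ring.
  rewrite normrM (_ : _ / k0 ^+ 2 * _ = k0^-1 * ((2 + 2 * pi) * (1 + L) * k0^-1)); last first.
    by rewrite expr2 invfM; ring.
  apply: ler_pM => //; rewrite normrM normfV (gtr0_norm D0).
  apply: (@le_trans _ _ ((2 + 2 * pi) * ((1 + y) ^+ 2 * (1 + L)) / D)).
    by rewrite ler_pM2r ?invr_gt0.
  rewrite (_ : _ / D = (2 + 2 * pi) * (1 + L) * ((1 + y) ^+ 2 / D)); last by ring.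
  by rewrite ler_wpM2l// mulr_ge0 ?addr_ge0 ?mulr_ge0// ltW.
apply: le_trans (ler_normD _ _) _.
apply: le_trans (lerD (lexx _) (ler_normB _ _)) _.
apply: le_trans (lerD q1 (lerD q2 q3)) _.
by rewrite /C1 addrA -!(mulrDl _ _ (1 + L)).
Qed.

End remainder_bounds.

(** * Euler integrals with a logarithm *)

Section gamma_log.
Context {R : realType}.
Notation mu := (@lebesgue_measure R).
Implicit Types x t r d : R.
Let mR := @measurable_Rpos R.

Lemma abs_ln_le_powR d r : 0 < d -> 0 < r -> `|ln r| <= (r `^ d + r `^ (- d)) / d.
Proof.
move=> d0 r0.
have p (e : R) : e * ln r < r `^ e by rewrite -ln_powR ln_sublinear// powR_gt0.
have := p d; have := p (- d); have := powR_ge0 r d; have := powR_ge0 r (- d).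
rewrite mulNr => h1 h2 h3 h4.
rewrite ler_pdivlMr// -(gtr0_norm d0) -normrM (gtr0_norm d0) mulrC ler_norml; lra.
Qed.

(** A logarithm is absorbed by a small change of the exponent, downwards near 0 and
    upwards near infinity; the two powers dominate uniformly for [x] in a segment. *)
Lemma powR_log_le d (x0 x1 : R) x r : 0 < d -> x0 <= x <= x1 -> 0 < r ->
  r `^ x * (1 + `|ln r|) <= (1 + 2 / d) * (r `^ (x0 - d) + r `^ (x1 + d)).
Proof.
move=> d0 /andP[xx0 xx1] r0; have K0 : 0 <= 1 + 2 / d by rewrite addr_ge0// divr_ge0// ltW.
have hl := abs_ln_le_powR d0 r0.
have key (p q : R) : 0 <= p -> r `^ x <= p -> 1 <= q -> r `^ d <= q -> r `^ (- d) <= q ->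
    r `^ x * (1 + `|ln r|) <= (1 + 2 / d) * (p * q).
  move=> p0 xp q1 dq dq'; rewrite mulrCA; apply: ler_pM; rewrite ?powR_ge0 ?addr_ge0//.
  rewrite mulrDl mul1r lerD//; apply: le_trans hl _.
  rewrite mulrAC ler_pM2r ?invr_gt0//; lra.
have [r1|r1] := leP r 1.
  have hp (y z : R) : y <= z -> r `^ z <= r `^ y.
    move=> yz; have /= := @ger_powR R r; apply => //; first by rewrite r0 r1.
  apply: le_trans (key (r `^ x0) (r `^ (- d)) _ _ _ _ _) _ => //.
  - exact: powR_ge0.
  - exact: hp.
  - by rewrite -(powRr0 r) hp// oppr_le0 ltW.
  - by apply: hp; lra.
  - by rewrite -powRD ?(gt_eqF r0) ?implybT// ler_wpM2l// lerDl powR_ge0.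
have hp (y z : R) : y <= z -> r `^ y <= r `^ z by move=> yz; rewrite ler_powR// ltW.
apply: le_trans (key (r `^ x1) (r `^ d) _ _ _ _ _) _ => //.
- exact: powR_ge0.
- exact: hp.
- by rewrite -(powRr0 r) hp// ltW.
- by apply: hp; lra.
- by rewrite -powRD ?(gt_eqF r0) ?implybT// ler_wpM2l// lerDr powR_ge0.
Qed.

Lemma continuous_normln r : 0 < r -> {for r, continuous (fun r => 1 + `|ln r|)}.
Proof.
move=> r0; apply: cvgD; first exact: cvg_cst.
by apply: cvg_norm; exact: continuous_ln.
Qed.

Definition euler_log x t r := euler x t r * (1 + `|ln r|).

Lemma euler_log_ge0 x t r : 0 <= euler_log x t r.
Proof. by rewrite mulr_ge0 ?euler_ge0// addr_ge0. Qed.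

Lemma continuous_euler_log x t r : 0 < r -> {for r, continuous (euler_log x t)}.
Proof.
by move=> r0; apply: cvgM; [exact: continuous_euler|exact: continuous_normln].
Qed.

Section envelope.
Variables x0 x1 : R.
Hypotheses (x00 : 0 < x0) (x01 : x0 <= x1).

(** Dominates [euler_log x t] for all [x] in [[x0, x1]] and [t >= 1]; the shift
    [x0 / 2] keeps both exponents positive. *)
Definition euler_env r := (1 + 2 / (x0 / 2)) * (euler (x0 / 2) 1 r + euler (x1 + x0 / 2) 1 r).

Lemma integrable_euler_env : mu.-integrable (Rpos : set R) (EFin \o euler_env).
Proof.
apply: integrable_RposZl.
have h1 : mu.-integrable (Rpos : set R) (EFin \o euler (x0 / 2) 1).
  by apply: integrable_euler => //; rewrite divr_gt0.
have h2 : mu.-integrable (Rpos : set R) (EFin \o euler (x1 + x0 / 2) 1).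
  by apply: integrable_euler => //; rewrite addr_gt0 ?divr_gt0// (lt_le_trans x00).
have := integrableD mR h1 h2; apply: eq_integrable => //; exact: mR.
Qed.

Lemma euler_log_env x t r : x0 <= x <= x1 -> 1 <= t -> 0 < r -> euler_log x t r <= euler_env r.
Proof.
move=> hx t1 r0.
have d0 : 0 < x0 / 2 by rewrite divr_gt0.
have hx' : x0 - 1 <= x - 1 <= x1 - 1 by move: hx; lra.
have := powR_log_le d0 hx' r0.
have e1 : x0 - 1 - x0 / 2 = x0 / 2 - 1 by field.
have e2 : x1 - 1 + x0 / 2 = x1 + x0 / 2 - 1 by ring.
rewrite e1 e2 => h.
rewrite /euler_log /euler_env /euler !mul1r -mulrDl mulrA mulrAC.
apply: ler_pM => //.
- by rewrite mulr_ge0 ?powR_ge0// addr_ge0.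
- by rewrite ler_expR lerN2 ler_peMl// ltW.
Qed.

Lemma integrable_euler_log x t : x0 <= x <= x1 -> 1 <= t ->
  mu.-integrable (Rpos : set R) (EFin \o euler_log x t).
Proof.
move=> hx t1; apply: (integrable_Rpos_dominated _ integrable_euler_env).
  by move=> r; exact: continuous_euler_log.
by move=> r r0; rewrite ger0_norm ?euler_log_ge0// euler_log_env.
Qed.

(** Rescaling [r := r / t] extracts [t^(- x)] and turns [ln r] into [ln r - ln t]. *)
Lemma integral_euler_log_le x t : x0 <= x <= x1 -> 1 <= t ->
  \int[mu]_(r in Rpos) euler_log x t r
    <= (\int[mu]_(r in Rpos) euler_env r) * ((1 + ln t) * t `^ (- x)).
Proof.
move=> hx t1; have t0 : 0 < t by exact: lt_le_trans t1.
have ti0 : 0 < t^-1 by rewrite invr_gt0.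
have lt0 : 0 <= ln t by rewrite ln_ge0.
rewrite {1}/Rintegral (ge0_integral_Rpos_scale ti0); last 2 first.
- by move=> r; exact: continuous_euler_log.
- by move=> r _; exact: euler_log_ge0.
have step r : 0 < r -> t^-1 * euler_log x t (t^-1 * r) <=
    (1 + ln t) * t `^ (- x) * euler_log x 1 r.
  move=> r0; have tr0 : 0 < t^-1 * r by rewrite mulr_gt0.
  rewrite /euler_log /euler mul1r (mulrA t t^-1 r) mulfV ?gt_eqF// mul1r.
  rewrite powRM ?(ltW ti0) ?(ltW r0)// lnM ?posrE// lnV ?posrE//.
  have -> : t^-1 `^ (x - 1) = t * t `^ (- x).
    rewrite powR_sub1// invrK mulrC; congr (_ * _).
    by rewrite -powR_inv1 ?(ltW t0)// -powRrM mulN1r.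
  have -> : t^-1 * (t * t `^ (- x) * r `^ (x - 1) * expR (- r) * (1 + `|- ln t + ln r|)) =
     t `^ (- x) * (r `^ (x - 1) * expR (- r)) * (1 + `|- ln t + ln r|).
    by field; rewrite gt_eqF.
  have -> : (1 + ln t) * t `^ (- x) * (r `^ (x - 1) * expR (- r) * (1 + `|ln r|)) =
     t `^ (- x) * (r `^ (x - 1) * expR (- r)) * ((1 + ln t) * (1 + `|ln r|)) by ring.
  apply: ler_wpM2l; first by rewrite mulr_ge0 ?powR_ge0// mulr_ge0 ?powR_ge0 ?expR_ge0.
  have := ler_normD (- ln t) (ln r); rewrite normrN (ger0_norm lt0).
  have := normr_ge0 (ln r); nra.
have ct r : 0 < r -> {for r, continuous (fun r => t^-1 * euler_log x t (t^-1 * r))}.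
  move=> r0; apply: cvgM; first exact: cvg_cst.
  apply: (@continuous_comp _ _ _ (fun r => t^-1 * r) (euler_log x t)).
    by apply: cvgM; [exact: cvg_cst|exact: cvg_id].
  by apply: continuous_euler_log; rewrite mulr_gt0.
have i1 := integrable_euler_log hx (lexx 1).
have i2 := integrable_RposZl ((1 + ln t) * t `^ (- x)) i1.
have i3 : mu.-integrable (Rpos : set R) (EFin \o (fun r => t^-1 * euler_log x t (t^-1 * r))).
  apply: (integrable_Rpos_dominated ct i2) => r r0.
  by rewrite ger0_norm ?step// mulr_ge0 ?euler_log_ge0// ltW.
rewrite -/(Rintegral mu Rpos (fun r => t^-1 * euler_log x t (t^-1 * r))).
apply: le_trans (le_Rintegral mR i3 i2 _) _.
  by move=> r /Rpos_gt0; exact: step.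
rewrite RintegralZl//; rewrite mulrC ler_wpM2r//.
  by rewrite mulr_ge0 ?powR_ge0// addr_ge0.
apply: (le_Rintegral mR i1 integrable_euler_env).
by move=> r /Rpos_gt0 r0; exact: euler_log_env.
Qed.

Lemma Gamma_le_env x : x0 <= x <= x1 -> Gamma x <= \int[mu]_(r in Rpos) euler_env r.
Proof.
move=> hx; have xp : 0 < x by move: hx x00; lra.
rewrite GammaE; apply: (le_Rintegral mR (integrable_euler xp ltr01) integrable_euler_env).
move=> r /Rpos_gt0 r0; apply: le_trans (euler_log_env hx (lexx 1) r0).
by rewrite /euler_log ler_peMr ?euler_ge0// lerDl.
Qed.

End envelope.

Definition dGamma x := \int[mu]_(r in Rpos) (euler x 1 r * ln r).

Lemma norm_euler_ln x r : `|euler x 1 r * ln r| <= euler_log x 1 r.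
Proof.
by rewrite normrM (ger0_norm (euler_ge0 _ _ _)) ler_wpM2l ?euler_ge0// lerDr.
Qed.

Lemma norm_dGamma_le x0 x1 x : 0 < x0 -> x0 <= x <= x1 ->
  `|dGamma x| <= \int[mu]_(r in Rpos) euler_env x0 x1 r.
Proof.
move=> x00 hx; have x01 : x0 <= x1 by move: hx; lra.
have i1 := integrable_euler_log x00 x01 hx (lexx 1).
have i0 : mu.-integrable (Rpos : set R) (EFin \o (fun r => euler x 1 r * ln r)).
  apply: (integrable_Rpos_dominated _ i1) => [r r0|r _]; last exact: norm_euler_ln.
  by apply: cvgM; [exact: continuous_euler|exact: continuous_ln].
apply: le_trans (le_normr_Rintegral mR i0) _.
apply: (le_Rintegral mR (integrable_norm i0) (integrable_euler_env x00 x01)).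
move=> r /Rpos_gt0 r0; apply: le_trans (norm_euler_ln _ _) _; exact: euler_log_env.
Qed.

Lemma is_derive_Gamma x : 0 < x -> is_derive x 1 (@Gamma R) (dGamma x).
Proof.
move=> x0.
have x20 : 0 < x / 2 by rewrite divr_gt0.
have x12 : x / 2 <= 2 * x by lra.
have -> : @Gamma R = fun x => \int[mu]_(r in Rpos) euler x 1 r.
  by apply/funext => y; exact: GammaE.
apply: (@is_derive_under_integral R _ _ mu (fun x r => euler x 1 r)
  (fun x r => euler x 1 r * ln r) Rpos (euler_env (x / 2) (2 * x)) (x / 2) (2 * x)).
- exact: mR.
- by apply/andP; split; lra.
- by move=> y /andP[hy _]; apply: integrable_euler => //; lra.
- move=> y r hy /Rpos_gt0 r0; rewrite /euler.
  apply: (is_derive_eq (isd_mul (@isd_comp _ (fun z => r `^ z) (fun y => y - 1) y _ _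
     (isd_powR_exp _ r0) (isd_add (@is_derive_id _ _ y 1) (isd_cst (-1) y))) (isd_cst _ y))).
  by ring.
- exact: integrable_euler_env.
- move=> y r /andP[h1 h2] /Rpos_gt0 r0; apply: le_trans (norm_euler_ln _ _) _.
  by apply: euler_log_env => //; rewrite (ltW h1) (ltW h2).
Qed.

End gamma_log.

(** * The remainder of a single mode *)

Section mode_remainder.
Context {R : realType}.
Notation mu := (@lebesgue_measure R).
Implicit Types lam t al r : R.
Let mR := @measurable_Rpos R.

Let ctM (f g : R -> R) r : {for r, continuous f} -> {for r, continuous g} ->
  {for r, continuous (fun x => f x * g x)}.
Proof. exact: cvgM. Qed.

Let ctD (f g : R -> R) r : {for r, continuous f} -> {for r, continuous g} ->
  {for r, continuous (fun x => f x + g x)}.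
Proof. exact: cvgD. Qed.

Let ctN (f : R -> R) r : {for r, continuous f} -> {for r, continuous (fun x => - f x)}.
Proof. exact: cvgN. Qed.

Let ctV (f : R -> R) r : f r != 0 -> {for r, continuous f} ->
  {for r, continuous (fun x => (f x)^-1)}.
Proof. exact: cvgV. Qed.

Let ctC (c : R) r : {for r, continuous (fun=> c)}.
Proof. exact: cvg_cst. Qed.

Let ctX (f : R -> R) r : {for r, continuous f} -> {for r, continuous (fun x => f x ^+ 2)}.
Proof. by move=> h; exact: (ctM h h). Qed.

Let cpow (c : R) r : 0 < r -> {for r, continuous (fun r => r `^ c)}.
Proof. by move=> r0; exact: isd_continuous (isd_powR_base c r0). Qed.

Let cy lam al r : 0 < r -> {for r, continuous (fun r => r `^ al / lam)}.
Proof. by move=> r0; exact: ctM (@cpow al r r0) (@ctC lam^-1 r). Qed.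

Let cD lam al r : 0 < r ->
  {for r, continuous (fun r => 1 + 2 * (r `^ al / lam) * cos (al * pi) + (r `^ al / lam) ^+ 2)}.
Proof.
move=> r0; have c := @cy lam al r r0.
exact: ctD (ctD (@ctC 1 r) (ctM (ctM (@ctC 2 r) c) (@ctC (cos (al * pi)) r))) (ctX c).
Qed.

Let cN m lam al r : 0 < r ->
  {for r, continuous (fun r => sin (m.+1%:R * (al * pi)) + (r `^ al / lam) * sin (m%:R * (al * pi)))}.
Proof.
move=> r0; have c := @cy lam al r r0.
exact: ctD (@ctC _ r) (ctM c (@ctC _ r)).
Qed.

Lemma continuous_mlker_rem m lam al r : 0 < al < 1 -> 0 < lam -> 0 < r ->
  {for r, continuous (mlker_rem m lam al)}.
Proof.
move=> al01 lam0 r0.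
exact: (@ctM _ _ r (@ctC ((-1) ^+ m * lam^-1 ^+ m.+1) r) (ctM (@cpow (m.+1%:R * al - 1) r r0)
  (ctM (@cN m lam al r r0) (@ctV _ r (geom_denom_neq0 al01 lam0 r0) (@cD lam al r r0))))).
Qed.

Lemma continuous_mlker_rem_d m lam al r : 0 < al < 1 -> 0 < lam -> 0 < r ->
  {for r, continuous (mlker_rem_d m lam al)}.
Proof.
move=> al01 lam0 r0; have y := @cy lam al r r0; have l := continuous_ln r0.
have D := @cD lam al r r0; have N := @cN m lam al r r0.
have Di := @ctV _ r (geom_denom_neq0 al01 lam0 r0) D.
have DDi := @ctV _ r (expf_neq0 2 (geom_denom_neq0 al01 lam0 r0)) (ctX D).
have dN : {for r, continuous (fun r => m.+1%:R * pi * cos (m.+1%:R * (al * pi)) +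
    ln r * (r `^ al / lam) * sin (m%:R * (al * pi)) +
    (r `^ al / lam) * (m%:R * pi * cos (m%:R * (al * pi))))}.
  exact: ctD (ctD (@ctC _ r) (ctM (ctM l y) (@ctC _ r))) (ctM y (@ctC _ r)).
have dD : {for r, continuous (fun r => 2 * ln r * (r `^ al / lam) * cos (al * pi) -
    2 * (r `^ al / lam) * pi * sin (al * pi) + 2 * ln r * (r `^ al / lam) ^+ 2)}.
  have l2 := ctM (@ctC 2 r) l.
  exact: ctD (ctD (ctM (ctM l2 y) (@ctC _ r))
    (ctN (ctM (ctM (ctM (@ctC 2 r) y) (@ctC pi r)) (@ctC _ r)))) (ctM l2 (ctX y)).
have T := ctD (ctM (ctM (@ctC m.+1%:R r) l) (ctM N Di)) (ctD (ctM dN Di) (ctN (ctM (ctM N dD) DDi))).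
exact: ctM (@ctC ((-1) ^+ m * lam^-1 ^+ m.+1) r) (ctM (@cpow (m.+1%:R * al - 1) r r0) T).
Qed.

(** The contribution of one mode to the remainder of order [m] of the
    observation, and its derivative with respect to the order [al]. *)
Definition mode_rem m lam t al :=
  \int[mu]_(r in Rpos) (expR (- (t * r)) * mlker_rem m lam al r).

Definition mode_rem_d m lam t al :=
  \int[mu]_(r in Rpos) (expR (- (t * r)) * mlker_rem_d m lam al r).

Variables (b0 b1 : R).
Hypotheses (b00 : 0 < b0) (b01 : b0 < b1) (b11 : b1 < 1).

Let al01 al : b0 < al < b1 -> 0 < al < 1.
Proof. by move=> /andP[h1 h2]; rewrite (lt_trans b00 h1) (lt_trans h2 b11). Qed.

Let hX m al : b0 < al < b1 -> m.+1%:R * b0 <= m.+1%:R * al <= m.+1%:R * b1.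
Proof. by move=> /andP[h1 h2]; rewrite !ler_pM2l ?ltr0n// (ltW h1) (ltW h2). Qed.

(** The constant does not depend on the mode: [lam] enters only through the factor
    [lam^-1 ^+ m.+1], which is what makes the sum over the modes converge. *)
Lemma mode_rem_bounds m : exists2 C : R, 0 <= C & forall lam t al, 0 < lam -> 1 <= t -> b0 < al < b1 ->
  [/\ mu.-integrable (Rpos : set R) (EFin \o (fun r => expR (- (t * r)) * mlker_rem m lam al r)),
      `|mode_rem m lam t al| <= C * lam^-1 ^+ m.+1 * t `^ (- (m.+1%:R * al)),
      is_derive al 1 (mode_rem m lam t) (mode_rem_d m lam t al) &
      `|mode_rem_d m lam t al| <= C * lam^-1 ^+ m.+1 * ((1 + ln t) * t `^ (- (m.+1%:R * al)))].
Proof.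
have [C1 C10 h1] := mlker_rem_bound b00 b01 b11 m.
have [C2 C20 h2] := mlker_rem_d_bound b00 b01 b11 m.
pose X0 := m.+1%:R * b0; pose X1 := m.+1%:R * b1.
have X00 : 0 < X0 by rewrite mulr_gt0// ltr0n.
have X01 : X0 <= X1 by rewrite ler_pM2l ?ltr0n// ltW.
pose E := \int[mu]_(r in Rpos) euler_env X0 X1 r.
have E0 : 0 <= E.
  apply: Rintegral_ge0 => r /Rpos_gt0 r0.
  apply: le_trans (euler_log_env X00 _ (lexx 1) r0); first exact: (euler_log_ge0 X0).
  by rewrite lexx.
exists ((C1 + C2) * E); first by rewrite mulr_ge0// addr_ge0.
move=> lam t al l0 t1 hal; have t0 : 0 < t by exact: lt_le_trans t1.
have li : 0 <= lam^-1 ^+ m.+1 by rewrite exprn_ge0// invr_ge0 ltW.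
have lt0 : 0 <= ln t by rewrite ln_ge0.
have ce r : {for r, continuous (fun r => expR (- (t * r)))} by exact: continuous_expRM.
have e0 r := expR_ge0 (- (t * r)).
have b1' a r : b0 < a < b1 -> 0 < r -> `|expR (- (t * r)) * mlker_rem m lam a r| <=
    C1 * lam^-1 ^+ m.+1 * euler (m.+1%:R * a) t r.
  move=> ha r0; rewrite normrM (ger0_norm (e0 r)) /euler.
  rewrite [leLHS]mulrC [leRHS]mulrA; apply: ler_wpM2r => //; exact: h1.
have b2' a r : b0 < a < b1 -> 0 < r -> `|expR (- (t * r)) * mlker_rem_d m lam a r| <=
    C2 * lam^-1 ^+ m.+1 * euler_log (m.+1%:R * a) t r.
  move=> ha r0; rewrite normrM (ger0_norm (e0 r)) /euler_log /euler.
  rewrite [leLHS]mulrC (mulrAC (r `^ _)) [leRHS]mulrA; apply: ler_wpM2r => //; exact: h2.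
have c1 a r : b0 < a < b1 -> 0 < r ->
    {for r, continuous (fun r => expR (- (t * r)) * mlker_rem m lam a r)}.
  by move=> ha r0; apply: ctM => //; exact: continuous_mlker_rem (al01 ha) l0 r0.
have c2 a r : b0 < a < b1 -> 0 < r ->
    {for r, continuous (fun r => expR (- (t * r)) * mlker_rem_d m lam a r)}.
  by move=> ha r0; apply: ctM => //; exact: continuous_mlker_rem_d (al01 ha) l0 r0.
have pX a : b0 < a < b1 -> 0 < m.+1%:R * a.
  by move=> /al01/andP[a0 _]; rewrite mulr_gt0// ltr0n.
have i1 a : b0 < a < b1 -> mu.-integrable (Rpos : set R)
    (EFin \o (fun r => expR (- (t * r)) * mlker_rem m lam a r)).
  move=> ha; apply: (integrable_Rpos_dominated (fun r => c1 a r ha)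
    (integrable_RposZl _ (integrable_euler (pX a ha) t0))).
  by move=> r; exact: b1'.
have i2 := integrable_RposZl (C2 * lam^-1 ^+ m.+1) (integrable_euler_log X00 X01 (hX m hal) t1).
have i3 : mu.-integrable (Rpos : set R)
    (EFin \o (fun r => expR (- (t * r)) * mlker_rem_d m lam al r)).
  by apply: (integrable_Rpos_dominated (fun r => c2 al r hal) i2) => r; exact: b2'.
split.
- exact: i1.
- apply: le_trans (le_normr_Rintegral mR (i1 _ hal)) _.
  apply: le_trans (le_Rintegral mR (integrable_norm (i1 _ hal))
    (integrable_RposZl (C1 * lam^-1 ^+ m.+1) (integrable_euler (pX _ hal) t0)) _) _.
    by move=> r /Rpos_gt0; exact: b1'.
  rewrite RintegralZl//; last exact: integrable_euler (pX _ hal) t0.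
  rewrite integral_euler ?pX// (mulrC (t `^ _)) mulrA ler_wpM2r ?powR_ge0//.
  rewrite [leLHS]mulrAC ler_wpM2r//.
  have G := Gamma_le_env X00 X01 (hX m hal).
  by apply: ler_pM => //; [apply: Rintegral_ge0 => r _; rewrite mulr_ge0 ?powR_ge0 ?expR_ge0|rewrite lerDl].
- have hd a r : b0 < a < b1 -> Rpos r -> is_derive a 1
      (fun a => expR (- (t * r)) * mlker_rem m lam a r) (expR (- (t * r)) * mlker_rem_d m lam a r).
    move=> ha /Rpos_gt0 r0; apply: isd_scale.
    exact: is_derive_mlker_rem (al01 ha) l0 r0.
  have hb a r : b0 < a < b1 -> Rpos r -> `|expR (- (t * r)) * mlker_rem_d m lam a r| <=
      C2 * lam^-1 ^+ m.+1 * euler_env X0 X1 r.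
    move=> ha /Rpos_gt0 r0; apply: le_trans (b2' _ _ ha r0) _.
    apply: ler_wpM2l; first exact: mulr_ge0.
    by have := euler_log_env X00 (hX m ha) t1 r0.
  have iG := integrable_RposZl (C2 * lam^-1 ^+ m.+1) (integrable_euler_env X00 X01).
  exact (@is_derive_under_integral R _ _ mu (fun a r => expR (- (t * r)) * mlker_rem m lam a r)
    (fun a r => expR (- (t * r)) * mlker_rem_d m lam a r) Rpos
    (fun r => C2 * lam^-1 ^+ m.+1 * euler_env X0 X1 r) b0 b1 al mR hal i1 hd iG hb).
- apply: le_trans (le_normr_Rintegral mR i3) _.
  apply: le_trans (le_Rintegral mR (integrable_norm i3) i2 _) _.
    by move=> r /Rpos_gt0; exact: b2'.
  have i4 := integrable_euler_log X00 X01 (hX m hal) t1.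
  rewrite RintegralZl//.
  have G := integral_euler_log_le X00 X01 (hX m hal) t1.
  apply: le_trans (ler_wpM2l _ G) _; first by rewrite mulr_ge0.
  rewrite mulrA ler_wpM2r//; first by rewrite mulr_ge0 ?powR_ge0// addr_ge0.
  by rewrite [leLHS]mulrAC ler_wpM2r// ler_wpM2r// lerDr.
Qed.

End mode_remainder.

(** * Expansion of a single mode *)

Section mode_expansion.
Context {R : realType}.
Notation mu := (@lebesgue_measure R).
Implicit Types lam t al r : R.
Let mR := @measurable_Rpos R.

Lemma integral_euler_sum (c x : nat -> R) (g : R -> R) t j : 0 < t ->
  (forall k, 0 < x k) -> mu.-integrable (Rpos : set R) (EFin \o g) ->
  \int[mu]_(r in Rpos) (\sum_(0 <= k < j) c k * euler (x k) t r + g r) =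
  \sum_(0 <= k < j) c k * (t `^ (- x k) * Gamma (x k)) + \int[mu]_(r in Rpos) g r.
Proof.
move=> t0 x0; elim: j g => [|j IH] g ig.
  by rewrite big_geq// add0r; apply: eq_Rintegral => r _; rewrite big_geq// add0r.
have ie := integrable_RposZl (c j) (integrable_euler (x0 j) t0).
have ig' : mu.-integrable (Rpos : set R) (EFin \o (fun r => c j * euler (x j) t r + g r)).
  by have := integrableD mR ie ig; apply: eq_integrable.
rewrite big_nat_recr//= -addrA.
have -> : c j * (t `^ (- x j) * Gamma (x j)) + \int[mu]_(r in Rpos) g r =
    \int[mu]_(r in Rpos) (c j * euler (x j) t r + g r).
  rewrite RintegralD// RintegralZl//; last exact: integrable_euler.
  by rewrite integral_euler.
by rewrite -IH//; apply: eq_Rintegral => r _; rewrite big_nat_recr//= addrA.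
Qed.

Definition expansion_coef al t k :=
  (-1) ^+ k * sin (k.+1%:R * (al * pi)) * (t `^ (- (k.+1%:R * al)) * Gamma (k.+1%:R * al)).

(** Watson's lemma for the kernel: integrate [mlker_expansion] against
    [e^(- t r)]. *)
Lemma mittag_leffler_expansion m lam t al : 0 < al < 1 -> 0 < lam -> 1 <= t ->
  pi * mittag_leffler al 1 (- (lam * t `^ al)) =
  \sum_(0 <= k < m) expansion_coef al t k * lam^-1 ^+ k.+1 + mode_rem m lam t al.
Proof.
move=> al01 l0 t1; have t0 : 0 < t by exact: lt_le_trans t1.
have [a0 a1] := andP al01.
rewrite -relaxation_mittag_leffler// /relaxation.
have ig : mu.-integrable (Rpos : set R) (EFin \o (fun r => expR (- (t * r)) * mlker_rem m lam al r)).
  have h0 : 0 < al / 2 by rewrite divr_gt0.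
  have h2 : al / 2 < al < (al + 1) / 2 by apply/andP; split; lra.
  have h1 : al / 2 < (al + 1) / 2 by lra.
  have h3 : (al + 1) / 2 < 1 by lra.
  by have [C _ /(_ lam t al l0 t1 h2)[]] := mode_rem_bounds h0 h1 h3 m.
pose c k := (-1) ^+ k * sin (k.+1%:R * (al * pi)) * lam^-1 ^+ k.+1.
have x0 k : 0 < k.+1%:R * al by rewrite mulr_gt0// ltr0n.
transitivity (\int[mu]_(r in Rpos) (\sum_(0 <= k < m) c k * euler (k.+1%:R * al) t r +
    expR (- (t * r)) * mlker_rem m lam al r)).
  apply: eq_Rintegral => r; rewrite inE => /Rpos_gt0 r0.
  rewrite (mlker_expansion m al01 l0 r0) mulrDr mulr_sumr; congr (_ + _).
  by apply: eq_bigr => k _; rewrite /c /euler; ring.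
rewrite integral_euler_sum//; congr (_ + _).
by apply: eq_bigr => k _; rewrite /c /expansion_coef; ring.
Qed.

End mode_expansion.

(** * Summation over the modes *)

Section spectral_sums.
Context {R : realType}.
Variables (b l : nat -> R) (l0 : R).
Hypotheses (l00 : 0 < l0) (l0l : forall n, l0 <= l n).
Hypothesis sb : abs_summable (fun n => b n * (l n)^-1).

(** The resolvent moments and, below, the observation, for coefficients [b] and
    levels [l] that are indexed by all natural numbers. *)
Definition moment k := limn (series (fun n => b n * (l n)^-1 ^+ k)).
Definition spectral_sum al t :=
  limn (series (fun n => b n * mittag_leffler al 1 (- (l n * t `^ al)))).

Let l_gt0 n : 0 < l n. Proof. exact: lt_le_trans (l0l n). Qed.

(** As the levels are bounded below, summability for the first moment implies it for
    the following ones. *)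
Lemma abs_summable_moment k : abs_summable (fun n => b n * (l n)^-1 ^+ k.+1).
Proof.
apply: (@abs_summable_le _ _ (fun n => l0^-1 ^+ k * `|b n * (l n)^-1|)) => [n|].
  rewrite exprS mulrA normrM mulrC ler_wpM2r// normrX ger0_norm ?invr_ge0 ?(ltW (l_gt0 n))//.
  apply: lerXn2r; rewrite ?nnegrE ?invr_ge0 ?(ltW l00) ?(ltW (l_gt0 n))//.
  by rewrite lef_pV2 ?posrE.
exact: (@is_cvg_seriesZ R (fun n => `|b n * (l n)^-1|) (l0^-1 ^+ k)).
Qed.

Lemma norm_lim_series_le (u v : nat -> R) : (forall n, `|u n| <= v n) -> cvgn (series v) ->
  `|limn (series u)| <= limn (series v).
Proof.
move=> uv cv; have su := abs_summable_le uv cv.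
apply: le_trans (lim_series_norm su) _.
exact: lim_series_le.
Qed.

Variables (b0 b1 : R).
Hypotheses (b00 : 0 < b0) (b01 : b0 < b1) (b11 : b1 < 1).

Definition spectral_rem m t al := limn (series (fun n => b n * mode_rem m (l n) t al)).
Definition spectral_rem_d m t al := limn (series (fun n => b n * mode_rem_d m (l n) t al)).

Lemma spectral_rem_bounds m : exists2 C : R, 0 <= C & forall t al, 1 <= t -> b0 < al < b1 ->
  [/\ abs_summable (fun n => b n * mode_rem m (l n) t al),
      `|spectral_rem m t al| <= C * t `^ (- (m.+1%:R * al)),
      is_derive al 1 (spectral_rem m t) (spectral_rem_d m t al) &
      `|spectral_rem_d m t al| <= C * ((1 + ln t) * t `^ (- (m.+1%:R * al)))].
Proof.
have [C C0 h] := mode_rem_bounds b00 b01 b11 m.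
pose u n := `|b n * (l n)^-1 ^+ m.+1|.
have cu : cvgn (series u) by exact: abs_summable_moment.
have uE n : u n = `|b n| * (l n)^-1 ^+ m.+1.
  by rewrite /u normrM normrX (ger0_norm (_ : 0 <= (l n)^-1))// invr_ge0 ltW.
have U0 : 0 <= limn (series u).
  by apply: limr_ge => //; apply: nearW => n; apply: sumr_ge0 => i _; exact: normr_ge0.
exists (C * limn (series u)); first exact: mulr_ge0.
move=> t al t1 hal; have t0 : 0 < t by exact: lt_le_trans t1.
have lt0 : 0 <= ln t by rewrite ln_ge0.
have hb a n : b0 < a < b1 ->
    `|b n * mode_rem m (l n) t a| <= (C * t `^ (- (m.+1%:R * a))) * u n.
  move=> ha; have [_ h1 _ _] := h (l n) t a (l_gt0 n) t1 ha.
  rewrite normrM uE [leRHS](_ : _ = `|b n| * (C * (l n)^-1 ^+ m.+1 * t `^ (- (m.+1%:R * a)))); last by ring.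
  by rewrite ler_wpM2l.
have hb' a n : b0 < a < b1 ->
    `|b n * mode_rem_d m (l n) t a| <= (C * ((1 + ln t) * t `^ (- (m.+1%:R * a)))) * u n.
  move=> ha; have [_ _ _ h1] := h (l n) t a (l_gt0 n) t1 ha.
  rewrite normrM uE [leRHS](_ : _ = `|b n| * (C * (l n)^-1 ^+ m.+1 * ((1 + ln t) * t `^ (- (m.+1%:R * a))))); last by ring.
  by rewrite ler_wpM2l.
have cs (c : R) : cvgn (series (fun n => c * u n)) by exact: is_cvg_seriesZ.
have sm a : b0 < a < b1 -> abs_summable (fun n => b n * mode_rem m (l n) t a).
  by move=> ha; exact: abs_summable_le (fun n => hb a n ha) (cs _).
split.
- exact: sm.
- apply: le_trans (norm_lim_series_le (fun n => hb al n hal) (cs _)) _.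
  by rewrite lim_series_scale// mulrAC.
- have hd a n : b0 < a < b1 -> is_derive a 1 (fun a => b n * mode_rem m (l n) t a)
      (b n * mode_rem_d m (l n) t a).
    by move=> ha; apply: isd_scale; have [_ _ + _] := h (l n) t a (l_gt0 n) t1 ha.
  have sG : abs_summable (fun n => C * (1 + ln t) * u n).
    by apply: abs_summable_scale; rewrite /abs_summable; under eq_fun do rewrite normr_id.
  have hG a n : b0 < a < b1 -> `|b n * mode_rem_d m (l n) t a| <= C * (1 + ln t) * u n.
    move=> ha; apply: le_trans (hb' a n ha) _.
    have a0 : 0 <= a by case/andP: ha => /(lt_trans b00)/ltW.
    apply: ler_wpM2r; first exact: normr_ge0.
    apply: ler_wpM2l => //; apply: ler_piMr; first exact: addr_ge0.
    rewrite powRN invf_le1 ?powR_gt0//.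
    have m0 : 0 <= m.+1%:R * a by rewrite mulr_ge0.
    by have := ler_powR t1 m0; rewrite powRr0.
  exact (@is_derive_series R (fun a n => b n * mode_rem m (l n) t a)
    (fun a n => b n * mode_rem_d m (l n) t a) (fun n => C * (1 + ln t) * u n) b0 b1 al hal
    sm hd sG hG).
- apply: le_trans (norm_lim_series_le (fun n => hb' al n hal) (cs _)) _.
  by rewrite lim_series_scale// mulrAC.
Qed.

Lemma lim_series_sum (c : nat -> R) (v : nat -> nat -> R) j : (forall k, cvgn (series (v k))) ->
  cvgn (series (fun n => \sum_(0 <= k < j) c k * v k n)) /\
  limn (series (fun n => \sum_(0 <= k < j) c k * v k n)) =
  \sum_(0 <= k < j) c k * limn (series (v k)).
Proof.
move=> cv; elim: j => [|j [IH1 IH2]].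
  have -> : (fun n => \sum_(0 <= k < 0) c k * v k n) = (fun n => 0 * v 0%N n).
    by apply/funext => n; rewrite big_geq// mul0r.
  split; first exact: is_cvg_seriesZ.
  by rewrite lim_series_scale// mul0r big_geq.
have -> : (fun n => \sum_(0 <= k < j.+1) c k * v k n) =
    (fun n => \sum_(0 <= k < j) c k * v k n + c j * v j n).
  by apply/funext => n; rewrite big_nat_recr.
have cj : cvgn (series (fun n => c j * v j n)) by exact: is_cvg_seriesZ.
split; first exact: is_cvg_seriesD.
by rewrite lim_series_add// IH2 lim_series_scale// big_nat_recr.
Qed.

(** The expansion of each mode is a finite sum, so it can be exchanged with the sum
    over the modes. *)
Lemma spectral_sum_expansion m t al : 1 <= t -> b0 < al < b1 ->
  pi * spectral_sum al t =
  \sum_(0 <= k < m) expansion_coef al t k * moment k.+1 + spectral_rem m t al.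
Proof.
move=> t1 hal; have al01 : 0 < al < 1.
  by case/andP: hal => h1 h2; rewrite (lt_trans b00 h1) (lt_trans h2 b11).
have [C _ /(_ t al t1 hal)[sr _ _ _]] := spectral_rem_bounds m.
have [cs sE] := lim_series_sum (expansion_coef al t) m
  (fun k => abs_summable_cvg (@abs_summable_moment k)).
rewrite /moment -sE /spectral_rem -lim_series_add//; last exact: abs_summable_cvg.
pose X n := b n * mittag_leffler al 1 (- (l n * t `^ al)).
have XE : (fun n => \sum_(0 <= k < m) expansion_coef al t k * (b n * (l n)^-1 ^+ k.+1) +
    b n * mode_rem m (l n) t al) = (fun n => pi * X n).
  apply/funext => n; rewrite [RHS]mulrCA (mittag_leffler_expansion m)// mulrDr mulr_sumr.
  by congr (_ + _); apply: eq_bigr => k _; ring.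
have cX : cvgn (series (fun n => pi * X n)).
  by rewrite -XE; apply: is_cvg_seriesD => //; exact: abs_summable_cvg.
have pn : (pi : R) != 0 by rewrite gt_eqF// pi_gt0.
have -> : spectral_sum al t = limn (series (fun n => pi^-1 * (pi * X n))).
  by congr (limn (series _)); apply/funext => n; rewrite mulKf.
by rewrite lim_series_scale// mulVKf// XE.
Qed.

End spectral_sums.

(** * The leading term of the observation *)

Section leading_term.
Context {R : realType}.
Implicit Types t al x : R.

(** A positive zero [x] of [sin (x * pi)] is a positive integer, and then the product
    that defines [rGamma (1 - x)] contains the factor [1 - x + (x - 1)]. *)
Lemma rGamma_eq0 x : 0 < x -> sin (x * pi) = 0 -> rGamma (1 - x) = 0.
Proof.
move=> x0 sx0; pose n := Num.truncn x; have nx : n%:R <= x by rewrite truncn_le// ltW.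
have xn : x < n.+1%:R by exact: truncnS_gt.
have xE : x = n%:R.
  apply/eqP/negPn/negP => xn'.
  have f0 : 0 < (x - n%:R) * pi < pi.
    have f1 : 0 < x - n%:R by rewrite subr_gt0 lt_neqAle eq_sym xn'.
    apply/andP; split; first by rewrite mulr_gt0// pi_gt0.
    by rewrite gtr_pMl ?pi_gt0// ltrBlDl -natr1 in xn *.
  have := sin_gt0_pi f0.
  have : sin ((x - n%:R) * pi) = 0.
    have si : sin (n%:R * pi) = 0 :> R.
      elim: (n) => [|k IH]; first by rewrite mul0r sin0.
      by rewrite -natr1 mulrDl mul1r sinDpi IH oppr0.
    by rewrite mulrBl sinB sx0 si mul0r mulr0 subrr.
  by move=> ->; rewrite ltxx.
have n0 : (0 < n)%N by rewrite -(ltr0n R) -xE.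
rewrite /rGamma xE ltNge ifF; last first.
  by apply/negbTE; rewrite negbK subr_le0 ler1n.
have -> : Num.truncn (- (1 - n%:R) : R) = n.-1.
  by rewrite opprB -{1}(prednK n0) -natr1 addrK natrK.
rewrite big_nat_recr//= (_ : 1 - n%:R + n.-1%:R = 0) ?mulr0 ?mul0r//.
by rewrite -{1}(prednK n0) -natr1; ring.
Qed.

(** As [r e^(- r) <= 1], the integrand of [Gamma x] dominates that of
    [Gamma (x + 1)] taken at the rate 2. *)
Lemma Gamma_pos x : 0 < x -> 0 < Gamma x.
Proof.
move=> x0; have x1 : 0 < x + 1 by rewrite addr_gt0.
have h : 2 `^ (- (x + 1)) * Gamma (x + 1) <= Gamma x.
  rewrite -integral_euler// GammaE.
  apply: (le_Rintegral measurable_Rpos (integrable_euler x1 _) (integrable_euler x0 _)) => //.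
  move=> r /Rpos_gt0 r0; rewrite /euler addrK powR_sub1//.
  have -> : - (2 * r) = - (1 * r) - r by ring.
  rewrite expRD -mulrA; apply: ler_wpM2l; first exact: powR_ge0.
  rewrite mulrC; apply: ler_wpM2r; first exact: expR_ge0.
  rewrite expRN lef_pV2 ?posrE ?expR_gt0//.
  by apply: le_trans (expR_ge1Dx r); rewrite lerDr.
by apply: lt_le_trans h; rewrite mulr_gt0 ?powR_gt0// Gamma_gt0// ltW.
Qed.

Variables (b l : nat -> R) (l0 : R).
Hypotheses (l00 : 0 < l0) (l0l : forall n, l0 <= l n).
Hypothesis sb : abs_summable (fun n => b n * (l n)^-1).
Variables (b0 b1 : R).
Hypotheses (b00 : 0 < b0) (b01 : b0 < b1) (b11 : b1 < 1).
Variable p : nat.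
Hypothesis S0 : forall k, (1 <= k < p.+1)%N -> moment b l k = 0.

(** The limit of [pi * t^(m al) * M_al(t)], for [m = p.+1]; [correction] is the
    deviation from it. *)
Definition leading al :=
  moment b l p.+1 * ((-1) ^+ p * (sin (p.+1%:R * (al * pi)) * Gamma (p.+1%:R * al))).

Definition leading_d al :=
  moment b l p.+1 * ((-1) ^+ p *
   (cos (p.+1%:R * (al * pi)) * (p.+1%:R * pi) * Gamma (p.+1%:R * al) +
    sin (p.+1%:R * (al * pi)) * (dGamma (p.+1%:R * al) * p.+1%:R))).

Definition correction al t := t `^ (p.+1%:R * al) * spectral_rem b l p.+1 t al.

Definition correction_d al t :=
  p.+1%:R * ln t * t `^ (p.+1%:R * al) * spectral_rem b l p.+1 t al +
  t `^ (p.+1%:R * al) * spectral_rem_d b l p.+1 t al.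

Lemma spectral_sum_leading al t : 1 <= t -> b0 < al < b1 ->
  spectral_sum b l al t = pi^-1 * t `^ (- (p.+1%:R * al)) * (leading al + correction al t).
Proof.
move=> t1 hal; have t0 : 0 < t by exact: lt_le_trans t1.
have pn : (pi : R) != 0 by rewrite gt_eqF// pi_gt0.
have tn : t `^ (p.+1%:R * al) != 0 by rewrite gt_eqF// powR_gt0.
rewrite -[LHS](mulKf pn) -mulrA; congr (_ * _).
rewrite (spectral_sum_expansion l00 l0l sb b00 b01 b11 p.+1 t1 hal).
rewrite mulrDr /correction powRN mulKf//; congr (_ + _).
rewrite big_nat_recr//= big1_seq ?add0r; last first.
  move=> k; rewrite mem_index_iota => /andP[_ kp]; rewrite S0 ?mulr0//.
rewrite /expansion_coef /leading powRN; ring.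
Qed.

Lemma is_derive_leading al : 0 < al -> is_derive al 1 leading (leading_d al).
Proof.
move=> a0; apply: isd_scale; apply: isd_scale.
have d1 : is_derive al 1 (fun a => p.+1%:R * a) p.+1%:R.
  by apply: (is_derive_eq (isd_scale _ (@is_derive_id _ _ al 1))); rewrite mulr1.
have dth : is_derive al 1 (fun a => p.+1%:R * (a * pi)) (p.+1%:R * pi).
  by apply: isd_scale; apply: (is_derive_eq (isd_mul (@is_derive_id _ _ al 1) (isd_cst pi al))); ring.
have x0 : 0 < p.+1%:R * al by rewrite mulr_gt0// ltr0n.
exact: (isd_mul (@isd_comp _ sin (fun a => p.+1%:R * (a * pi)) al _ _ (is_derive_sin _) dth)
  (@isd_comp _ (@Gamma R) (fun a => p.+1%:R * a) al _ _ (is_derive_Gamma x0) d1)).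
Qed.

(** This is where the hypothesis on [1 / Gamma(1 - m al)] enters. *)
Lemma leading_neq0 al : 0 < al -> moment b l p.+1 != 0 -> leading_coef p.+1 al != 0 ->
  leading al != 0.
Proof.
move=> a0 Sn lc; have x0 : 0 < p.+1%:R * al by rewrite mulr_gt0// ltr0n.
rewrite /leading; apply: mulf_neq0 => //; apply: mulf_neq0.
  by rewrite expf_neq0// oppr_eq0 oner_eq0.
apply: mulf_neq0; last by rewrite gt_eqF// Gamma_pos.
apply/eqP => s0; move/eqP: lc; apply; rewrite /leading_coef rGamma_eq0 ?mulr0//.
by rewrite -mulrA.
Qed.

Let pX al : b0 < al < b1 -> p.+1%:R * b0 <= p.+1%:R * al <= p.+1%:R * b1.
Proof. by move=> /andP[h1 h2]; rewrite !ler_pM2l ?ltr0n// (ltW h1) (ltW h2). Qed.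

Lemma leading_bounds : exists2 K : R, 0 <= K & forall t al, 1 <= t -> b0 < al < b1 ->
  [/\ `|leading_d al| <= K,
      `|correction al t| <= K * t `^ (- al),
      is_derive al 1 (correction ^~ t) (correction_d al t) &
      `|correction_d al t| <= K * ((1 + ln t) * t `^ (- al))].
Proof.
have [C C0 hC] := spectral_rem_bounds l00 l0l sb b00 b01 b11 p.+1.
pose E := \int[@lebesgue_measure R]_(r in Rpos) euler_env (p.+1%:R * b0) (p.+1%:R * b1) r.
have X00 : 0 < p.+1%:R * b0 by rewrite mulr_gt0// ltr0n.
have X01 : p.+1%:R * b0 <= p.+1%:R * b1 by rewrite ler_pM2l ?ltr0n// ltW.
have p0 : 0 <= (pi : R) by exact: pi_ge0.
pose K1 := `|moment b l p.+1| * (p.+1%:R * pi * E + E * p.+1%:R).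
have hG al : b0 < al < b1 -> [/\ 0 <= Gamma (p.+1%:R * al), Gamma (p.+1%:R * al) <= E &
    `|dGamma (p.+1%:R * al)| <= E].
  move=> hal; split; last by have := norm_dGamma_le X00 (pX hal).
    by apply/ltW/Gamma_pos; case/andP: (pX hal) => + _; exact: lt_le_trans.
  by have := Gamma_le_env X00 X01 (pX hal).
have E0 : 0 <= E.
  have hh : b0 < (b0 + b1) / 2 < b1 by rewrite !midf_lt.
  by have [h1 h2 _] := hG _ hh; exact: le_trans h2.
have K10 : 0 <= K1 by rewrite mulr_ge0// addr_ge0// !mulr_ge0.
have K20 : 0 <= (p.+1%:R + 1) * C by rewrite mulr_ge0.
exists (K1 + (p.+1%:R + 1) * C); first exact: addr_ge0.
move=> t al t1 hal; have t0 : 0 < t by exact: lt_le_trans t1.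
have lt0 : 0 <= ln t by rewrite ln_ge0.
have [_ h1 h2 h3] := hC t al t1 hal.
have pw : t `^ (p.+1%:R * al) * t `^ (- (p.+2%:R * al)) = t `^ (- al).
  rewrite -powRD ?(gt_eqF t0) ?implybT//; congr (_ `^ _).
  by rewrite -[p.+2]addn1 natrD; ring.
have tp := powR_ge0 t (p.+1%:R * al); have tq := powR_ge0 t (- al).
have g1 : `|t `^ (p.+1%:R * al) * spectral_rem b l p.+1 t al| <= C * t `^ (- al).
  by rewrite normrM (ger0_norm tp) -pw mulrCA ler_wpM2l.
have g2 : `|t `^ (p.+1%:R * al) * spectral_rem_d b l p.+1 t al| <= C * ((1 + ln t) * t `^ (- al)).
  rewrite normrM (ger0_norm tp) -pw.
  have -> : C * ((1 + ln t) * (t `^ (p.+1%:R * al) * t `^ (- (p.+2%:R * al)))) =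
    t `^ (p.+1%:R * al) * (C * ((1 + ln t) * t `^ (- (p.+2%:R * al)))) by ring.
  by rewrite ler_wpM2l.
have Cp : C <= K1 + (p.+1%:R + 1) * C.
  by rewrite ler_wpDl// ler_peMl// lerDr.
split.
- have [G0 GE dG] := hG al hal.
  have K1le : `|leading_d al| <= K1.
    rewrite /leading_d /K1 normrM; apply: ler_wpM2l => //.
    rewrite normrM normrX normrN1 expr1n mul1r; apply: le_trans (ler_normD _ _) _.
    apply: lerD.
      rewrite normrM normrM (ger0_norm G0) (ger0_norm (mulr_ge0 (ler0n _ _) p0)).
      apply: ler_pM => //; first by rewrite !mulr_ge0.
      by rewrite ler_piMl ?cos_max// mulr_ge0.
    rewrite normrM normrM (ger0_norm (ler0n _ _)).
    apply: (@le_trans _ _ (1 * (`|dGamma (p.+1%:R * al)| * p.+1%:R))).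
      by apply: ler_wpM2r; [rewrite mulr_ge0|exact: sin_max].
    by rewrite mul1r ler_wpM2r.
  by apply: le_trans K1le _; rewrite lerDl.
- by apply: le_trans g1 _; rewrite ler_wpM2r.
- have d1 : is_derive al 1 (fun a => p.+1%:R * a) p.+1%:R.
    by apply: (is_derive_eq (isd_scale _ (@is_derive_id _ _ al 1))); rewrite mulr1.
  apply: (is_derive_eq (isd_mul (@isd_comp _ (fun x => t `^ x) (fun a => p.+1%:R * a) al _ _
     (isd_powR_exp _ t0) d1) h2)).
  by rewrite /correction_d; ring.
- rewrite /correction_d; apply: le_trans (ler_normD _ _) _.
  have g3 : `|p.+1%:R * ln t * t `^ (p.+1%:R * al) * spectral_rem b l p.+1 t al| <=
     p.+1%:R * C * ((1 + ln t) * t `^ (- al)).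
    rewrite -mulrA normrM ger0_norm ?mulr_ge0//.
    apply: le_trans (ler_wpM2l _ g1) _; first by rewrite mulr_ge0.
    have -> : p.+1%:R * ln t * (C * t `^ (- al)) = p.+1%:R * C * (ln t * t `^ (- al)) by ring.
    by apply: ler_wpM2l; [rewrite mulr_ge0|apply: ler_wpM2r => //; rewrite lerDr].
  apply: le_trans (lerD g3 g2) _; rewrite -mulrDl; apply: ler_wpM2r.
    by rewrite mulr_ge0// addr_ge0.
  by rewrite mulrDl mul1r lerDr.
Qed.

End leading_term.

(** * The ratio of two observations *)

Section log_ratio.
Context {R : realType}.

Lemma is_derive_ln_norm (f : R -> R) (x df : R) : f x != 0 -> is_derive x 1 f df ->
  is_derive x 1 (fun y => ln `|f y|) (df / f x).
Proof.
move=> fx0 hf; have cf := isd_continuous hf.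
have [fx|fx|fx] := ltgtP (f x) 0; last by rewrite fx eqxx in fx0.
  have nf : is_derive x 1 (fun y => ln (- f y)) (df / f x).
    have fx' : 0 < - f x by rewrite oppr_gt0.
    apply: (is_derive_eq (@isd_comp _ (@ln R) (fun y => - f y) x _ _ (is_derive1_ln fx') (isd_opp hf))).
    by rewrite invrN mulrNN mulrC.
  have E : \forall y \near x, ln (- f y) = ln `|f y|.
    by apply: filterS (cvgr_lt _ cf _ fx) => y fy; rewrite ltr0_norm.
  exact: near_eq_is_derive E nf.
have nf : is_derive x 1 (fun y => ln (f y)) (df / f x).
  by apply: (is_derive_eq (@isd_comp _ (@ln R) f x _ _ (is_derive1_ln fx) hf)); rewrite mulrC.
have E : \forall y \near x, ln (f y) = ln `|f y|.
  by apply: filterS (cvgr_gt _ cf _ fx) => y fy; rewrite gtr0_norm.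
exact: near_eq_is_derive E nf.
Qed.

(** [powR_log_le] with the exponent [a / 2] given up to the logarithm. *)
Lemma log_decay (a e : R) : 0 < a -> 0 < e ->
  exists2 T : R, 1 < T & forall t, T <= t -> (1 + ln t) * t `^ (- a) <= e.
Proof.
move=> a0 e0; pose d := a / 2; have d0 : 0 < d by rewrite divr_gt0.
pose C := (1 + 2 / d) * 2; have C0 : 0 < C by rewrite mulr_gt0// addr_gt0// divr_gt0.
pose T := 1 + (1 + C / e) `^ d^-1; exists T.
  by rewrite ltrDl powR_gt0// addr_gt0// divr_gt0.
move=> t Tt; have t1 : 1 <= t by apply: le_trans Tt; rewrite lerDl powR_ge0.
have t0 : 0 < t by exact: lt_le_trans t1.
have lt0 : 0 <= ln t by rewrite ln_ge0.
have hx : - a <= - a <= - a by rewrite lexx.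
have := powR_log_le d0 hx t0; rewrite (ger0_norm lt0) [_ `^ _ * _]mulrC => /le_trans; apply.
have h1 : t `^ (- a - d) <= t `^ (- d) by rewrite ler_powR//; rewrite /d; lra.
have h2 : t `^ (- a + d) = t `^ (- d) by congr (_ `^ _); rewrite /d; lra.
apply: (@le_trans _ _ (C * t `^ (- d))).
  rewrite /C -mulrA; apply: ler_wpM2l; first by rewrite addr_ge0// divr_ge0// ltW.
  by rewrite h2; lra.
rewrite powRN ler_pdivrMr ?powR_gt0// -ler_pdivrMl// mulrC.
have : ((1 + C / e) `^ d^-1) `^ d <= t `^ d.
  apply: ge0_ler_powR; rewrite ?nnegrE ?powR_ge0 ?(ltW d0) ?(ltW t0)//.
  by apply: le_trans Tt; rewrite lerDr.
rewrite -powRrM mulVf ?gt_eqF// powRr1 ?addr_ge0 ?divr_ge0 ?(ltW C0) ?(ltW e0)//.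
by apply: le_trans; rewrite lerDr.
Qed.

Variables (F : R -> R -> R) (A dA : R -> R) (Q dQ : R -> R -> R).
Variables (K b0 b1 al0 al1 rho c mm : R).
Hypotheses (mm0 : 0 < mm) (rho1 : 1 < rho) (cn : c != 0).
Hypotheses (b00 : 0 < b0) (b0al : b0 < al0) (al01 : al0 <= al1) (al1b : al1 < b1) (K0 : 0 <= K).
Hypothesis FE : forall al t, 1 <= t -> b0 < al < b1 ->
  F al t = c * t `^ (- (mm * al)) * (A al + Q al t).
Hypothesis A_d : forall al, b0 < al < b1 -> is_derive al 1 A (dA al).
Hypothesis A_neq0 : forall al, al0 <= al <= al1 -> A al != 0.
Hypothesis AQ : forall t al, 1 <= t -> b0 < al < b1 ->
  [/\ `|dA al| <= K, `|Q al t| <= K * t `^ (- al), is_derive al 1 (Q ^~ t) (dQ al t) &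
      `|dQ al t| <= K * ((1 + ln t) * t `^ (- al))].

Let h t := (1 + ln t) * t `^ (- al0).
Let ratio al t := F al (rho * t) / F al t.
(** [N] is the observation freed of its leading decay, [eps1] and [eps2] are the two
    error terms: the quotient [N al (rho * t) / N al t] minus 1, and the difference
    of the logarithmic derivatives of numerator and denominator. *)
Let N al t := A al + Q al t.
Let eps1 al t := (Q al (rho * t) - Q al t) / N al t.
Let eps2 al t := (dQ al (rho * t) - dQ al t) / N al (rho * t) +
  (dA al + dQ al t) * (Q al t - Q al (rho * t)) / (N al t * N al (rho * t)).

Let inJ al : al0 <= al <= al1 -> b0 < al < b1.
Proof. by move=> /andP[h1 h2]; rewrite (lt_le_trans b0al h1) (le_lt_trans h2 al1b). Qed.

Let rho_t t : 1 <= t -> t <= rho * t.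
Proof. by move=> t1; rewrite ler_peMl ?(ltW rho1)// (le_trans ler01). Qed.

(** Compactness of the interval of orders turns the pointwise non-vanishing of [A]
    into a uniform bound. *)
Lemma leading_lower_bound : exists2 c0 : R, 0 < c0 & forall al, al0 <= al <= al1 -> c0 <= `|A al|.
Proof.
have cA : {within `[al0, al1], continuous (fun al => `|A al|)}.
  apply: (@continuous_in_subspaceT _ _ `[al0, al1]%classic) => x; rewrite inE/= in_itv/= => hx.
  by apply: cvg_norm; exact: isd_continuous (A_d (inJ hx)).
have [x xI hx] := EVT_min al01 cA.
exists `|A x|; first by rewrite normr_gt0 A_neq0//; rewrite in_itv/= in xI.
by move=> al hal; apply: hx; rewrite in_itv.
Qed.

(** Valid even where [N al t] vanishes, since both quotients are then 0; so it can be
    differentiated in [al] without first finding a neighbourhood free of zeros. *)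
Lemma ratioE al t : 1 <= t -> b0 < al < b1 ->
  ratio al t = rho `^ (- (mm * al)) * (N al (rho * t) * (N al t)^-1).
Proof.
move=> t1 hal; have t0 : 0 < t by exact: lt_le_trans t1.
have r0 : 0 < rho by exact: lt_trans rho1.
have tn : t `^ (- (mm * al)) != 0 by rewrite gt_eqF// powR_gt0.
rewrite /ratio !FE ?(le_trans t1)// ?rho_t// powRM ?(ltW t0) ?(ltW r0)//.
rewrite -/(N al t) -/(N al (rho * t)) !invfM.
set X := rho `^ _; set Y := t `^ _ in tn *; set Z := (N al t)^-1.
by field; rewrite cn tn.
Qed.

Let small t al c0 : 1 <= t -> K * h t <= c0 / 2 -> c0 <= `|A al| -> al0 <= al <= al1 ->
  c0 / 2 <= `|N al t|.
Proof.
move=> t1 hK hA hal; have [_ hQ _ _] := AQ t1 (inJ hal).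
have t0 : 0 < t by exact: lt_le_trans t1.
have lt0 : 0 <= ln t by rewrite ln_ge0.
have : `|Q al t| <= c0 / 2.
  apply: le_trans hQ (le_trans _ hK); apply: ler_wpM2l => //.
  apply: (@le_trans _ _ (t `^ (- al0))); first by rewrite ler_powR// lerN2; case/andP: hal.
  by rewrite /h ler_peMl ?powR_ge0// lerDl.
have := ler_normD (A al + Q al t) (- Q al t); rewrite addrK normrN -/(N al t); lra.
Qed.

Let Q_bounds t al : 1 <= t -> al0 <= al <= al1 ->
  [/\ `|Q al t| <= K * t `^ (- al0), `|Q al (rho * t)| <= K * t `^ (- al0),
      `|dQ al t| <= K * h t & `|dQ al (rho * t)| <= K * (1 + ln rho) * h t].
Proof.
move=> t1 hal; have t0 : 0 < t by exact: lt_le_trans t1.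
have r0 : 0 < rho by exact: lt_trans rho1.
have rt1 : 1 <= rho * t by rewrite (le_trans t1)// rho_t.
have lt0 : 0 <= ln t by rewrite ln_ge0.
have lr0 : 0 <= ln rho by rewrite ln_ge0// ltW.
have [_ h1 _ h2] := AQ t1 (inJ hal); have [_ h3 _ h4] := AQ rt1 (inJ hal).
have p1 : t `^ (- al) <= t `^ (- al0) by rewrite ler_powR// lerN2; case/andP: hal.
have p2 : (rho * t) `^ (- al) <= t `^ (- al0).
  apply: le_trans p1; rewrite !powRN lef_pV2 ?posrE ?powR_gt0 ?mulr_gt0//.
  have al_ge0 : 0 <= al by case/andP: (inJ hal) => /(lt_trans b00)/ltW.
  by apply: ge0_ler_powR; rewrite ?nnegrE ?rho_t// ltW// mulr_gt0.
split.
- by apply: le_trans h1 _; rewrite ler_wpM2l.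
- by apply: le_trans h3 _; rewrite ler_wpM2l.
- by apply: le_trans h2 _; rewrite ler_wpM2l// ler_wpM2l// addr_ge0.
- apply: le_trans h4 _; rewrite -mulrA ler_wpM2l// /h mulrA.
  apply: ler_pM => //; rewrite ?powR_ge0//.
    by rewrite addr_ge0// ln_ge0.
  by rewrite lnM ?posrE//; nra.
Qed.

Let H_ge t : 1 <= t -> t `^ (- al0) <= h t.
Proof. by move=> t1; rewrite /h ler_peMl ?powR_ge0// lerDl ln_ge0. Qed.

(** For large [t] the correction [Q] is at most half of the lower bound of [A], so
    that [N] is bounded below; both error terms are then controlled by the corrections
    at [t] and [rho * t] and by their derivatives. *)
Lemma log_ratio_asymptotics :
  exists eps1 eps2 : R -> R -> R, exists2 T : R, 1 < T & exists2 C : R, 0 <= C &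
  forall t al, T <= t -> al0 <= al <= al1 ->
  [/\ F al t != 0 /\ F al (rho * t) != 0,
      `|eps1 al t| <= C * t `^ (- al0),
      ratio al t = rho `^ (- (mm * al)) * (1 + eps1 al t),
      `|eps2 al t| <= C * h t &
      is_derive al 1 (fun b => ln `|ratio b t|) (- (mm * ln rho) + eps2 al t)].
Proof.
exists eps1, eps2; have [c0 c00 hc0] := leading_lower_bound.
have a00 : 0 < al0 by exact: lt_trans b0al.
have K1 : 0 < K + 1 by rewrite ltr_wpDl.
have e0 : 0 < Num.min (c0 / 2) 1 / (K + 1) by rewrite divr_gt0// lt_min ltr01 divr_gt0.
have [T T1 hT] := log_decay a00 e0; exists T => //.
have lr0 : 0 <= ln rho by rewrite ln_ge0// ltW.
have r0 : 0 < rho by exact: lt_trans rho1.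
have Kh t : T <= t -> K * h t <= Num.min (c0 / 2) 1.
  move=> Tt; have := hT t Tt; rewrite ler_pdivlMr// mulrC; apply: le_trans.
  apply: ler_wpM2r; last by rewrite lerDl.
  by rewrite mulr_ge0 ?powR_ge0// addr_ge0// ln_ge0// (le_trans (ltW T1)).
pose d := (c0 / 2)^-1; have d0 : 0 < d by rewrite invr_gt0 divr_gt0.
pose C := K * (2 + ln rho) * d + (K + 1) * (2 * K) * (d * d) + 2 * K * d.
have d0' := ltW d0.
have P1 : 0 <= K * (2 + ln rho) * d by do 2 (apply: mulr_ge0 => //); rewrite addr_ge0.
have P2 : 0 <= (K + 1) * (2 * K) * (d * d).
  by apply: mulr_ge0; [apply: mulr_ge0; [exact: ltW|exact: mulr_ge0]|exact: mulr_ge0].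
have P3 : 0 <= 2 * K * d by do 2 (apply: mulr_ge0 => //).
exists C; first by rewrite /C !addr_ge0.
move=> t al Tt hal; have t1 : 1 <= t by exact: le_trans (ltW T1) Tt.
have t0 : 0 < t by exact: lt_le_trans t1.
have rt1 : 1 <= rho * t by rewrite (le_trans t1)// rho_t.
have rtT : T <= rho * t by rewrite (le_trans Tt)// rho_t.
have hK : K * h t <= c0 / 2 by move: (Kh t Tt); rewrite le_min => /andP[].
have hK1 : K * h t <= 1 by move: (Kh t Tt); rewrite le_min => /andP[].
have hK' : K * h (rho * t) <= c0 / 2 by move: (Kh _ rtT); rewrite le_min => /andP[].
have n1 := small t1 hK (hc0 _ hal) hal; have n2 := small rt1 hK' (hc0 _ hal) hal.
have c20 : 0 < c0 / 2 by rewrite divr_gt0.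
have N1 : N al t != 0 by rewrite -normr_gt0 (lt_le_trans c20).
have N2 : N al (rho * t) != 0 by rewrite -normr_gt0 (lt_le_trans c20).
have i1 : `|(N al t)^-1| <= d by rewrite normfV lef_pV2 ?posrE ?normr_gt0.
have i2 : `|(N al (rho * t))^-1| <= d by rewrite normfV lef_pV2 ?posrE ?normr_gt0.
have [q1 q2 q3 q4] := Q_bounds t1 hal.
have pw := powR_ge0 t (- al0); have hg := H_ge t1.
have h0 : 0 <= h t by exact: le_trans hg.
have hJ := inJ hal.
have [dA1 _ dQ1 _] := AQ t1 hJ; have [_ _ dQ2 _] := AQ rt1 hJ.
have dN1 := isd_add (A_d hJ) dQ1; have dN2 := isd_add (A_d hJ) dQ2.
split.
- by rewrite !FE// !mulf_neq0// gt_eqF// powR_gt0// mulr_gt0.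
- rewrite /eps1 normrM; apply: (@le_trans _ _ (2 * K * t `^ (- al0) * d)).
    apply: ler_pM => //; apply: le_trans (ler_normB _ _) _.
    by apply: le_trans (lerD q2 q1) _; lra.
  rewrite mulrAC; apply: ler_wpM2r => //; rewrite /C lerDr addr_ge0//.
- rewrite ratioE//; congr (_ * _); rewrite /eps1 -[1](divff N1) -mulrDl.
  by congr (_ / _); rewrite /N; ring.
- rewrite /eps2; apply: le_trans (ler_normD _ _) _.
  apply: (@le_trans _ _ (K * (2 + ln rho) * d * h t + (K + 1) * (2 * K) * (d * d) * h t)); last first.
    by rewrite -mulrDl; apply: ler_wpM2r => //; rewrite /C lerDl.
  apply: lerD.
    rewrite normrM [leRHS]mulrAC; apply: ler_pM => //; apply: le_trans (ler_normB _ _) _.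
    by apply: le_trans (lerD q4 q3) _; lra.
  have -> : (K + 1) * (2 * K) * (d * d) * h t = (K + 1) * (2 * K * h t) * (d * d) by ring.
  rewrite invfM normrM normrM normrM; apply: ler_pM; [by rewrite mulr_ge0|by rewrite mulr_ge0| |].
    apply: ler_pM => //.
      by apply: le_trans (ler_normD _ _) _; apply: lerD => //; exact: le_trans hK1.
    apply: le_trans (ler_normB _ _) _; apply: le_trans (lerD q1 q2) _.
    have : K * t `^ (- al0) <= K * h t by rewrite ler_wpM2l.
    lra.
  by apply: ler_pM.
- have dr : is_derive al 1 (fun b => rho `^ (- (mm * b))) (- (mm * ln rho) * rho `^ (- (mm * al))).
    apply: (is_derive_eq (@isd_comp _ (fun x => rho `^ x) (fun b => - (mm * b)) al _ _
      (isd_powR_exp _ r0) (isd_opp (isd_scale mm (@is_derive_id _ _ al 1))))).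
    by ring.
  have dR := isd_mul dr (isd_mul dN2 (@isd_inv _ (N ^~ t) al _ N1 dN1)).
  have pr : rho `^ (- (mm * al)) != 0 by rewrite gt_eqF// powR_gt0.
  have nz : rho `^ (- (mm * al)) * (N al (rho * t) * (N al t)^-1) != 0.
    by rewrite !mulf_neq0// invr_eq0.
  have dL := @is_derive_ln_norm (fun b => rho `^ (- (mm * b)) * (N b (rho * t) * (N b t)^-1)) al _ nz dR.
  have E : \forall b \near al, ln `|rho `^ (- (mm * b)) * (N b (rho * t) * (N b t)^-1)| = ln `|ratio b t|.
    have hJ' : al \in `]b0, b1[ by rewrite in_itv.
    by have := near_in_itvoo hJ'; apply: filterS => y; rewrite in_itv/= => hy; rewrite ratioE.
  apply: (near_eq_is_derive E); apply: (is_derive_eq dL).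
  rewrite /eps2 -/(N al (rho * t)); move: pr N1 N2; rewrite /N; set X := rho `^ _ => X0 N1 N2.
  by field; rewrite X0 N1 N2.
Qed.

End log_ratio.

(** * From the derivative to stability *)

Section slope.
Context {R : realType}.

Lemma derivative_slope_bound (f df : R -> R) (x0 x1 k : R) :
  (forall x, x0 <= x <= x1 -> is_derive x 1 f (df x)) ->
  (forall x, x0 <= x <= x1 -> df x <= - k) ->
  forall x y, x0 <= x -> x < y -> y <= x1 -> k * (y - x) <= f x - f y.
Proof.
move=> hd hk x y x0x xy yx1.
have inI z : x <= z <= y -> x0 <= z <= x1.
  by move=> /andP[h1 h2]; rewrite (le_trans x0x h1) (le_trans h2 yx1).
have cf : {within `[x, y], continuous f}.
  apply: (@continuous_in_subspaceT _ _ `[x, y]%classic) => z; rewrite inE/= in_itv/= => hz.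
  exact: isd_continuous (hd _ (inI _ hz)).
have [|z zI E] := @MVT _ f df _ _ xy _ cf.
  by move=> z; rewrite in_itv/= => /andP[h1 h2]; apply: hd; apply: inI; rewrite !ltW.
have hz : df z <= - k.
  by apply: hk; apply: inI; move: zI; rewrite in_itv/= => /andP[h1 h2]; rewrite !ltW.
have d0 : 0 < y - x by rewrite subr_gt0.
by rewrite -[leRHS]opprB E -mulNr ler_pM2r// lerNr.
Qed.

End slope.

(** * Reindexing of the eigenvalues *)

Section reduction.
Context {R : realType}.
Variables (dim : option nat) (a lam : nat -> R).
Hypothesis hlam : eigenvalue_list dim lam.
Hypothesis ha : (\sum_(0 <= n <oo | below dim n) (`|a n| / lam n)%:E < +oo)%E.

(** The meaningless indices carry the coefficient 0 and the level 1: the sums are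
    unchanged, and the levels are bounded below at every index. *)
Definition coef n : R := if below dim n then a n else 0.
Definition level n : R := if below dim n then lam n else 1.

Lemma level_lower_bound : exists2 l0 : R, 0 < l0 & forall n, l0 <= level n.
Proof.
have [l1 l2 _] := hlam.
exists (Num.min (level 0%N) 1).
  by rewrite lt_min ltr01 andbT /level; case: ifP => // /l1.
move=> n; rewrite ge_min /level; have [hn|_] := boolP (below dim n); last by rewrite lexx orbT.
have h0 : below dim 0 by move: hn; rewrite /below; case: (dim) => // N; exact: leq_ltn_trans.
by rewrite h0 l2.
Qed.

Lemma series_below (u v : nat -> R) : (forall n, v n = if below dim n then u n else 0) ->
  \big[+%R/0]_(0 <= n <oo | below dim n) u n = limn (series v).
Proof.
move=> uv; congr (limn _); apply/funext => N; rewrite /series/= big_mkcond/=.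
by apply: eq_bigr => n _; rewrite uv.
Qed.

Lemma abs_summable_coef : abs_summable (fun n => coef n * (level n)^-1).
Proof.
have [l1 _ _] := hlam.
have f0 n : below dim n -> (0 <= (`|a n| / lam n)%:E)%E.
  by move=> hn; rewrite lee_fin divr_ge0// ltW// l1.
have sf : summable (below dim) (fun n => (`|a n| / lam n)%:E).
  rewrite /summable -nneseries_esum; last by move=> n _; exact: abse_ge0.
  rewrite (eq_eseriesr (g := fun n => (`|a n| / lam n)%:E))// => n hn.
  by rewrite gee0_abs// f0.
have := summable_cvg f0 sf; rewrite /abs_summable.
suff -> : series (fun n => `|coef n * (level n)^-1|) =
  (fun N => \sum_(0 <= n < N | below dim n) fine (`|a n| / lam n)%:E) by [].
apply/funext => N; rewrite /series/= [RHS]big_mkcond/=; apply: eq_bigr => n _.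
rewrite /coef /level; case: ifP => hn; last by rewrite mul0r normr0.
by rewrite normrM normfV (gtr0_norm (l1 n hn)).
Qed.

Lemma resolvent_momentE k : resolvent_moment dim a lam k = moment coef level k.
Proof.
apply: series_below => n; rewrite /coef /level; case: ifP => _; last by rewrite mul0r.
by rewrite exprVn.
Qed.

Lemma observationE al t : observation dim a lam al t = spectral_sum coef level al t.
Proof.
by apply: series_below => n; rewrite /coef /level; case: ifP => _ //; rewrite mul0r.
Qed.

End reduction.

Theorem theorem5p1 (R : realType)
    (H : completeNormedModType R) (dot : {dot H for idfun})
    (hnorm : hilbert_norm dot) (hsep : separable H)
    (D : set H) (A : H -> H)
    (hsa : self_adjoint dot D A) (hpos : strictly_positive dot D A)
    (hres : has_compact_resolvent D A)
    (dim : option nat) (lam : nat -> R) (v : nat -> H)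
    (hlam : eigenvalue_list dim lam) (hv : eigenbasis dot D A dim lam v)
    (a : nat -> R)
    (ha : (\sum_(0 <= n <oo | below dim n) (`|a n| / lam n)%:E < +oo)%E)
    (alpha0 alpha1 : R)
    (h0 : 0 < alpha0) (h01 : alpha0 <= alpha1) (h1 : alpha1 < 1)
    (m : nat) (hm : (1 <= m)%N)
    (hS0 : forall k, (1 <= k < m)%N -> resolvent_moment dim a lam k = 0)
    (hSm : resolvent_moment dim a lam m != 0)
    (hc : forall alpha, alpha \in `[alpha0, alpha1] -> leading_coef m alpha != 0)
    (rho : R) (hrho : 1 < rho) :
  let I := [set` `[alpha0, alpha1]] : set R in
  let M := observation dim a lam in
  let Rt := observation_ratio dim a lam in
  (exists T : R,
    [/\ 1 < T,
        forall t, T <= t -> forall alpha, I alpha ->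
          M alpha t != 0 /\ M alpha (rho * t) != 0,
        exists2 eps : R -> R -> R,
          uniform_bigO I eps (fun t => t `^ (- alpha0)) &
          forall t, T <= t -> forall alpha, I alpha ->
            Rt alpha t rho = rho `^ (- (m%:R * alpha)) * (1 + eps alpha t) &
        exists2 eps : R -> R -> R,
          uniform_bigO I eps (fun t => (1 + ln t) * t `^ (- alpha0)) &
          forall t, T <= t -> forall alpha, I alpha ->
            is_derive alpha 1 (fun b : R => ln `|Rt b t rho|)
              (- (m%:R * ln rho) + eps alpha t)]) /\
  (\forall t \near +oo,
    (forall alpha alpha', I alpha -> I alpha' -> alpha < alpha' ->
      ln `|Rt alpha' t rho| < ln `|Rt alpha t rho|) /\
    (forall alpha alpha', I alpha -> I alpha' ->
      `|alpha - alpha'| <=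
        2 / (m%:R * ln rho) *
          `|ln `|Rt alpha t rho| - ln `|Rt alpha' t rho| |)).
Proof.
case: m hm hS0 hSm hc => // p _ hS0 hSm hc I M Rt.
set b := coef dim a; set l := level dim lam.
have [l0 l00 l0l] := level_lower_bound hlam.
have sb : abs_summable (fun n => b n * (l n)^-1) by exact: abs_summable_coef.
(* The asymptotics hold on an open interval around [[alpha0, alpha1]], which gives
   two-sided derivatives at the end points. *)
have b00 : 0 < alpha0 / 2 by rewrite divr_gt0.
have b0a : alpha0 / 2 < alpha0 by lra.
have ab1 : alpha1 < (alpha1 + 1) / 2 by lra.
have b11 : (alpha1 + 1) / 2 < 1 by lra.
have b01 : alpha0 / 2 < (alpha1 + 1) / 2 by lra.
have S0 k : (1 <= k < p.+1)%N -> moment b l k = 0.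
  by move=> hk; rewrite -resolvent_momentE hS0.
have Sn : moment b l p.+1 != 0 by rewrite -resolvent_momentE.
have m0 : 0 < p.+1%:R :> R by rewrite ltr0n.
have lr0 : 0 < ln rho by rewrite ln_gt0.
have pn : (pi : R)^-1 != 0 by rewrite invr_eq0 gt_eqF// pi_gt0.
have [K K0 hK] := leading_bounds l00 l0l sb b00 b01 b11 p.
have [eps1 [eps2 [T T1 [C C0 hT]]]] := @log_ratio_asymptotics R M (leading b l p) (leading_d b l p)
  (correction b l p) (correction_d b l p) K _ _ alpha0 alpha1 rho pi^-1 p.+1%:R
  hrho pn b00 b0a h01 ab1 K0
  (fun al t t1 hal => etrans (observationE dim a lam al t)
     (spectral_sum_leading l00 l0l sb b00 b01 b11 S0 t1 hal))
  (fun al hal => is_derive_leading b l p (lt_trans b00 (proj1 (andP hal))))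
  (fun al hal => leading_neq0 (lt_le_trans h0 (proj1 (andP hal))) Sn (hc al hal))
  hK.
have II alpha : I alpha -> alpha0 <= alpha <= alpha1 by rewrite /I/= in_itv.
have nearT (T' : R) (P : R -> Prop) : (forall t, T' <= t -> P t) -> \forall t \near +oo, P t.
  by move=> h; exists T'; split; [exact: num_real|move=> t /ltW; exact: h].
have h_ge0 t : T <= t -> 0 <= (1 + ln t) * t `^ (- alpha0).
  by move=> Tt; rewrite mulr_ge0 ?powR_ge0// addr_ge0// ln_ge0// (le_trans (ltW T1)).
split.
  exists T; split => //.
  - by move=> t Tt al /II hal; have [] := hT t al Tt hal.
  - exists eps1.
      exists C; apply: (nearT T) => t Tt al /II hal; have [_ h _ _ _] := hT t al Tt hal.
      by rewrite [X in C * X]ger0_norm ?powR_ge0.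
    by move=> t Tt al /II hal; have [] := hT t al Tt hal.
  - exists eps2.
      exists C; apply: (nearT T) => t Tt al /II hal; have [_ _ _ h _] := hT t al Tt hal.
      by rewrite [X in C * X]ger0_norm ?h_ge0.
    by move=> t Tt al /II hal; have [] := hT t al Tt hal.
pose k := p.+1%:R * ln rho; have k0 : 0 < k by rewrite mulr_gt0.
(* From this threshold on, the error in the derivative is below half of its leading
   term [- k]; this is where the factor 2 of the stability estimate comes from. *)
have e0 : 0 < k / 2 / (C + 1) by rewrite divr_gt0 ?divr_gt0// ltr_wpDl.
have [T2 T21 hT2] := log_decay h0 e0.
apply: (nearT (Num.max T T2)) => t; rewrite ge_max => /andP[Tt T2t].
have slope al : alpha0 <= al <= alpha1 -> - k + eps2 al t <= - (k / 2).
  move=> hal; have [_ _ _ h _] := hT t al Tt hal.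
  have h2 := hT2 t T2t; rewrite ler_pdivlMr ?ltr_wpDl// in h2.
  have h3 := h_ge0 t Tt; have h4 := le_trans (ler_norm _) h; lra.
have dec al al' : I al -> I al' -> al < al' ->
    k / 2 * (al' - al) <= ln `|Rt al t rho| - ln `|Rt al' t rho|.
  move=> /II/andP[h2 _] /II/andP[_ h3] h4.
  apply: (@derivative_slope_bound _ (fun b => ln `|Rt b t rho|) (fun al => - k + eps2 al t) alpha0 alpha1) => //.
  by move=> x hx; have [] := hT t x Tt hx.
split=> [al al' Ial Ial' lt_al|].
  rewrite -subr_gt0; apply: lt_le_trans (dec _ _ Ial Ial' lt_al).
  by rewrite mulr_gt0 ?divr_gt0// subr_gt0.
have dist al al' : I al -> I al' -> al < al' -> `|al - al'| <=
    2 / k * `|ln `|Rt al t rho| - ln `|Rt al' t rho| |.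
  move=> Ial Ial' lt_al; have h := dec _ _ Ial Ial' lt_al.
  have d0 : 0 < al' - al by rewrite subr_gt0.
  rewrite distrC gtr0_norm// -[2 / k]invf_div ler_pdivlMl ?divr_gt0//.
  exact: le_trans h (ler_norm _).
move=> al al' Ial Ial'; have [lt_al|lt_al|->] := ltgtP al al'.
- exact: dist.
- by rewrite distrC [X in _ * X]distrC; exact: dist.
- by rewrite subrr normr0 mulr_ge0// divr_ge0// ltW.
Qed.
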